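(* Fix an integer $k>0$ and let $1$, $\delta$, $\bar\delta$ denote the trivial, $\det$, and $\overline{\det}$ characters of $GL_k(\mathbb{C})$. Then for all integers $i>0$ and all integers $j$ there exist non-zero intertwining operators of $GL_{2k}(\mathbb{C})$-representations $$1\times\delta^i\bar\delta^j\;\to\;\delta^i\times\bar\delta^j,\qquad 1\times\bar\delta^i\delta^j\;\to\;\bar\delta^i\times\delta^j .$$
   Context: For characters $\chi_1,\chi_2$ of $GL_k(\mathbb{C})$, let $P=P_{k,k}\subset GL_{2k}(\mathbb{C})$ be the subgroup of block upper triangular matrices $x=\begin{pmatrix}x_{11}&x_{12}\\0&x_{22}\end{pmatrix}$ with $k\times k$ blocks, with modular function $\Delta_P(x)=\nu(\det x_{11})^{k}\nu(\det x_{22})^{-k}$, where $\nu(z)=z\bar z$ for $z\in\mathbb{C}^\times$. Then $\chi_1\times\chi_2$ denotes the normalized induced representation: $GL_{2k}(\mathbb{C})$ acts by right translation $(R_gf)(y)=f(yg)$ on the space of smooth (in the real sense) functions $f$ on $GL_{2k}(\mathbb{C})$ with $f(xy)=\chi_1(x_{11})\chi_2(x_{22})\Delta_P^{1/2}(x)f(y)$ for all $x\in P$, $y\in GL_{2k}(\mathbb{C})$. Intertwining operators are continuous equivariant linear maps. *)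

(* Defs.v *)
From HB Require Import structures.
From mathcomp Require Import all_boot all_order all_algebra.
From mathcomp Require Import complex.
From mathcomp Require Import all_classical all_reals all_analysis.

Set Implicit Arguments.
Unset Strict Implicit.
Unset Printing Implicit Defensive.

Import Order.TTheory GRing.Theory Num.Theory numFieldNormedType.Exports.

Local Open Scope classical_set_scope.
Local Open Scope ring_scope.
Local Open Scope complex_scope.

(* R[i] itself carries no topology; seen as a numeric field, it inherits the one
   given by its norm. *)
Definition Cplx (R : realType) : numClosedFieldType := R[i].

Definition ofreal (R : realType) (t : R) : Cplx R := t%:C.

(* GL_n(C), with the topology induced from 'M[C]_n. *)
Definition GL (R : realType) (n : nat) : Type :=
  set_type [set A : 'M[Cplx R]_n | A \in unitmx].

HB.instance Definition _ (R : realType) (n : nat) :=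
  Topological.copy (GL R n) (set_type [set A : 'M[Cplx R]_n | A \in unitmx]).
HB.instance Definition _ (R : realType) (n : nat) :=
  SubChoice.copy (GL R n) (set_type [set A : 'M[Cplx R]_n | A \in unitmx]).

Definition GLmx (R : realType) (n : nat) (g : GL R n) : 'M[Cplx R]_n := val g.

Section GLGroup.
Variables (R : realType) (n : nat).
Implicit Types g h : GL R n.

Lemma GLmx_inj : injective (@GLmx R n).
Proof. exact: val_inj. Qed.

Lemma GLmx_unit g : GLmx g \in unitmx.
Proof. by have := valP g; rewrite inE. Qed.

Definition toGL (A : 'M[Cplx R]_n) (uA : A \in unitmx) : GL R n :=
  exist (fun B : 'M[Cplx R]_n => B \in [set B | B \in unitmx]) A (mem_set uA).

Lemma GLmul_subproof g h : GLmx g *m GLmx h \in unitmx.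
Proof. by rewrite unitmx_mul !GLmx_unit. Qed.

Lemma GLinv_subproof g : invmx (GLmx g) \in unitmx.
Proof. by rewrite unitmx_inv GLmx_unit. Qed.

Definition GLone : GL R n := toGL (unitmx1 (Cplx R) n).
Definition GLmul g h : GL R n := toGL (GLmul_subproof g h).
Definition GLinv g : GL R n := toGL (GLinv_subproof g).

Fact GLmulA : associative GLmul.
Proof. by move=> x y z; apply: GLmx_inj; rewrite /GLmx /= mulmxA. Qed.
Fact GLmul1g : left_id GLone GLmul.
Proof. by move=> x; apply: GLmx_inj; rewrite /GLmx /= mul1mx. Qed.
Fact GLmulg1 : right_id GLone GLmul.
Proof. by move=> x; apply: GLmx_inj; rewrite /GLmx /= mulmx1. Qed.
Fact GLmulVg : left_inverse GLone GLinv GLmul.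
Proof.
by move=> x; apply: GLmx_inj; rewrite /GLmx /= mulVmx //; exact: GLmx_unit.
Qed.
Fact GLmulgV : right_inverse GLone GLinv GLmul.
Proof.
by move=> x; apply: GLmx_inj; rewrite /GLmx /= mulmxV //; exact: GLmx_unit.
Qed.

HB.instance Definition _ :=
  isGroup.Build (GL R n) GLmulA GLmul1g GLmulg1 GLmulVg GLmulgV.

Lemma GLmxM g h : GLmx (g * h)%g = GLmx g *m GLmx h.
Proof. by []. Qed.

End GLGroup.

Section Smooth.
Variables (R : realType) (n : nat).
Local Notation C := (Cplx R).
Implicit Types (f : GL R n -> C) (V : 'M[C]_n) (g h : GL R n).

(* Extension by 0 to all matrices. As GL_n(C) is open, the value outside it does
   not affect the limits below. *)
Definition ext0 f (A : 'M[C]_n) : C := oapp f 0 (insub A).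

Lemma ext0_GL f g : ext0 f (GLmx g) = f g.
Proof. by rewrite /ext0 /GLmx valK. Qed.

(* Difference quotient of f at g in the direction V; the parameter t is real. *)
Definition diffq f V g (t : R) : C :=
  (ofreal t)^-1 * (ext0 f (GLmx g + ofreal t *: V) - f g).

Definition rderivable f V g : Prop := cvg (diffq f V g t @[t --> (0 : R)^']).

Definition rderive f V g : C := lim (diffq f V g t @[t --> (0 : R)^']).

Definition rderive_seq (Vs : seq 'M[C]_n) f : GL R n -> C :=
  foldr (fun V u => rderive u V) f Vs.

(* C^oo in the real sense: all iterated real directional derivatives exist and
   are continuous. *)
Definition rsmooth f : Prop :=
  forall Vs : seq 'M[C]_n,
    continuous (rderive_seq Vs f) /\
    forall V g, rderivable (rderive_seq Vs f) V g.

Definition rtransl g f : GL R n -> C := fun y => f (y * g)%g.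

Lemma ext0_rtransl h f A : ext0 (rtransl h f) A = ext0 f (A *m GLmx h).
Proof.
rewrite /ext0; have [uA|nA] := boolP (A \in unitmx).
  have -> : A = val (toGL uA) by [].
  by rewrite valK /= -[_ *m _]/(val (toGL uA * h)%g) valK.
rewrite !insubF //.
- apply/negP; rewrite inE /= unitmx_mul => /andP[].
  by rewrite (negPf nA).
- by apply/negP; rewrite inE /= (negPf nA).
Qed.

Lemma diffq_rtransl h f V g :
  diffq (rtransl h f) V g = diffq f (V *m GLmx h) (g * h)%g.
Proof.
apply/funext => t; rewrite /diffq ext0_rtransl mulmxDl scalemxAl.
by rewrite GLmxM.
Qed.

Lemma rderive_seq_rtransl h Vs f :
  rderive_seq Vs (rtransl h f) =
  rtransl h (rderive_seq [seq V *m GLmx h | V <- Vs] f).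
Proof.
elim: Vs => //= V Vs ->; apply/funext => g.
by rewrite /rderive diffq_rtransl.
Qed.

Lemma GLmx_continuous : continuous (@GLmx R n).
Proof. exact: initial_continuous. Qed.

Lemma rtransl_continuous h : continuous (fun y : GL R n => (y * h)%g).
Proof.
suff ch : continuous (fun y : GL R n => GLmx (y * h)%g).
  move=> z U [_ [[W oW <-]] /= Wz sWU].
  have : nbhs z ((fun y => GLmx (y * h)%g) @^-1` W).
    by apply: (ch z W); exact: open_nbhs_nbhs.
  by apply: filterS => y; exact: sWU.
move=> y U [P nP sPU].
have Fy : Filter (nbhs y) by exact: nbhs_filter.
have : nbhs y [set x | forall i j, P i j (GLmx (x * h)%g i j)].
  refine (@filter_forall _ _ _ _ Fy _) => i.
  refine (@filter_forall _ _ _ _ Fy _) => j.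
  have cij : GLmx (x * h)%g i j @[x --> y] --> GLmx (y * h)%g i j.
    rewrite GLmxM mxE; under eq_fun do rewrite GLmxM mxE.
    apply: cvg_big => [|l _]; first exact: add_continuous.
    apply: cvgM; last exact: cvg_cst.
    apply: (continuous_comp (f := @GLmx R n) (g := fun A => A i l)).
      exact: GLmx_continuous.
    exact: coord_continuous.
  by apply: cij; exact: nP.
by apply: filterS => x Px; exact: sPU.
Qed.

Lemma rsmooth_rtransl h f : rsmooth f -> rsmooth (rtransl h f).
Proof.
move=> sf Vs; rewrite rderive_seq_rtransl.
have [cf df] := sf [seq V *m GLmx h | V <- Vs].
split=> [y|V g]; last by rewrite /rderivable diffq_rtransl; exact: df.
apply: (continuous_comp (f := fun y : GL R n => (y * h)%g)).
  exact: rtransl_continuous.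
exact: cf.
Qed.

Lemma diffq_linear (a : C) f1 f2 V g :
  diffq (fun x => a * f1 x + f2 x) V g =
  (fun t => a * diffq f1 V g t + diffq f2 V g t).
Proof.
apply/funext => t; rewrite /diffq /ext0; case: insub => [x|] /=.
  by rewrite (mulrCA a) -mulrDr; congr (_ * _); rewrite mulrBr opprD addrACA.
by rewrite (mulrCA a) -mulrDr; congr (_ * _); rewrite mulrBr mulr0 !add0r opprD.
Qed.

Lemma rderive_seq_linear (a : C) f1 f2 Vs : rsmooth f1 -> rsmooth f2 ->
  rderive_seq Vs (fun x => a * f1 x + f2 x) =
  (fun x => a * rderive_seq Vs f1 x + rderive_seq Vs f2 x).
Proof.
move=> s1 s2; elim: Vs => //= V Vs ->; apply/funext => g.
rewrite /rderive diffq_linear.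
have c12 : (a * diffq (rderive_seq Vs f1) V g t
            + diffq (rderive_seq Vs f2) V g t) @[t --> (0 : R)^'] -->
           (a * rderive (rderive_seq Vs f1) V g
            + rderive (rderive_seq Vs f2) V g).
  apply: cvgD; last exact: (s2 Vs).2.
  by apply: cvgM; [exact: cvg_cst | exact: (s1 Vs).2].
refine (cvg_lim _ c12); exact: norm_hausdorff.
Qed.

Lemma rsmooth_linear (a : C) f1 f2 : rsmooth f1 -> rsmooth f2 ->
  rsmooth (fun x => a * f1 x + f2 x).
Proof.
move=> s1 s2 Vs; rewrite rderive_seq_linear //; split=> [g|V g].
  apply: (@cvgD _ _ _ (nbhs g)); last exact: (s2 Vs).1.
  by apply: (@cvgM _ _ (nbhs g)); [exact: cvg_cst | exact: (s1 Vs).1].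
rewrite /rderivable diffq_linear; apply: is_cvgD; last exact: (s2 Vs).2.
by apply: is_cvgM; [exact: is_cvg_cst | exact: (s1 Vs).2].
Qed.

Lemma diffq0 V g : diffq (fun _ => 0) V g = (fun _ => 0).
Proof.
by apply/funext => t; rewrite /diffq /ext0; case: insub => *; rewrite subrr mulr0.
Qed.

Lemma rsmooth0 : rsmooth (fun _ => 0).
Proof.
have d0 Vs : rderive_seq Vs (fun _ => 0) = (fun _ => 0).
  elim: Vs => //= V Vs ->; apply/funext => g; rewrite /rderive diffq0.
  have c0 : (fun _ : R => 0 : C) t @[t --> (0 : R)^'] --> (0 : C).
    exact: cvg_cst.
  refine (cvg_lim _ c0); exact: norm_hausdorff.
move=> Vs; rewrite d0; split=> [g|V g]; first exact: cst_continuous.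
by rewrite /rderivable diffq0; exact: is_cvg_cst.
Qed.

End Smooth.

Section Induced.
Variables (R : realType) (k : nat).
Local Notation C := (Cplx R).

Lemma ublock_subproof (a d : GL R k) (b : 'M[C]_k) :
  block_mx (GLmx a) b 0 (GLmx d) \in unitmx.
Proof. by rewrite unitmxE det_ublock unitrM -!unitmxE !GLmx_unit. Qed.

(* The elements of the parabolic subgroup P_{k,k}. *)
Definition ublock (a d : GL R k) (b : 'M[C]_k) : GL R (k + k) :=
  toGL (ublock_subproof a d b).

Lemma ublockP (x : GL R (k + k)) :
  dlsubmx (GLmx x) = 0 <-> exists a d b, x = ublock a d b.
Proof.
split=> [x0|[a [d [b ->]]]]; last by rewrite /GLmx /= block_mxKdl.
have ex : GLmx x = block_mx (ulsubmx (GLmx x)) (ursubmx (GLmx x)) 0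
                            (drsubmx (GLmx x)) by rewrite -x0 submxK.
have := GLmx_unit x; rewrite ex unitmxE det_ublock unitrM => /andP[ua ud].
exists (toGL (ua : ulsubmx (GLmx x) \in unitmx)).
exists (toGL (ud : drsubmx (GLmx x) \in unitmx)).
by exists (ursubmx (GLmx x)); apply: GLmx_inj.
Qed.

Definition nu (z : C) : C := z * Num.conj z.

(* Delta_P at an element of P with diagonal blocks a and d. *)
Definition modulus (a d : GL R k) : C :=
  nu (\det (GLmx a)) ^+ k * nu (\det (GLmx d)) ^- k.

Variables chi1 chi2 : GL R k -> C.

Definition is_induced (f : GL R (k + k) -> C) : Prop :=
  rsmooth f /\
  forall (a d : GL R k) (b : 'M[C]_k) (y : GL R (k + k)),
    f (ublock a d b * y)%g = chi1 a * chi2 d * sqrtC (modulus a d) * f y.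

Definition induced_pred : {pred GL R (k + k) -> C} :=
  fun f => `[< is_induced f >].

(* The space of the normalized induced representation chi1 x chi2. *)
Record ind_rep : Type := IndRep {
  induced_fun :> GL R (k + k) -> C;
  _ : induced_fun \in induced_pred }.

HB.instance Definition _ := [isSub for induced_fun].
HB.instance Definition _ := [Choice of ind_rep by <:].

Lemma inducedP (f : ind_rep) : is_induced f.
Proof. exact/asboolP/(valP f). Qed.

Fact induced_submod_closed : submod_closed induced_pred.
Proof.
split=> [|c f1 f2 /asboolP[s1 e1] /asboolP[s2 e2]]; apply/asboolP; split.
- exact: rsmooth0.
- by move=> a d b y; rewrite mulr0.
- exact: rsmooth_linear.
move=> a d b y; change ((c *: f1 + f2) (ublock a d b * y)%g) with
  (c * f1 (ublock a d b * y)%g + f2 (ublock a d b * y)%g).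
change ((c *: f1 + f2) y) with (c * f1 y + f2 y).
by rewrite e1 e2 mulrDr mulrCA.
Qed.

HB.instance Definition _ := GRing.isSubmodClosed.Build C
  (GL R (k + k) -> C) induced_pred induced_submod_closed.
HB.instance Definition _ := [SubChoice_isSubLmodule of ind_rep by <:].

(* The C^oo topology: uniform convergence on compact sets of the functions and
   of each of their iterated derivatives. *)
Definition jet (f : ind_rep) :
    prod_topology (fun _ : seq 'M[C]_(k + k) => {family compact, GL R (k + k) -> C}) :=
  fun Vs => rderive_seq Vs f.

HB.instance Definition _ := Topological.copy ind_rep (initial_topology jet).

Fact induced_rtransl_subproof (g : GL R (k + k)) (f : ind_rep) :
  rtransl g f \in induced_pred.
Proof.
have [sf ef] := inducedP f; apply/asboolP; split; first exact: rsmooth_rtransl.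
by move=> a d b y; rewrite /rtransl -mulgA ef.
Qed.

Definition induced_rtransl (g : GL R (k + k)) (f : ind_rep) : ind_rep :=
  IndRep (induced_rtransl_subproof g f).

End Induced.

Definition intertwining (R : realType) (k : nat)
    (chi1 chi2 chi3 chi4 : GL R k -> Cplx R)
    (T : {linear ind_rep chi1 chi2 -> ind_rep chi3 chi4}) : Prop :=
  continuous T /\
  forall (g : GL R (k + k)) (f : ind_rep chi1 chi2),
    T (induced_rtransl g f) = induced_rtransl g (T f).

Definition triv (R : realType) (k : nat) (g : GL R k) : Cplx R := 1.
Definition delta (R : realType) (k : nat) (g : GL R k) : Cplx R :=
  \det (GLmx g).
Definition deltabar (R : realType) (k : nat) (g : GL R k) : Cplx R :=
  Num.conj (\det (GLmx g)).

(* Main.v *)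
(* Let D_pq be the holomorphic derivation f |-> d/dt f((1 + t E) y), where E is the
   elementary matrix at the entry (p, q) of the lower left k x k block.  These
   derivations commute with each other and with right translations, and the
   operator of the theorem is det(D_pq)^i; its complex conjugate gives the second
   one.

   The Levi subgroup acts on the D_pq by n |-> d^-1 n a, so det(D)^i changes the
   character by det(a)^i det(d)^-i.  Invariance under the upper unipotent subgroup
   is infinitesimal: moving an upper right elementary derivation through a
   polynomial P(D) applied to f gives the second order operator
     lam d_sq P - sum_(p,r) x_pr d_pq d_sr P      (lam = i - k)
   on the symbol P, and this kills det^i by the polarization identities
     sum_p x_pr d_pq det^i = i delta_qr det^i.
   To make sense of this for C^oo functions one needs that real directional
   derivatives are additive in the direction and commute, which both follow from
   the mean value inequality.

   Nonvanishing is tested at the identity on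
     |det y|^k det(Z1)^i det(Z2)^c conj(det Z2)^(j + c) det(Z Z^* )^-(k + c),
   where c = |j| and Z = (Z1 Z2) is the lower half of y.  Up to functions whose
   iterated D-derivatives all vanish at the identity, every factor but det(Z1)^i is
   constant, and the value is the Fischer norm of the polynomial det^i. *)

Require Import Defs.
From HB Require Import structures.
From mathcomp Require Import all_boot all_order all_algebra.
From mathcomp Require Import complex.
From mathcomp Require Import all_classical all_reals all_analysis.
From mathcomp Require Import -(notations) mpoly.
From mathcomp Require Import ring lra zify.

Set Implicit Arguments.
Unset Strict Implicit.
Unset Printing Implicit Defensive.

Import Order.TTheory GRing.Theory Num.Theory numFieldNormedType.Exports.

Local Open Scope classical_set_scope.
Local Open Scope ring_scope.

(** * Complex-valued functions of a real variable *)

(** The constant lam = i - k is met twice, and the normalization of the induction makes the two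
    values agree. On functions, the difference of two diagonal derivations acts on the source by i
    from the holomorphic power of the determinant, by 0 from the antiholomorphic power, and by -k
    from the square root of the modulus. On symbols, i comes from polarizing det^i, and -k from
    moving one derivation past k polarization operators. The exponent j does not enter lam, so it
    may be any integer.

    Only the unipotent radical is treated infinitesimally; the Levi part is a direct computation on
    symbols. Antiholomorphic upper right derivations commute with det(D)^i, so they annihilate the
    image as soon as they annihilate f.

    Smoothness is stated with real derivatives in constant directions, whereas D_pq has entries of y
    as coefficients; Wirtinger operators in constant directions bridge the two.

    A negative power of conj(det Z2) would be singular where det Z2 = 0; the shift by c = |j| in the
    test function removes it, and the power of the Gram determinant compensates. *)

Section Modulus.
Variable R : realType.
Local Notation C := (Cplx R).
Implicit Types (z w l : C) (s t e : R).

(** The norm of [Cplx R] takes values in [Cplx R] itself; the estimates and the mean value theorem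
    need a modulus in the ordered field [R]. *)
Definition cabs z : R := complex.Re `|z|.

Lemma cabsE z : `|z| = ofreal (cabs z).
Proof. by rewrite /cabs /ofreal normc_def. Qed.

Lemma ler_ofreal s t : (ofreal s <= ofreal t) = (s <= t).
Proof. exact: lecR. Qed.

Lemma ltr_ofreal s t : (ofreal s < ofreal t) = (s < t).
Proof. exact: ltcR. Qed.

Lemma ofrealD s t : ofreal (s + t) = ofreal s + ofreal t.
Proof. exact: (raddfD (real_complex R)). Qed.

Lemma ofrealM s t : ofreal (s * t) = ofreal s * ofreal t.
Proof. exact: (rmorphM (real_complex R)). Qed.

Lemma ofrealN t : ofreal (- t) = - ofreal t.
Proof. exact: (raddfN (real_complex R)). Qed.

Lemma ofreal0 : ofreal (0 : R) = 0.
Proof. by []. Qed.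

Lemma ofreal1 : ofreal (1 : R) = 1.
Proof. by []. Qed.

Lemma ofrealV t : ofreal t^-1 = (ofreal t)^-1.
Proof. exact: (fmorphV (real_complex R)). Qed.

Lemma ofreal_eq0 t : (ofreal t == 0) = (t == 0).
Proof. exact: (fmorph_eq0 (real_complex R)). Qed.

Lemma conj_ofreal t : Num.conj (ofreal t) = ofreal t.
Proof. by apply: CrealP; rewrite /ofreal complex_real. Qed.

Lemma cabs_ge0 z : 0 <= cabs z.
Proof. by rewrite -ler_ofreal -cabsE normr_ge0. Qed.

Lemma cabsD z w : cabs (z + w) <= cabs z + cabs w.
Proof. by rewrite -ler_ofreal ofrealD -!cabsE ler_normD. Qed.

Lemma cabsN z : cabs (- z) = cabs z.
Proof. by rewrite /cabs normrN. Qed.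

Lemma cabsM z w : cabs (z * w) = cabs z * cabs w.
Proof. by apply: complexI; rewrite -/(ofreal _) -cabsE normrM !cabsE -ofrealM. Qed.

Lemma cabs_ofreal t : cabs (ofreal t) = `|t|.
Proof. by rewrite /cabs /ofreal normc_def /= expr0n /= addr0 sqrtr_sqr. Qed.

Lemma cabs_lipschitz z w : `|cabs z - cabs w| <= cabs (z - w).
Proof.
have h1 := cabsD (z - w) w; have h2 := cabsD (w - z) z.
rewrite !subrK in h1 h2; rewrite -[cabs (w - z)]cabsN opprB in h2.
by rewrite ler_norml; apply/andP; split; lra.
Qed.

Lemma cabs_eq0 z : cabs z = 0 -> z = 0.
Proof. by move=> z0; apply/eqP; rewrite -normr_eq0 cabsE z0. Qed.

Lemma cabs0 : cabs (0 : C) = 0.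
Proof. by rewrite /cabs normr0. Qed.

Lemma complex_ReD z w : complex.Re (z + w) = complex.Re z + complex.Re w.
Proof. by case: z w => [? ?] [? ?]. Qed.

Lemma complex_ImD z w : complex.Im (z + w) = complex.Im z + complex.Im w.
Proof. by case: z w => [? ?] [? ?]. Qed.

Lemma complex_ReN z : complex.Re (- z) = - complex.Re z.
Proof. by case: z. Qed.

Lemma complex_ImN z : complex.Im (- z) = - complex.Im z.
Proof. by case: z. Qed.

Lemma complex_ReZ t z : complex.Re (ofreal t * z) = t * complex.Re z.
Proof. by case: z => a b /=; rewrite mul0r subr0. Qed.

Lemma complex_ImZ t z : complex.Im (ofreal t * z) = t * complex.Im z.
Proof. by case: z => a b /=; rewrite mul0r addr0. Qed.

Lemma Re_le_cabs z : `|complex.Re z| <= cabs z.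
Proof.
rewrite /cabs normc_def /= -[X in X <= _]sqrtr_sqr ler_wsqrtr //.
by rewrite lerDl sqr_ge0.
Qed.

Lemma Im_le_cabs z : `|complex.Im z| <= cabs z.
Proof.
rewrite /cabs normc_def /= -[X in X <= _]sqrtr_sqr ler_wsqrtr //.
by rewrite lerDr sqr_ge0.
Qed.

Lemma cabs_le_ReIm z : cabs z <= `|complex.Re z| + `|complex.Im z|.
Proof.
have {1}-> : z = ofreal (complex.Re z) + ofreal (complex.Im z) * 'i%C.
  by rewrite [LHS]complexE mulrC -/(ofreal _) -/(ofreal _) mulrC [X in _ + X]mulrC.
apply: le_trans (cabsD _ _) _; rewrite cabsM !cabs_ofreal.
suff -> : cabs ('i%C : C) = 1 by rewrite mulr1.
by rewrite /cabs normc_def /= expr0n /= add0r expr1n sqrtr1.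
Qed.

Lemma dnbhs0P (P : R -> Prop) :
  (\forall t \near (0 : R)^', P t) <->
  exists2 d : R, 0 < d & forall t, t != 0 -> `|t| < d -> P t.
Proof.
split.
  case/nbhs_ballP => d /= d0 sP; exists d => // t t0 td.
  by apply: sP => //; rewrite -ball_normE /= sub0r normrN.
case=> d d0 sP; apply/nbhs_ballP; exists d => // t.
by rewrite -ball_normE /= sub0r normrN => td t0; exact: sP.
Qed.

Lemma cplx_cvgP (T : Type) (F : set_system T) {FF : Filter F} (f : T -> C) l :
  f t @[t --> F] --> l <-> forall e : R, 0 < e -> \forall t \near F, cabs (f t - l) < e.
Proof.
split=> [/cvgrPdist_lt fl e e0|fl].
  have := fl (ofreal e); rewrite -ofreal0 ltr_ofreal => /(_ e0).
  by apply: filterS => t; rewrite distrC cabsE ltr_ofreal.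
apply/cvgrPdist_lt => e e0.
(* A number that is positive for the partial order of [Cplx R] is real, so real radii suffice. *)
have er : ofreal (complex.Re e) = e by apply: RRe_real; exact: gtr0_real.
have e0' : 0 < complex.Re e by rewrite -ltr_ofreal er.
by apply: filterS (fl _ e0') => t; rewrite distrC cabsE -er ltr_ofreal.
Qed.

Lemma cplx_cvg0P (f : R -> C) l :
  f t @[t --> (0 : R)^'] --> l <->
  forall e, 0 < e -> exists2 d, 0 < d &
    forall t, t != 0 -> `|t| < d -> cabs (f t - l) < e.
Proof.
split.
  by move/cplx_cvgP => fl e /fl /dnbhs0P.
by move=> fl; apply/cplx_cvgP => e /fl /dnbhs0P.
Qed.

Lemma cplx_cvg0_near (f g : R -> C) (l : C) (d : R) : 0 < d ->
  (forall t, t != 0 -> `|t| < d -> f t = g t) ->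
  f t @[t --> (0 : R)^'] --> l -> g t @[t --> (0 : R)^'] --> l.
Proof.
move=> d0 fg /cplx_cvg0P fl; apply/cplx_cvg0P => e /fl[d' d'0 H].
exists (Num.min d d') => [|t t0]; first by rewrite lt_min d0.
by rewrite lt_min => /andP[td td']; rewrite -fg//; exact: H.
Qed.

Lemma cplx_cvg0_eq (f g : R -> C) (l : C) : (forall t, t != 0 -> f t = g t) ->
  f t @[t --> (0 : R)^'] --> l -> g t @[t --> (0 : R)^'] --> l.
Proof. by move=> fg; apply: (cplx_cvg0_near ltr01) => t t0 _; exact: fg. Qed.

Lemma cplx_cvg0D (f g : R -> C) (l m : C) :
  f t @[t --> (0 : R)^'] --> l -> g t @[t --> (0 : R)^'] --> m ->
  f t + g t @[t --> (0 : R)^'] --> l + m.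
Proof. move=> fl gm; apply: cvgD; [exact: fl|exact: gm]. Qed.

Lemma cplx_cvg0M (f g : R -> C) (l m : C) :
  f t @[t --> (0 : R)^'] --> l -> g t @[t --> (0 : R)^'] --> m ->
  f t * g t @[t --> (0 : R)^'] --> l * m.
Proof. move=> fl gm; apply: cvgM; [exact: fl|exact: gm]. Qed.

Lemma cplx_cvg0V (f : R -> C) (l : C) : l != 0 ->
  f t @[t --> (0 : R)^'] --> l -> (f t)^-1 @[t --> (0 : R)^'] --> l^-1.
Proof. move=> l0 fl; apply: cvgV; [exact: l0|exact: fl]. Qed.

Lemma cplx_cvg0_cst (l : C) : l @[_ --> (0 : R)^'] --> l.
Proof. exact: cvg_cst. Qed.

Lemma cplx_cvg0_unique (f : R -> C) (l1 l2 : C) :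
  f t @[t --> (0 : R)^'] --> l1 -> f t @[t --> (0 : R)^'] --> l2 -> l1 = l2.
Proof. by apply: cvg_unique; exact: norm_hausdorff. Qed.

End Modulus.

(** * Derivatives of complex curves and the mean value inequality *)

Section CurveDerivative.
Variable R : realType.
Local Notation C := (Cplx R).
Implicit Types (phi psi : R -> C) (u s t e : R) (l m : C).

Definition has_cderiv phi u l : Prop :=
  (ofreal t)^-1 * (phi (u + t) - phi u) @[t --> (0 : R)^'] --> l.

Lemma has_cderiv_unique phi u l m :
  has_cderiv phi u l -> has_cderiv phi u m -> l = m.
Proof. exact: cplx_cvg0_unique. Qed.

Lemma has_cderiv_eq phi psi u l :
  (\forall t \near 0^', phi (u + t) = psi (u + t)) -> phi u = psi u ->
  has_cderiv phi u l -> has_cderiv psi u l.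
Proof.
move=> pp pu; apply: cvg_trans; apply: near_eq_cvg.
by apply: filterS pp => t ->; rewrite pu.
Qed.

Lemma has_cderiv_cst l u : has_cderiv (fun=> l) u 0.
Proof.
rewrite /has_cderiv; apply/cplx_cvg0P => e e0; exists 1 => // t _ _.
by rewrite subrr mulr0 subr0 cabs0.
Qed.

Lemma has_cderiv_ofreal l u : has_cderiv (fun t => ofreal t * l) u l.
Proof.
apply/cplx_cvg0P => e e0; exists 1 => // t t0 _.
by rewrite ofrealD mulrDl addrAC subrr add0r mulKf ?ofreal_eq0// subrr cabs0.
Qed.

Lemma has_cderivD phi psi u l m : has_cderiv phi u l -> has_cderiv psi u m ->
  has_cderiv (fun t => phi t + psi t) u (l + m).
Proof.
move=> pl pm; rewrite /has_cderiv; have := cplx_cvg0D pl pm.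
by apply: cplx_cvg0_eq => t t0 /=; rewrite opprD addrACA -mulrDr.
Qed.

Lemma has_cderiv_cvg phi u l : has_cderiv phi u l ->
  phi (u + t) @[t --> (0 : R)^'] --> phi u.
Proof.
move=> pl.
have zt : ofreal t @[t --> (0 : R)^'] --> (0 : C).
  apply/cplx_cvg0P => e e0; exists e => // t _ te.
  by rewrite subr0 cabs_ofreal.
have := cplx_cvg0D (cplx_cvg0M zt pl) (@cplx_cvg0_cst R (phi u)); rewrite mul0r add0r.
apply: cplx_cvg0_eq => t t0 /=.
by rewrite mulVKf ?ofreal_eq0// subrK.
Qed.

Lemma has_cderivM phi psi u l m : has_cderiv phi u l -> has_cderiv psi u m ->
  has_cderiv (fun t => phi t * psi t) u (l * psi u + phi u * m).
Proof.
move=> pl pm; have pc := has_cderiv_cvg pm; rewrite /has_cderiv.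
have := cplx_cvg0D (cplx_cvg0M pl pc) (cplx_cvg0M (@cplx_cvg0_cst R (phi u)) pm).
by apply: cplx_cvg0_eq => t t0 /=; ring.
Qed.

Lemma has_cderivV phi u l : phi u != 0 -> has_cderiv phi u l ->
  has_cderiv (fun t => (phi t)^-1) u (- l * (phi u) ^- 2).
Proof.
move=> p0 pl; have pc := has_cderiv_cvg pl; rewrite /has_cderiv.
have := cplx_cvg0M pl (cplx_cvg0M (cplx_cvg0V p0 pc) (@cplx_cvg0_cst R (- (phi u)^-1))).
rewrite mulrN mulrN -invfM -expr2 -mulNr.
have e0 : 0 < cabs (phi u).
  by rewrite lt_neqAle cabs_ge0 andbT eq_sym; apply: contra_neq p0; exact: cabs_eq0.
(* With the radius |phi u| itself, continuity already excludes a zero of [phi (u + t)]. *)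
have /cplx_cvg0P/(_ _ e0)[d d0 H] := pc.
apply: (cplx_cvg0_near d0) => t t0 td /=.
have pt : phi (u + t) != 0.
  have := H t t0 td; apply: contraTneq => ->.
  by rewrite sub0r cabsN ltxx.
have t0' : ofreal t != 0 by rewrite ofreal_eq0.
move: (phi (u + t)) (phi u) pt p0 (ofreal t) t0' => a c a0 c0 r r0.
by field; rewrite a0 c0 r0.
Qed.

(** Here [p] stands for the real or the imaginary part: a real-linear map bounded by the modulus
    carries complex difference quotients to real ones, to which the library's mean value theorem
    applies. *)
Lemma has_cderiv_part (p : C -> R) phi u l :
  (forall z w, p (z + w) = p z + p w) -> (forall z, p (- z) = - p z) ->
  (forall (t : R) z, p (ofreal t * z) = t * p z) -> (forall z, `|p z| <= cabs z) ->
  has_cderiv phi u l -> is_derive u 1 (p \o phi) (p l).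
Proof.
move=> pD pN pZ pc /cplx_cvg0P pl.
have h : h^-1 *: ((p \o phi) (h *: (1 : R) + u) - (p \o phi) u) @[h --> (0 : R)^']
    --> p l.
  apply/cvgrPdist_lt => e /pl[d d0 H]; apply/dnbhs0P; exists d => // t t0 td.
  apply: le_lt_trans (H t t0 td).
  have -> : t%:A + u = u + t by rewrite addrC /GRing.scale /= mulr1.
  rewrite distrC /= -pN -pD -[X in X *: _]/(t^-1) -[_ *: _]/(_ * _) -pZ -pN -pD ofrealV.
  exact: pc.
split; first by apply/cvg_ex; exists (p l).
exact: cvg_lim h.
Qed.

Lemma real_mean_value (f df : R -> R) (s e l : R) :
  (forall u, `|u| <= `|s| -> is_derive u 1 f (df u)) ->
  (forall u, `|u| <= `|s| -> `|df u - l| <= e) ->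
  `|f s - f 0 - s * l| <= e * `|s|.
Proof.
move=> fd de.
have mv a b : a <= b -> `|a| <= `|s| -> `|b| <= `|s| ->
    `|f b - f a - (b - a) * l| <= e * (b - a).
  move=> ab as_ bs.
  have abs c : c \in `[a, b] -> `|c| <= `|s|.
    rewrite in_itv /= => /andP[ac cb]; rewrite ler_norml.
    move: as_ bs; rewrite !ler_norml => /andP[a1 a2] /andP[b1 b2].
    by apply/andP; split; lra.
  have [//||c cab ->] := MVT_segment ab (f := f) (df := df).
  - by move=> x xab; apply: fd; exact: abs (subset_itv_oo_cc xab).
  - apply: derivable_within_continuous => x xab.
    by have [] := fd x (abs _ xab).
  rewrite [_ * l]mulrC -mulrBl normrM.
  by rewrite [`|b - a|]ger0_norm ?subr_ge0// ler_wpM2r ?subr_ge0// de// abs.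
have [s0|/ltW s0] := leP 0 s.
  have := mv 0 s s0; rewrite normr0 normr_ge0 subr0 (ger0_norm s0).
  by move=> -> //; rewrite ger0_norm.
have := mv s 0 s0; rewrite normr0 normr_ge0 lexx sub0r => /(_ isT isT).
move=> H; rewrite [`|s|]ler0_norm//.
have -> : f s - f 0 - s * l = - (f 0 - f s - - s * l) by ring.
rewrite normrN.
exact: H.
Qed.

(** No exact mean value theorem holds for complex values, so the real and imaginary parts are
    estimated separately; each costs e |s|, whence the factor 2. *)
Lemma complex_mean_value phi psi s e l :
  (forall u, `|u| <= `|s| -> has_cderiv phi u (psi u)) ->
  (forall u, `|u| <= `|s| -> cabs (psi u - l) <= e) ->
  cabs (phi s - phi 0 - ofreal s * l) <= 2 * e * `|s|.
Proof.
move=> pd pe; apply: le_trans (cabs_le_ReIm _) _.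
have -> : 2 * e * `|s| = e * `|s| + e * `|s| by ring.
apply: lerD.
- have := @real_mean_value (@complex.Re R \o phi) (@complex.Re R \o psi) s e (complex.Re l).
  rewrite /= !(complex_ReD, complex_ReN, complex_ReZ); apply.
    move=> u us; apply: has_cderiv_part (pd u us) => *;
    rewrite ?complex_ReD ?complex_ReN ?complex_ReZ//; exact: Re_le_cabs.
  move=> u us; rewrite -complex_ReN -complex_ReD.
  exact: le_trans (Re_le_cabs _) (pe u us).
- have := @real_mean_value (@complex.Im R \o phi) (@complex.Im R \o psi) s e (complex.Im l).
  rewrite /= !(complex_ImD, complex_ImN, complex_ImZ); apply.
    move=> u us; apply: has_cderiv_part (pd u us) => *;
    rewrite ?complex_ImD ?complex_ImN ?complex_ImZ//; exact: Im_le_cabs.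
  move=> u us; rewrite -complex_ImN -complex_ImD.
  exact: le_trans (Im_le_cabs _) (pe u us).
Qed.

Lemma has_cderiv0_cst phi : (forall u, has_cderiv phi u 0) ->
  forall s, phi s = phi 0.
Proof.
move=> p0 s; apply/eqP; rewrite -subr_eq0; apply/eqP/cabs_eq0/eqP.
rewrite eq_le cabs_ge0 andbT; have := @complex_mean_value phi (fun=> 0) s 0 0.
rewrite !mulr0 mul0r !subr0; apply=> // u _; by rewrite cabs0.
Qed.

End CurveDerivative.

(** * Directional derivatives on GL_n *)

Section SmoothCalculus.
Variables (R : realType) (n : nat).
Local Notation C := (Cplx R).
Local Notation G := (GL R n).
Implicit Types (f u : G -> C) (g h : G) (V W A : 'M[C]_n).

Lemma det_continuous : continuous (fun A => \det A : C).
Proof.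
move=> A; have FA : Filter (nbhs A) by exact: nbhs_filter.
rewrite /continuous_at /determinant.
apply: cvg_big => [|s _]; first exact: add_continuous.
apply: cvgM; first exact: cvg_cst.
apply: cvg_big => [|i _]; first exact: mul_continuous.
exact: coord_continuous.
Qed.

(** Continuity of the determinant makes GL_n open, so a matrix with entries close to those of [g] is
    automatically invertible and can be taken as a point of [U]. *)
Lemma GL_nbhsP g (U : set G) : nbhs g U ->
  exists2 e : R, 0 < e &
    forall A, (forall i j, cabs (A i j - GLmx g i j) < e) ->
      exists2 h, GLmx h = A & U h.
Proof.
case=> _ [[P oP <-]] /= Pg sPU.
have dg : nbhs (GLmx g) [set A | \det A != 0].
  have /det_continuous : nbhs (\det (GLmx g) : C) [set z : C | z != 0].
    have d0 : \det (GLmx g) != 0 by have := GLmx_unit g; rewrite unitmxE unitfE.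
    apply/nbhs_ballP; exists `|\det (GLmx g)|; first by rewrite /= normr_gt0.
    move=> z; rewrite -ball_normE /=; apply: contraTneq => ->.
    by rewrite subr0 ltxx.
  exact.
have [Q nQ sQ] : nbhs (GLmx g) (P `&` [set A | \det A != 0]).
  by apply: filterI => //; exact: open_nbhs_nbhs.
(* The matrix topology gives one neighbourhood per entry; a radius common to the finitely many
   entries is obtained as a property holding near 0 on the right. *)
have FR : Filter ((0 : R)^'+) by exact: at_right_proper_filter.
have : \forall e \near (0 : R)^'+, forall i j, forall z : C,
    cabs (z - GLmx g i j) < e -> Q i j z.
  refine (@filter_forall _ _ _ _ FR _) => i.
  refine (@filter_forall _ _ _ _ FR _) => j.
  have [e /= e0 sB] := (nbhs_ballP _ _).1 (nQ i j).
  have er : ofreal (complex.Re e) = e by apply: RRe_real; exact: gtr0_real.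
  have e0' : 0 < complex.Re e by rewrite -ltr_ofreal er.
  near=> d => z zd; apply: sB; rewrite -ball_normE /= distrC cabsE -er ltr_ofreal.
  by apply: lt_trans zd _; near: d; exact: nbhs_right_lt.
move=> H; have [e [He e0]] : exists e, (forall i j, forall z : C,
    cabs (z - GLmx g i j) < e -> Q i j z) /\ 0 < e.
  have := filter_ex (filterI H (nbhs_right_gt (0 : R))).
  by case=> e [] He e0; exists e.
exists e => // A HA.
have [PA dA] : P A /\ \det A != 0 by apply: sQ => i j; exact: He.
have uA : A \in unitmx by rewrite unitmxE unitfE.
by exists (toGL uA) => //; apply: sPU.
Unshelve. all: by end_near.
Qed.

(** Keeps a small parallelogram at [g] inside GL_n, where [ext0] is the function itself. With [W] =
    0 it serves for lines. *)
Lemma near_plane u g V W (e : R) : continuous u -> 0 < e ->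
  exists2 d : R, 0 < d & forall s t : R, `|s| < d -> `|t| < d ->
    exists2 h, GLmx h = GLmx g + ofreal s *: V + ofreal t *: W &
      cabs (u h - u g) < e.
Proof.
move=> cu e0.
have [r r0 Hr] : exists2 r : R, 0 < r &
    forall A, (forall i j, cabs (A i j - GLmx g i j) < r) ->
      exists2 h, GLmx h = A & cabs (u h - u g) < e.
  by apply: GL_nbhsP; have /cplx_cvgP := cu g; exact.
(* A bound for all entries at once; dividing by m + 1 avoids a zero denominator. *)
pose m := \sum_i \sum_j (cabs (V i j) + cabs (W i j)) : R.
have m0 : 0 <= m.
  by apply: sumr_ge0 => i _; apply: sumr_ge0 => j _; rewrite addr_ge0 ?cabs_ge0.
have m1 : 0 < m + 1 by lra.
exists (r / (m + 1)); first by rewrite divr_gt0.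
move=> s t sr tr; apply: Hr => i j; rewrite !mxE -addrA addrAC subrr add0r.
have mij : cabs (V i j) + cabs (W i j) <= m.
  rewrite /m (bigD1 i)//= (bigD1 j)//= -addrA lerDl addr_ge0//.
    by apply: sumr_ge0 => l _; rewrite addr_ge0 ?cabs_ge0.
  apply: sumr_ge0 => l _; apply: sumr_ge0 => l' _.
  by rewrite addr_ge0 ?cabs_ge0.
apply: le_lt_trans (cabsD _ _) _; rewrite !cabsM !cabs_ofreal.
have r' : r = r / (m + 1) * (m + 1) by rewrite divfK// gt_eqF.
rewrite [X in _ < X]r'; set q := r / (m + 1) in sr tr *.
have q0 : 0 < q by rewrite divr_gt0.
apply: le_lt_trans (_ : q * m < _); last by rewrite ltr_pM2l//; lra.
apply: le_trans (ler_wpM2l (ltW q0) mij).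
by rewrite mulrDr lerD// ler_wpM2r ?cabs_ge0// ltW.
Qed.

(** A directional derivative at any point of a line is a derivative of one function of one real
    variable, which is the form the mean value inequality takes. *)
Lemma has_cderiv_line f V A (r : R) h l : GLmx h = A + ofreal r *: V ->
  diffq f V h t @[t --> (0 : R)^'] --> l ->
  has_cderiv (fun t => ext0 f (A + ofreal t *: V)) r l.
Proof.
move=> hA; rewrite /has_cderiv; apply: cplx_cvg0_eq => t _.
by rewrite /diffq hA -(ext0_GL f h) hA -addrA -scalerDl -ofrealD.
Qed.

Lemma diffq_line f V g l :
  has_cderiv (fun t => ext0 f (GLmx g + ofreal t *: V)) 0 l ->
  diffq f V g t @[t --> (0 : R)^'] --> l.
Proof.
rewrite /has_cderiv; apply: cplx_cvg0_eq => t _.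
by rewrite /diffq add0r ofreal0 scale0r addr0 ext0_GL.
Qed.

Lemma rsmooth_continuous f : rsmooth f -> continuous f.
Proof. by move=> sf; have [] := sf [::]. Qed.

Lemma rsmooth_rderive f V : rsmooth f -> rsmooth (rderive f V).
Proof.
move=> sf Vs; have := sf (rcons Vs V).
by rewrite /rderive_seq foldr_rcons.
Qed.

Lemma diffq_rderive f V g : rsmooth f ->
  diffq f V g t @[t --> (0 : R)^'] --> rderive f V g.
Proof. by move=> sf; have [_] := sf [::]; exact. Qed.

Lemma rderive_eq f V g l :
  diffq f V g t @[t --> (0 : R)^'] --> l -> rderive f V g = l.
Proof. by move=> fl; refine (cvg_lim _ fl); exact: norm_hausdorff. Qed.

(** A coinduction principle: if the derivatives of members of [Q] stay in [Q], so do all iterated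
    ones. It spares explicit formulas for iterated derivatives of products, inverses and roots. *)
Lemma rsmooth_coind (Q : (G -> C) -> Prop) :
  (forall f, Q f -> continuous f) ->
  (forall f V, Q f -> exists2 f', Q f' &
     forall g, diffq f V g t @[t --> (0 : R)^'] --> f' g) ->
  forall f, Q f -> rsmooth f.
Proof.
move=> Qc Qd f Qf.
have dE (k k' : G -> C) V :
    (forall g, diffq k V g t @[t --> (0 : R)^'] --> k' g) -> rderive k V = k'.
  by move=> hh; apply/funext => g; exact: rderive_eq.
have Qs Vs : Q (rderive_seq Vs f).
  elim: Vs => //= V Vs IH.
  by have [h' Qh' hh] := Qd _ V IH; rewrite (dE _ _ _ hh).
move=> Vs; split; first exact: Qc.
by move=> V g; have [h' _ hh] := Qd _ V (Qs Vs); apply/cvg_ex; exists (h' g).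
Qed.

(** Strict differentiability: the linear approximation with the derivative taken at [g] remains
    valid when the base point moves along [V], by continuity of [rderive f W]. *)
Lemma strict_rderive f V W g (e : R) : rsmooth f -> 0 < e ->
  exists2 d : R, 0 < d & forall s t : R, `|s| < d -> `|t| < d ->
    cabs (ext0 f (GLmx g + ofreal s *: V + ofreal t *: W)
          - ext0 f (GLmx g + ofreal s *: V) - ofreal t * rderive f W g)
      <= e * `|t|.
Proof.
move=> sf e0; have e20 : 0 < e / 2 by lra.
have cf := rsmooth_continuous (rsmooth_rderive W sf).
have [d d0 Hd] := near_plane g V W cf e20.
exists d => // s t sd td.
pose psi r := ext0 (rderive f W) (GLmx g + ofreal s *: V + ofreal r *: W).
have := @complex_mean_value R
  (fun r => ext0 f (GLmx g + ofreal s *: V + ofreal r *: W)) psi t (e / 2)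
  (rderive f W g).
rewrite ofreal0 scale0r addr0 (_ : 2 * (e / 2) = e); last by field.
apply=> r rt; have rd := le_lt_trans rt td; have [h hE hd] := Hd s r sd rd.
  by apply: (has_cderiv_line hE); rewrite /psi -hE ext0_GL; exact: diffq_rderive.
by rewrite /psi -hE ext0_GL ltW.
Qed.

(** The increment along t(V + W) is an increment along tV followed by one along tW from the moved
    point; the latter is controlled by [strict_rderive]. *)
Lemma rderiveD f V W g : rsmooth f ->
  rderive f (V + W) g = rderive f V g + rderive f W g.
Proof.
move=> sf; apply: rderive_eq; apply/cplx_cvg0P => e e0.
have e20 : 0 < e / 2 by lra.
have e40 : 0 < e / 4 by lra.
have [d1 d10 H1] := strict_rderive V W g sf e40.
have /cplx_cvg0P/(_ _ e20)[d2 d20 H2] := @diffq_rderive f V g sf.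
exists (Num.min d1 d2); first by rewrite lt_min d10.
move=> t t0; rewrite lt_min => /andP[t1 t2].
have t0' : ofreal t != 0 by rewrite ofreal_eq0.
have -> : diffq f (V + W) g t - (rderive f V g + rderive f W g) =
  (ofreal t)^-1 * (ext0 f (GLmx g + ofreal t *: V + ofreal t *: W)
    - ext0 f (GLmx g + ofreal t *: V) - ofreal t * rderive f W g)
  + (diffq f V g t - rderive f V g).
  rewrite /diffq scalerDr addrA.
  move: (ext0 f (_ + ofreal t *: W)) => a; move: (ext0 f _) (f g) => b c.
  move: (rderive f V g) (rderive f W g) (ofreal t) t0' => L L' r r0.
  by field.
apply: le_lt_trans (cabsD _ _) _.
rewrite cabsM -ofrealV cabs_ofreal normfV.
have : `|t|^-1 * cabs (ext0 f (GLmx g + ofreal t *: V + ofreal t *: W)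
    - ext0 f (GLmx g + ofreal t *: V) - ofreal t * rderive f W g) <= e / 4.
  by rewrite ler_pdivrMl ?normr_gt0// [X in _ <= X]mulrC; exact: H1.
by have := H2 t t0 t2; lra.
Qed.

Lemma rderiveZ f V g (r : R) : rsmooth f ->
  rderive f (ofreal r *: V) g = ofreal r * rderive f V g.
Proof.
move=> sf; apply: rderive_eq; have [->|r0] := eqVneq r 0.
  rewrite ofreal0 mul0r /diffq scale0r.
  apply: cplx_cvg0_eq (@cplx_cvg0_cst R 0) => t _.
  by rewrite scaler0 addr0 ext0_GL subrr mulr0.
apply/cplx_cvg0P => e e0.
have e1 : 0 < e / `|r| by rewrite divr_gt0// normr_gt0.
have /cplx_cvg0P/(_ _ e1)[d d0 H] := @diffq_rderive f V g sf.
exists (d / `|r|); first by rewrite divr_gt0// normr_gt0.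
move=> t t0; rewrite ltr_pdivlMr ?normr_gt0// -normrM => td.
have := H (t * r) _ td; rewrite mulf_neq0// ltr_pdivlMr ?normr_gt0// => /(_ isT).
rewrite -cabs_ofreal -cabsM; congr (cabs _ < _).
have t0' : ofreal t != 0 by rewrite ofreal_eq0.
have r0' : ofreal r != 0 by rewrite ofreal_eq0.
rewrite /diffq scalerA -ofrealM; move: (ext0 f _) (f g) (rderive f V g).
by rewrite ofrealM; move: (ofreal t) (ofreal r) t0' r0' => x y x0 y0 a b L;
  field; rewrite x0.
Qed.

(** The mixed second difference is symmetric in [V] and [W], while the term approximating it is not
    visibly so; comparing the two readings yields the symmetry of second derivatives. *)
Lemma second_difference f V W g (e : R) : rsmooth f -> 0 < e ->
  exists2 d : R, 0 < d & forall t : R, `|t| < d ->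
    cabs (ext0 f (GLmx g + ofreal t *: V + ofreal t *: W)
      - ext0 f (GLmx g + ofreal t *: V) - ext0 f (GLmx g + ofreal t *: W)
      + f g - ofreal t * (ofreal t * rderive (rderive f V) W g))
      <= 2 * e * `|t| * `|t|.
Proof.
move=> sf e0; have cf := rsmooth_continuous sf.
have [d1 d10 H1] := near_plane g V W cf e0.
have [d2 d20 H2] := strict_rderive V W g (rsmooth_rderive V sf) e0.
exists (Num.min d1 d2); first by rewrite lt_min d10.
move=> t; rewrite lt_min => /andP[t1 t2].
pose F r q := GLmx g + ofreal r *: V + ofreal q *: W.
have F0 r : F r 0 = GLmx g + ofreal r *: V.
  by rewrite /F ofreal0 scale0r addr0.
(* The increment along tW as the base point moves along [V]. Its derivative [psi] is the increment
   of [rderive f V], which [strict_rderive] compares with t times the second derivative. *)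
pose phi r := ext0 f (F r t) + -1 * ext0 f (F r 0).
pose psi r := ext0 (rderive f V) (F r t) + (0 * ext0 f (F r 0)
  + -1 * ext0 (rderive f V) (F r 0)).
have FV r q : F r q = GLmx g + ofreal q *: W + ofreal r *: V.
  by rewrite /F addrAC.
have dF r q : `|r| < d1 -> `|q| < d1 ->
    has_cderiv (fun r => ext0 f (F r q)) r (ext0 (rderive f V) (F r q)).
  move=> rd qd; have [h hE _] := H1 r q rd qd.
  have -> : (fun r => ext0 f (F r q)) =
    (fun r => ext0 f (GLmx g + ofreal q *: W + ofreal r *: V)).
    by apply/funext => r'; rewrite FV.
  rewrite -[F r q]hE ext0_GL; apply: (has_cderiv_line (h := h)).
    by rewrite hE -FV.
  exact: diffq_rderive.
have := @complex_mean_value R phi psi t (e * `|t|)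
  (ofreal t * rderive (rderive f V) W g).
have z1 : `|0 : R| < d1 by rewrite normr0.
rewrite !mulrA => H.
have -> : ext0 f (GLmx g + ofreal t *: V + ofreal t *: W)
      - ext0 f (GLmx g + ofreal t *: V) - ext0 f (GLmx g + ofreal t *: W)
      + f g - ofreal t * ofreal t * rderive (rderive f V) W g
  = phi t - phi 0 - ofreal t * ofreal t * rderive (rderive f V) W g.
  rewrite /phi !F0 /F ofreal0 scale0r addr0 ext0_GL.
  move: (ext0 f (_ + ofreal t *: V + ofreal t *: W)) (f g) => a b.
  move: (ext0 f (_ + ofreal t *: V)) (ext0 f (_ + ofreal t *: W)) => c d.
  by move: (ofreal t * ofreal t * _) => M; ring.
apply: H => r rt; have rd1 := le_lt_trans rt t1; have rd2 := le_lt_trans rt t2.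
  apply: has_cderivD; first exact: dF.
  by apply: has_cderivM; [exact: has_cderiv_cst|exact: dF].
have := H2 r t rd2 t2; rewrite -/(F r t) -F0.
by rewrite /psi mul0r add0r mulN1r.
Qed.

Lemma rderiveC f V W g : rsmooth f ->
  rderive (rderive f V) W g = rderive (rderive f W) V g.
Proof.
move=> sf; apply/eqP; rewrite -subr_eq0; apply/eqP/cabs_eq0/eqP.
rewrite eq_le cabs_ge0 andbT; apply/ler_addgt0Pl => e e0.
have e40 : 0 < e / 4 by lra.
have [d1 d10 H1] := second_difference V W g sf e40.
have [d2 d20 H2] := second_difference W V g sf e40.
have [t t0 /andP[t1 t2]] : exists2 t : R, 0 < t & (t < d1) && (t < d2).
  exists (Num.min d1 d2 / 2); first by rewrite divr_gt0// lt_min d10.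
  rewrite -lt_min ltr_pdivrMr// ltr_pMr ?lt_min ?d10//; lra.
have {}H1 := H1 t; have {}H2 := H2 t; rewrite gtr0_norm// in H1 H2.
have {}H1 := H1 t1; have {}H2 := H2 t2.
rewrite (_ : GLmx g + ofreal t *: W + ofreal t *: V =
  GLmx g + ofreal t *: V + ofreal t *: W) in H2; last by rewrite addrAC.
rewrite addr0; move: H1 H2.
generalize (rderive (rderive f V) W g) (rderive (rderive f W) V g) => M M'.
move: (ext0 f (GLmx g + ofreal t *: V + ofreal t *: W)) => a.
move: (ext0 f (GLmx g + ofreal t *: V)) (ext0 f (GLmx g + ofreal t *: W)) => b c.
move: (f g) => d H1 H2.
have E : ofreal t * (ofreal t * (M - M')) =
  (a - c - b + d - ofreal t * (ofreal t * M'))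
  - (a - b - c + d - ofreal t * (ofreal t * M)).
  by move: (ofreal t) => r; ring.
have : t * (t * cabs (M - M')) <= t * (t * e).
  rewrite -{1 2}(gtr0_norm t0) -cabs_ofreal -!cabsM E.
  apply: le_trans (cabsD _ _) _; rewrite cabsN.
  by apply: le_trans (lerD H2 H1) _; rewrite le_eqVlt; apply/orP; left;
    apply/eqP; field.
by rewrite !ler_pM2l.
Qed.

End SmoothCalculus.

(** * Closure properties of smooth functions *)

(* Otherwise unification compares two smoothness statements by unfolding the
   limits behind [rderive]. *)
Opaque rderive.

Section SmoothClosure.
Variables (R : realType) (n : nat).
Local Notation C := (Cplx R).
Local Notation G := (GL R n).
Implicit Types (f u v : G -> C) (g h : G) (V W A : 'M[C]_n) (l m : C).

Lemma diffq_derivM f u V g l m :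
  diffq f V g t @[t --> (0 : R)^'] --> l ->
  diffq u V g t @[t --> (0 : R)^'] --> m ->
  diffq (fun x => f x * u x) V g t @[t --> (0 : R)^'] --> l * u g + f g * m.
Proof.
have g0 : GLmx g = GLmx g + ofreal (0 : R) *: V by rewrite ofreal0 scale0r addr0.
move=> /(has_cderiv_line g0) fl /(has_cderiv_line g0) um; apply: diffq_line.
have := has_cderivM fl um; rewrite -g0 !ext0_GL; apply: has_cderiv_eq.
  apply/dnbhs0P; exists 1 => // t _ _.
  by rewrite /ext0; case: insub => //=; rewrite mul0r.
by rewrite -g0 !ext0_GL.
Qed.

Lemma diffqD f u V g l m :
  diffq f V g t @[t --> (0 : R)^'] --> l ->
  diffq u V g t @[t --> (0 : R)^'] --> m ->
  diffq (fun x => f x + u x) V g t @[t --> (0 : R)^'] --> l + m.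
Proof.
move=> fl um; have := cplx_cvg0D fl um; apply: cplx_cvg0_eq => t _.
have := diffq_linear 1 f u V g; under [X in diffq X]eq_fun do rewrite mul1r.
by move=> ->; rewrite mul1r.
Qed.

Lemma continuous_mul f u : continuous f -> continuous u ->
  continuous (fun x => f x * u x).
Proof. by move=> cf cu g; apply: (@cvgM _ _ (nbhs g)); [exact: cf|exact: cu]. Qed.

Lemma continuous_add f u : continuous f -> continuous u ->
  continuous (fun x => f x + u x).
Proof. by move=> cf cu g; apply: (@cvgD _ _ _ (nbhs g)); [exact: cf|exact: cu]. Qed.

Lemma rsmoothD f u : rsmooth f -> rsmooth u -> rsmooth (fun x => f x + u x).
Proof.
move=> sf su; have := rsmooth_linear 1 sf su.
by under [X in rsmooth X]eq_fun do rewrite mul1r.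
Qed.

(** Extended by 0, a nonzero constant is not constant on all matrices; the quotient vanishes only
    once [t] is small enough for g + tV to stay invertible. *)
Lemma diffq_cst (c : C) V g :
  diffq (fun=> c) V g t @[t --> (0 : R)^'] --> (0 : C).
Proof.
have cc : continuous (fun _ : G => c) by move=> ?; exact: cst_continuous.
apply/cplx_cvg0P => e e0; have [d d0 H] := near_plane g V 0 cc e0.
exists d => // t t0 td; have [|h hE _] := H t 0 td; first by rewrite normr0.
move: hE; rewrite scaler0 addr0 => hE.
by rewrite /diffq -hE ext0_GL subrr mulr0 subr0 cabs0.
Qed.

Lemma rsmooth_cst (c : C) : rsmooth (fun _ : G => c).
Proof.
apply: (rsmooth_coind (Q := fun f => exists c, f = fun=> c)); last by exists c.
  by move=> _ [{}c ->] ?; exact: cst_continuous.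
by move=> _ V [{}c ->]; exists (fun=> 0); [exists 0|move=> g; exact: diffq_cst].
Qed.

(* The derivative of a product is a sum of products, so products alone are not
   stable under derivation. *)
Inductive sum_of_products : (G -> C) -> Prop :=
| sop_prod f u : rsmooth f -> rsmooth u -> sum_of_products (fun x => f x * u x)
| sop_sum f u : sum_of_products f -> sum_of_products u ->
    sum_of_products (fun x => f x + u x).

Lemma rsmoothM f u : rsmooth f -> rsmooth u -> rsmooth (fun x => f x * u x).
Proof.
move=> sf su; apply: (rsmooth_coind (Q := sum_of_products)).
- move=> v; elim=> {f u sf su v} f u.
    by move=> sf su; apply: continuous_mul; exact: rsmooth_continuous.
  by move=> _ cf _ cu; exact: continuous_add.
- move=> v V; elim=> {f u sf su v} f u.
    move=> sf su; exists (fun x => rderive f V x * u x + f x * rderive u V x).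
      apply: sop_sum; apply: sop_prod; [exact: rsmooth_rderive|exact: su|exact: sf|].
      exact: rsmooth_rderive.
    by move=> g; apply: diffq_derivM; exact: diffq_rderive.
  move=> _ [f' Qf df] _ [u' Qu du].
  exists (fun x => f' x + u' x); first exact: sop_sum.
  by move=> g; exact: diffqD.
- exact: sop_prod.
Qed.

Lemma rderiveM f u V g : rsmooth f -> rsmooth u ->
  rderive (fun x => f x * u x) V g = rderive f V g * u g + f g * rderive u V g.
Proof.
move=> sf su; apply: rderive_eq.
by apply: diffq_derivM; exact: diffq_rderive.
Qed.

Lemma rderive_linear f u V g (c : C) : rsmooth f -> rsmooth u ->
  rderive (fun x => c * f x + u x) V g = c * rderive f V g + rderive u V g.
Proof. by move=> sf su; have /= -> := rderive_seq_linear c [:: V] sf su. Qed.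

Lemma cabs_conj (z : C) : cabs (Num.conj z) = cabs z.
Proof. by rewrite /cabs norm_conjC. Qed.

Lemma conjCM (a b : C) : Num.conj (a * b) = Num.conj a * Num.conj b.
Proof. exact: rmorphM. Qed.

Lemma conjCB (a b : C) : Num.conj (a - b) = Num.conj a - Num.conj b.
Proof. exact: rmorphB. Qed.

Lemma conjCD (a b : C) : Num.conj (a + b) = Num.conj a + Num.conj b.
Proof. exact: rmorphD. Qed.

Lemma diffq_conj f V g l : diffq f V g t @[t --> (0 : R)^'] --> l ->
  diffq (fun x => Num.conj (f x)) V g t @[t --> (0 : R)^'] --> Num.conj l.
Proof.
move=> /cplx_cvg0P fl; apply/cplx_cvg0P => e /fl[d d0 H]; exists d => // t t0 td.
have -> : diffq (fun x => Num.conj (f x)) V g t - Num.conj l =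
    Num.conj (diffq f V g t - l).
  rewrite conjCB /diffq; congr (_ - _).
  rewrite conjCM -ofrealV conj_ofreal conjCB.
  by rewrite /ext0; case: insub => //=; rewrite rmorph0.
by rewrite cabs_conj; exact: H.
Qed.

Lemma continuous_conj f : continuous f -> continuous (fun x => Num.conj (f x)).
Proof.
move=> cf g; have Fg : Filter (nbhs g) by exact: nbhs_filter.
apply/cplx_cvgP => e e0.
have /cplx_cvgP/(_ e e0) := cf g; apply: filterS => x.
by rewrite -rmorphB cabs_conj.
Qed.

Lemma rsmooth_conj f : rsmooth f -> rsmooth (fun x => Num.conj (f x)).
Proof.
move=> sf; apply: (rsmooth_coind (Q := fun u =>
    exists2 f, rsmooth f & u = fun x => Num.conj (f x))); last by exists f.
  by move=> _ [{}f {}sf ->]; exact/continuous_conj/rsmooth_continuous.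
move=> _ V [{}f {}sf ->]; exists (fun x => Num.conj (rderive f V x)).
  by exists (rderive f V); [exact: rsmooth_rderive|].
by move=> g; apply: diffq_conj; exact: diffq_rderive.
Qed.

Lemma rderive_conj f V g : rsmooth f ->
  rderive (fun x => Num.conj (f x)) V g = Num.conj (rderive f V g).
Proof. by move=> sf; apply: rderive_eq; apply: diffq_conj; exact: diffq_rderive. Qed.

Lemma continuous_coord i j : continuous (fun x : G => GLmx x i j).
Proof.
move=> g; apply: (continuous_comp (f := @GLmx R n) (g := fun A => A i j)).
  exact: GLmx_continuous.
exact: coord_continuous.
Qed.

Lemma diffq_coord i j V g :
  diffq (fun x => GLmx x i j) V g t @[t --> (0 : R)^'] --> V i j.
Proof.
apply/cplx_cvg0P => e e0.
have [d d0 H] := near_plane g V 0 (@continuous_coord i j) e0.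
exists d => // t t0 td; have [|h hE _] := H t 0 td; first by rewrite normr0.
move: hE; rewrite scaler0 addr0 => hE.
rewrite /diffq -hE ext0_GL hE !mxE addrAC subrr add0r mulKf ?ofreal_eq0//.
by rewrite subrr cabs0.
Qed.

Lemma rsmooth_coord i j : rsmooth (fun x : G => GLmx x i j).
Proof.
apply: (rsmooth_coind (Q := fun f => rsmooth f \/ f = fun x => GLmx x i j)).
- by move=> f [/rsmooth_continuous//|->]; exact: continuous_coord.
- move=> f V [sf|->].
    by exists (rderive f V); [left; exact: rsmooth_rderive|
      move=> g; exact: diffq_rderive].
  by exists (fun=> V i j); [left; exact: rsmooth_cst|move=> g; exact: diffq_coord].
- by right.
Qed.

Lemma rderive_coord i j V g : rderive (fun x => GLmx x i j) V g = V i j.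
Proof. by apply: rderive_eq; exact: diffq_coord. Qed.

Lemma diffqV f V g l : f g != 0 ->
  diffq f V g t @[t --> (0 : R)^'] --> l -> continuous f ->
  diffq (fun x => (f x)^-1) V g t @[t --> (0 : R)^'] --> - l * (f g) ^- 2.
Proof.
move=> f0 fl cf; have g0 : GLmx g = GLmx g + ofreal (0 : R) *: V.
  by rewrite ofreal0 scale0r addr0.
apply: diffq_line; have fl' := has_cderiv_line g0 fl.
have := has_cderivV _ fl'; rewrite -g0 ext0_GL => /(_ f0).
apply: has_cderiv_eq; last by rewrite -g0 !ext0_GL.
apply/dnbhs0P; exists 1 => // t _ _.
by rewrite /ext0; case: insub => //=; rewrite invr0.
Qed.

Lemma continuous_inv f : (forall x, f x != 0) -> continuous f ->
  continuous (fun x => (f x)^-1).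
Proof.
move=> f0 cf g; have Fg : Filter (nbhs g) by exact: nbhs_filter.
by apply: cvgV; [exact: f0|exact: cf].
Qed.

Lemma rsmoothX f (m : nat) : rsmooth f -> rsmooth (fun x => f x ^+ m).
Proof.
move=> sf; elim: m => [|m IH].
  by under [X in rsmooth X]eq_fun do rewrite expr0; exact: rsmooth_cst.
by under [X in rsmooth X]eq_fun do rewrite exprS; exact: rsmoothM.
Qed.

(** The class stable under derivation is that of the quotients u / f^m: the quotient rule gives
    again such a quotient, with exponent m + m. *)
Lemma rsmoothV f : (forall x, f x != 0) -> rsmooth f ->
  rsmooth (fun x => (f x)^-1).
Proof.
move=> f0 sf; have cf := rsmooth_continuous sf.
apply: (rsmooth_coind (Q := fun v =>
    exists u (m : nat), rsmooth u /\ v = fun x => u x * (f x ^+ m)^-1)).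
- move=> _ [u [m [su ->]]]; apply: continuous_mul; first exact: rsmooth_continuous.
  apply: continuous_inv; first by move=> x; rewrite expf_neq0.
  exact/rsmooth_continuous/rsmoothX.
- move=> _ V [u [m [su ->]]].
  exists (fun x => rderive u V x * (f x ^+ m)^-1 +
    u x * (- rderive (fun x => f x ^+ m) V x * (f x ^+ m) ^- 2)).
    exists (fun x => rderive u V x * f x ^+ m +
      -1 * (u x * rderive (fun x => f x ^+ m) V x)), (m + m)%N; split.
      apply: rsmoothD; first by apply: rsmoothM; [exact: rsmooth_rderive|exact: rsmoothX].
      apply: rsmoothM; first exact: rsmooth_cst.
      by apply: rsmoothM; [exact: su|exact/rsmooth_rderive/rsmoothX].
    apply/funext => x; rewrite exprD.
    have := expf_neq0 m (f0 x).
    generalize (rderive u V x) (rderive (fun x => f x ^+ m) V x) => a b.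
    by move: (f x ^+ m) (u x) => c d c0; field.
  move=> g; apply: diffq_derivM; first exact: diffq_rderive.
  apply: diffqV; first by rewrite expf_neq0.
    exact/diffq_rderive/rsmoothX.
  exact/rsmooth_continuous/rsmoothX.
- exists (fun=> 1), 1%N; split; first exact: rsmooth_cst.
  by apply/funext => x; rewrite mul1r expr1.
Qed.

(** The quotient of [f] is that of u = f^2 divided by f(g) + f(g + tV), whose limit 2 f(g) is
    nonzero. *)
Lemma diffq_sqrt f u V g l : (forall x, f x != 0) -> continuous f ->
  (forall x, 0 < f x) -> (forall x, f x ^+ 2 = u x) ->
  diffq u V g t @[t --> (0 : R)^'] --> l ->
  diffq f V g t @[t --> (0 : R)^'] --> l * (2 * f g)^-1.
Proof.
move=> f0 cf fp fu ul.
have fc : f g + ext0 f (GLmx g + ofreal t *: V) @[t --> (0 : R)^'] --> 2 * f g.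
  apply/cplx_cvg0P => e e0; have [d d0 H] := near_plane g V 0 cf e0.
  exists d => // t t0 td; have [|h] := H t 0 td; first by rewrite normr0.
  rewrite scaler0 addr0 => <-; rewrite ext0_GL; congr (cabs _ < _); ring.
have g20 : 2 * f g != 0 by rewrite mulf_neq0// pnatr_eq0.
have := cplx_cvg0M ul (cplx_cvg0V g20 fc).
have [d d0 H] := near_plane g V 0 cf ltr01.
move=> /cplx_cvg0P K; apply/cplx_cvg0P => e /K[d' d'0 {}K].
exists (Num.min d d'); first by rewrite lt_min d0.
move=> t t0; rewrite lt_min => /andP[td td'].
have [|h hE _] := H t 0 td; first by rewrite normr0.
move: hE; rewrite scaler0 addr0 => hE.
have := K t t0 td'; congr (cabs (_ - _) < _).
rewrite /diffq -hE !ext0_GL -!fu.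
have t0' : ofreal t != 0 by rewrite ofreal_eq0.
have s0 : f g + f h != 0 by rewrite gt_eqF// addr_gt0.
move: (f h) (f g) s0 (ofreal t) t0' => a b s0 r r0.
by field; rewrite r0.
Qed.

(** The class of products w f with [w] smooth is stable, because the derivative of [f] is u' / (2u)
    times [f] itself. *)
Lemma rsmooth_sqrt f u : continuous f -> (forall x, 0 < f x) ->
  (forall x, f x ^+ 2 = u x) -> rsmooth u -> rsmooth f.
Proof.
move=> cf fp fu su; have f0 x : f x != 0 by rewrite gt_eqF.
have u0 x : u x != 0 by rewrite -fu expf_neq0.
apply: (rsmooth_coind (Q := fun v =>
    exists2 w, rsmooth w & v = fun x => w x * f x)).
- move=> _ [w sw ->]; apply: continuous_mul; [exact: rsmooth_continuous|exact: cf].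
- move=> _ V [w sw ->].
  exists (fun x => rderive w V x * f x + w x * (rderive u V x * (2 * f x)^-1)).
    exists (fun x => rderive w V x + w x * (rderive u V x * (2^-1 * (u x)^-1))).
      apply: rsmoothD; first exact: rsmooth_rderive.
      apply: rsmoothM; first exact: sw.
      apply: rsmoothM; first exact: rsmooth_rderive.
      by apply: rsmoothM; [exact: rsmooth_cst|exact: rsmoothV].
    apply/funext => x; rewrite -fu; have := f0 x.
    generalize (rderive w V x) (rderive u V x) => a b.
    by move: (w x) (f x) => c d d0; field.
  move=> g; apply: diffq_derivM; first exact: diffq_rderive.
  by apply: diffq_sqrt => //; exact: diffq_rderive.
- by exists (fun=> 1); [exact: rsmooth_cst|apply/funext => x; rewrite mul1r].
Qed.

End SmoothClosure.

(** * The algebra of smooth functions and its left-translation derivations *)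

Section SmoothAlgebra.
Variables (R : realType) (n : nat).
Local Notation C := (Cplx R).
Local Notation G := (GL R n).

Definition rsmooth_pred : {pred G -> C} := fun f => `[< rsmooth f >].

(** Bundled so that smooth functions form a commutative ring and a module: determinants with smooth
    entries make sense, and derivations become linear endomorphisms that can be substituted into
    polynomials. *)
Record smoothGL : Type := SmoothGL {
  smooth_fun :> G -> C;
  _ : smooth_fun \in rsmooth_pred }.

HB.instance Definition _ := [isSub for smooth_fun].
HB.instance Definition _ := [Choice of smoothGL by <:].

Lemma smoothP (f : smoothGL) : rsmooth f.
Proof. exact/asboolP/(valP f). Qed.

Definition mk_smooth f (sf : rsmooth f) : smoothGL := SmoothGL (asboolT sf).

Lemma mk_smoothE f (sf : rsmooth f) : (mk_smooth sf : G -> C) = f.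
Proof. by []. Qed.

Fact rsmooth_submod_closed : submod_closed rsmooth_pred.
Proof.
split=> [|c f1 f2 /asboolP s1 /asboolP s2]; apply/asboolP.
- exact: rsmooth0.
- exact: rsmooth_linear s1 s2.
Qed.

HB.instance Definition _ := GRing.isSubmodClosed.Build C
  (G -> C) rsmooth_pred rsmooth_submod_closed.
HB.instance Definition _ := [SubChoice_isSubLmodule of smoothGL by <:].

Definition smooth_mul (f u : smoothGL) : smoothGL :=
  mk_smooth (rsmoothM (smoothP f) (smoothP u)).
Definition smooth_one : smoothGL := mk_smooth (@rsmooth_cst R n 1).

Lemma smooth_ext (f u : smoothGL) : (forall x, f x = u x) -> f = u.
Proof. by move=> fu; apply: val_inj; apply/funext. Qed.

Fact smooth_mulA : associative smooth_mul.
Proof. by move=> f u v; apply: smooth_ext => x; exact: mulrA. Qed.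
Fact smooth_mulC : commutative smooth_mul.
Proof. by move=> f u; apply: smooth_ext => x; exact: mulrC. Qed.
Fact smooth_mul1 : left_id smooth_one smooth_mul.
Proof. by move=> f; apply: smooth_ext => x; exact: mul1r. Qed.
Fact smooth_mulDl : left_distributive smooth_mul +%R.
Proof. by move=> f u v; apply: smooth_ext => x; exact: mulrDl. Qed.
Fact smooth_one_neq0 : smooth_one != 0.
Proof.
apply/eqP => /(congr1 (fun f : smoothGL => f (GLone R n))) /eqP.
by rewrite [_ == _](oner_eq0 C).
Qed.

HB.instance Definition _ := GRing.Zmodule_isComNzRing.Build smoothGL
  smooth_mulA smooth_mulC smooth_mul1 smooth_mulDl smooth_one_neq0.

Implicit Types (f u v : smoothGL) (g h : G) (V W A X Y : 'M[C]_n) (c z : C).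

Lemma smoothDE f u x : (f + u) x = f x + u x. Proof. by []. Qed.
Lemma smoothNE f x : (- f) x = - f x. Proof. by []. Qed.
Lemma smoothME f u x : (f * u) x = f x * u x. Proof. by []. Qed.
Lemma smoothZE c f x : (c *: f) x = c * f x. Proof. by []. Qed.
Lemma smooth0E x : (0 : smoothGL) x = 0. Proof. by []. Qed.
Lemma smooth1E x : (1 : smoothGL) x = 1. Proof. by []. Qed.

Lemma smooth_sumE (I : Type) (r : seq I) (P : pred I) (F : I -> smoothGL) x :
  (\sum_(i <- r | P i) F i) x = \sum_(i <- r | P i) F i x.
Proof. by elim/big_ind2: _ => // f1 a f2 b <- <-. Qed.

Lemma smooth_prodE (I : Type) (r : seq I) (P : pred I) (F : I -> smoothGL) x :
  (\prod_(i <- r | P i) F i) x = \prod_(i <- r | P i) F i x.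
Proof. by elim/big_ind2: _ => // f1 a f2 b <- <-. Qed.

Lemma smoothXE f m x : (f ^+ m) x = f x ^+ m.
Proof. by elim: m => // m IH; rewrite !exprS smoothME IH. Qed.

Lemma smoothZAl c f u : c *: (f * u) = (c *: f) * u.
Proof. by apply: smooth_ext => x; rewrite !(smoothME, smoothZE) mulrA. Qed.

Lemma smoothZAr c f u : c *: (f * u) = f * (c *: u).
Proof. by apply: smooth_ext => x; rewrite !(smoothME, smoothZE) mulrCA. Qed.

Definition dreal V f : smoothGL := mk_smooth (rsmooth_rderive V (@smoothP f)).

Lemma drealE V f x : dreal V f x = rderive f V x. Proof. by []. Qed.

Lemma dreal_linear V c f u : dreal V (c *: f + u) = c *: dreal V f + dreal V u.
Proof.
by apply: smooth_ext => x; exact: (rderive_linear V x c (@smoothP f) (@smoothP u)).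
Qed.

HB.instance Definition _ V :=
  GRing.isLinear.Build C smoothGL smoothGL *:%R (dreal V)
    (fun c f u => dreal_linear V c f u).

Lemma drealZ V c f : dreal V (c *: f) = c *: dreal V f.
Proof. exact: linearZ. Qed.

Lemma drealB V f u : dreal V (f - u) = dreal V f - dreal V u.
Proof. exact: linearB. Qed.

Lemma drealM V f u : dreal V (f * u) = dreal V f * u + f * dreal V u.
Proof.
by apply: smooth_ext => x; exact: (rderiveM V x (@smoothP f) (@smoothP u)).
Qed.

Lemma drealC V W f : dreal V (dreal W f) = dreal W (dreal V f).
Proof. by apply: smooth_ext => x; exact: (rderiveC W V x (@smoothP f)). Qed.

Lemma dreal_dirD V W f : dreal (V + W) f = dreal V f + dreal W f.
Proof. by apply: smooth_ext => x; exact: (rderiveD V W x (@smoothP f)). Qed.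

Lemma dreal_dirZ V f (r : R) : dreal (ofreal r *: V) f = ofreal r *: dreal V f.
Proof. by apply: smooth_ext => x; exact: (rderiveZ V x r (@smoothP f)). Qed.

Lemma dreal_dirN V f : dreal (- V) f = - dreal V f.
Proof.
by rewrite -scaleN1r -[X in X *: V]/(- (1 : C)) -ofreal1 -ofrealN dreal_dirZ
  ofrealN scaleN1r.
Qed.

(* [b] selects the holomorphic ([false]) or antiholomorphic ([true]) version of
   each object, so that both operators of the theorem come from one argument. *)
Definition cjg (b : bool) c : C := if b then Num.conj c else c.

Lemma cjgD b c z : cjg b (c + z) = cjg b c + cjg b z.
Proof. by case: b => //=; rewrite conjCD. Qed.

Lemma cjgM b c z : cjg b (c * z) = cjg b c * cjg b z.
Proof. by case: b => //=; rewrite conjCM. Qed.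

Lemma cjg1 b : cjg b 1 = 1.
Proof. by case: b => //=; rewrite rmorph1. Qed.

Lemma cjg0 b : cjg b 0 = 0.
Proof. by case: b => //=; rewrite rmorph0. Qed.

Lemma cjg_ofreal b (r : R) : cjg b (ofreal r) = ofreal r.
Proof. by case: b => //=; rewrite conj_ofreal. Qed.

Definition entry b i j : smoothGL :=
  if b then mk_smooth (rsmooth_conj (@rsmooth_coord R n i j))
  else mk_smooth (@rsmooth_coord R n i j).

Lemma coordE b i j x : entry b i j x = cjg b (GLmx x i j).
Proof. by case: b. Qed.

Lemma dreal_coord V b i j : dreal V (entry b i j) = cjg b (V i j) *: (1 : smoothGL).
Proof.
apply: smooth_ext => x; rewrite smoothZE smooth1E mulr1 drealE.
case: b; last exact: rderive_coord.
by rewrite [LHS](rderive_conj _ _ (@rsmooth_coord R n i j)) rderive_coord.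
Qed.

Definition cpxi b : C := if b then - 'i else 'i.

(** The Wirtinger derivative in the direction [V]: d/dz for [b = false] and d/dzbar for
    [b = true]. *)
Definition dwirt b V f : smoothGL :=
  2^-1 *: (dreal V f - cpxi b *: dreal ('i *: V) f).

Lemma dwirtE b V f x :
  dwirt b V f x = 2^-1 * (dreal V f x - cpxi b * dreal ('i *: V) f x).
Proof. by []. Qed.

Lemma dwirt_linear b V c f u :
  dwirt b V (c *: f + u) = c *: dwirt b V f + dwirt b V u.
Proof.
apply: smooth_ext => x; rewrite smoothDE smoothZE !dwirtE !dreal_linear.
rewrite !smoothDE !smoothZE.
generalize (dreal V f x) (dreal V u x) (dreal ('i *: V) f x) (dreal ('i *: V) u x).
by move: (cpxi b) => r p1 p2 p3 p4; ring.
Qed.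

HB.instance Definition _ b V :=
  GRing.isLinear.Build C smoothGL smoothGL *:%R (dwirt b V)
    (fun c f u => dwirt_linear b V c f u).

Lemma dwirtM b V f u : dwirt b V (f * u) = dwirt b V f * u + f * dwirt b V u.
Proof.
apply: smooth_ext => x; rewrite smoothDE !smoothME !dwirtE !drealM.
rewrite !smoothDE !smoothME.
generalize (dreal V f x) (dreal V u x) (dreal ('i *: V) f x) (dreal ('i *: V) u x).
by move: (cpxi b) (f x) (u x) => r q1 q2 p1 p2 p3 p4; ring.
Qed.

Lemma dwirtC b b' V W f : dwirt b V (dwirt b' W f) = dwirt b' W (dwirt b V f).
Proof.
rewrite /dwirt !(drealZ, drealB).
rewrite (drealC V W) (drealC V _ f) (drealC _ W f) (drealC ('i *: V) ('i *: W)).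
apply: smooth_ext => x; rewrite !(smoothZE, smoothDE, smoothNE).
generalize (dreal W (dreal V f) x) (dreal W (dreal ('i *: V) f) x).
generalize (dreal ('i *: W) (dreal V f) x) (dreal ('i *: W) (dreal ('i *: V) f) x).
by move: (cpxi b) (cpxi b') => r r' p1 p2 p3 p4; ring.
Qed.

Lemma dwirt_dirD b V W f : dwirt b (V + W) f = dwirt b V f + dwirt b W f.
Proof.
apply: smooth_ext => x; rewrite smoothDE !dwirtE scalerDr !dreal_dirD !smoothDE.
generalize (dreal V f x) (dreal W f x) (dreal ('i *: V) f x) (dreal ('i *: W) f x).
by move: (cpxi b) => r p1 p2 p3 p4; ring.
Qed.

Lemma cpxi2 b : cpxi b * cpxi b = -1.
Proof. by case: b; rewrite /= ?mulrNN -expr2 sqrCi. Qed.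

Lemma dwirt_dir_ofreal b V f (r : R) :
  dwirt b (ofreal r *: V) f = ofreal r *: dwirt b V f.
Proof.
rewrite /dwirt scalerA mulrC -scalerA !dreal_dirZ.
by rewrite !scalerBr !scalerA; congr (_ *: _ - _ *: _); ring.
Qed.

Lemma dwirt_dir_i b V f : dwirt b ('i *: V) f = cpxi b *: dwirt b V f.
Proof.
rewrite /dwirt scalerA -expr2 sqrCi scaleN1r dreal_dirN.
rewrite scalerA mulrC -scalerA; congr (_ *: _).
by rewrite scalerBr scalerN opprK scalerA cpxi2 scaleN1r opprK addrC.
Qed.

Lemma cjgi b : cjg b 'i = cpxi b.
Proof. by case: b => //=; rewrite conjCi. Qed.

Lemma cplx_rect z : z = ofreal (complex.Re z) + 'i * ofreal (complex.Im z).
Proof.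
by rewrite {1}[z]complexE; congr (_ + _ * _).
Qed.

(** This is the gain over [dreal], which is only real-linear in the direction: complex directions
    can now be expanded in elementary matrices. *)
Lemma dwirt_dirZ b V f c : dwirt b (c *: V) f = cjg b c *: dwirt b V f.
Proof.
rewrite [c]cplx_rect scalerDl -scalerA dwirt_dirD dwirt_dir_i !dwirt_dir_ofreal.
by rewrite cjgD cjgM cjgi !cjg_ofreal scalerDl scalerA.
Qed.

Lemma dwirt_dir0 b f : dwirt b 0 f = 0.
Proof. by rewrite -(scale0r (0 : 'M[C]_n)) dwirt_dirZ cjg0 scale0r. Qed.

Lemma dwirt_dir_sum b f (I : Type) (r : seq I) (P : pred I) (F : I -> 'M[C]_n) :
  dwirt b (\sum_(i <- r | P i) F i) f = \sum_(i <- r | P i) dwirt b (F i) f.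
Proof.
elim/big_rec2: _ => [|i u v _ <-]; first exact: dwirt_dir0.
by rewrite dwirt_dirD.
Qed.

Lemma dwirt_coord b b' V i j :
  dwirt b V (entry b' i j) = if b == b' then cjg b (V i j) *: (1 : smoothGL) else 0.
Proof.
rewrite /dwirt !dreal_coord mxE cjgM cjgi scalerA -scalerBl scalerA mulrA.
have -> : 2^-1 * (cjg b' (V i j) - cpxi b * cpxi b' * cjg b' (V i j)) =
    if b == b' then cjg b (V i j) else 0.
  case: eqP => [->|bb'].
    by rewrite cpxi2; move: (cjg b' (V i j)) => z; field.
  have -> : cpxi b * cpxi b' = 1.
    by case: b b' bb' => [] [] //= _; rewrite ?mulNr ?mulrN -expr2 sqrCi opprK.
  by rewrite mul1r subrr mulr0.
by case: ifP => _ //; rewrite scale0r.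
Qed.

Lemma dreal_dwirt V f : dreal V f = dwirt false V f + dwirt true V f.
Proof.
apply: smooth_ext => x; rewrite smoothDE !dwirtE.
have -> : cpxi true = - cpxi false by [].
generalize (dreal V f x) (dreal ('i *: V) f x).
by move: (cpxi false) => r p1 p2; field.
Qed.

(** The infinitesimal left translation by the elementary matrix E_ij: the only nonzero row of E_ij y
    is the row i, and it equals the row j of y, hence these coefficients. *)
Definition dleft b i j f : smoothGL :=
  \sum_l entry b j l * dwirt b (delta_mx i l) f.

Lemma dleft_linear b i j c f u :
  dleft b i j (c *: f + u) = c *: dleft b i j f + dleft b i j u.
Proof.
rewrite /dleft scaler_sumr -big_split; apply: eq_bigr => l _ /=.
by rewrite linearP mulrDr smoothZAr.
Qed.

HB.instance Definition _ b i j :=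
  GRing.isLinear.Build C smoothGL smoothGL *:%R (dleft b i j)
    (fun c f u => dleft_linear b i j c f u).

Lemma dleftM b i j f u : dleft b i j (f * u) = dleft b i j f * u + f * dleft b i j u.
Proof.
rewrite /dleft mulr_suml mulr_sumr -big_split; apply: eq_bigr => l _ /=.
by rewrite dwirtM mulrDr mulrA mulrCA.
Qed.

Lemma dwirt_mul b X f (x : G) :
  dwirt b (X *m GLmx x) f x = \sum_i \sum_j cjg b (X i j) * dleft b i j f x.
Proof.
rewrite [X *m _]matrix_sum_delta dwirt_dir_sum smooth_sumE.
apply: eq_bigr => i _; rewrite dwirt_dir_sum smooth_sumE.
transitivity (\sum_l \sum_j
    cjg b (X i j) * (cjg b (GLmx x j l) * dwirt b (delta_mx i l) f x)).
  apply: eq_bigr => l _; rewrite dwirt_dirZ smoothZE mxE.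
  rewrite (big_morph (cjg b) (cjgD b) (cjg0 b)) mulr_suml.
  by apply: eq_bigr => j _; rewrite cjgM mulrA.
rewrite exchange_big; apply: eq_bigr => j _; rewrite /dleft smooth_sumE mulr_sumr.
by apply: eq_bigr => l _; rewrite smoothME coordE.
Qed.

(** The second order parts of the two products coincide because constant-direction derivatives
    commute; what remains comes from differentiating the coefficients. The sign is opposite to that
    of the matrix commutator, as usual for left translations. *)
Lemma dleft_bracket b i j i' j' f :
  dleft b i j (dleft b i' j' f) - dleft b i' j' (dleft b i j f) =
  (if i == j' then dleft b i' j f else 0) - (if i' == j then dleft b i j' f else 0).
Proof.
have E (p p' q q' : 'I_n) : dleft b p p' (dleft b q q' f) =
  (if p == q' then dleft b q p' f else 0) +
  \sum_l \sum_l' entry b p' l * entry b q' l' *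
    dwirt b (delta_mx p l) (dwirt b (delta_mx q l') f).
  rewrite {1}/dleft; transitivity (\sum_l \sum_l'
    ((if (p == q') && (l == l') then entry b p' l * dwirt b (delta_mx q l') f else 0)
     + entry b p' l * entry b q' l' *
       dwirt b (delta_mx p l) (dwirt b (delta_mx q l') f))).
    apply: eq_bigr => l _; rewrite linear_sum mulr_sumr; apply: eq_bigr => l' _ /=.
    rewrite dwirtM dwirt_coord eqxx mxE mulrDr; congr (_ + _); last by rewrite mulrA.
    rewrite eq_sym [l' == l]eq_sym; case: andP => _.
      by rewrite cjg1 scale1r mul1r.
    by rewrite cjg0 scale0r mul0r mulr0.
  under eq_bigr do rewrite big_split.
  rewrite big_split; congr (_ + _) => /=; case: eqP => _ /=.
    apply: eq_bigr => l _; rewrite (bigD1 l)//= eqxx big1 ?addr0// => l' nl.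
    by rewrite eq_sym (negPf nl).
  by rewrite big1 // => l _; rewrite big1.
rewrite !E opprD addrACA [X in _ + X](_ : _ = 0) ?addr0//.
apply/eqP; rewrite subr_eq0; apply/eqP; rewrite [RHS]exchange_big.
apply: eq_bigr => l _; apply: eq_bigr => l' _.
by rewrite dwirtC [entry b j l * _]mulrC.
Qed.

(** The coefficients of one operator are annihilated by the derivatives in the other, so only the
    symmetric second order part survives. *)
Lemma dleft_mixed b b' i j i' j' f : b != b' ->
  dleft b i j (dleft b' i' j' f) = dleft b' i' j' (dleft b i j f).
Proof.
move=> bb'; have E (c c' : bool) (p p' q q' : 'I_n) : c != c' ->
  dleft c p p' (dleft c' q q' f) = \sum_l \sum_l' entry c p' l * entry c' q' l' *
    dwirt c (delta_mx p l) (dwirt c' (delta_mx q l') f).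
  move=> cc'; rewrite {1}/dleft; apply: eq_bigr => l _.
  rewrite linear_sum mulr_sumr; apply: eq_bigr => l' _ /=.
  by rewrite dwirtM dwirt_coord (negPf cc') mul0r add0r mulrA.
have b'b : b' != b by rewrite eq_sym.
rewrite (E _ _ _ _ _ _ bb') (E _ _ _ _ _ _ b'b) [RHS]exchange_big.
apply: eq_bigr => l _; apply: eq_bigr => l' _.
by rewrite dwirtC [entry b j l * _]mulrC.
Qed.

End SmoothAlgebra.

(** * Polynomials in commuting operators *)

Section PolynomialAction.
Variables (K : comNzRingType) (N : nat).
Local Notation poly := (mpoly N K).

Lemma mpoly_mulX_ind (Q : poly -> Prop) : Q 1 ->
  (forall c P1 P2, Q P1 -> Q P2 -> Q (c *: P1 + P2)) ->
  (forall i P, Q P -> Q (mpolyX K (mnm1 i) * P)) -> forall P, Q P.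
Proof.
move=> Q1 Qlin QX.
have Q0 : Q 0.
  have := Qlin (-1) _ _ Q1 Q1; by rewrite scaleN1r addNr.
apply: mpolyind => // c m P _ _ QP; apply: (Qlin) => //.
rewrite mpolyXE_id; elim/big_rec: _ => // i P' _ QP'.
by elim: (m i) => [|e IH]; rewrite ?expr0 ?mul1r // exprS -mulrA; exact: QX.
Qed.

Variables (V : lmodType K) (D : 'I_N -> {linear V -> V}).
Hypothesis DC : forall i j v, D i (D j v) = D j (D i v).

(** A composite of operators needs an order, fixed here by the list [s]; commutativity makes it
    immaterial. An arbitrary [s] is allowed for inductions on the enumeration. *)
Definition mon_act (s : seq 'I_N) (m : multinom N) (v : V) : V :=
  foldr (fun i => iter (m i) (D i)) v s.

Definition poly_act (P : poly) (v : V) : V :=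
  \sum_(m <- msupp P) mcoeff m P *: mon_act (enum 'I_N) m v.

Lemma iter_linear i e c v w :
  iter e (D i) (c *: v + w) = c *: iter e (D i) v + iter e (D i) w.
Proof. by elim: e => //= e ->; rewrite linearP. Qed.

Lemma mon_act_linear s m c v w :
  mon_act s m (c *: v + w) = c *: mon_act s m v + mon_act s m w.
Proof. by elim: s => //= i s ->; rewrite iter_linear. Qed.

Lemma poly_act_linear P c v w :
  poly_act P (c *: v + w) = c *: poly_act P v + poly_act P w.
Proof.
rewrite /poly_act scaler_sumr -big_split; apply: eq_bigr => m _ /=.
by rewrite mon_act_linear scalerDr !scalerA mulrC.
Qed.

HB.instance Definition _ P := GRing.isLinear.Build K V V *:%R (poly_act P)
  (fun c v w => poly_act_linear P c v w).

Lemma mon_actX s i m v : uniq s -> mon_act s (mnm_add (mnm1 i) m) v =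
  if i \in s then D i (mon_act s m v) else mon_act s m v.
Proof.
elim: s => //= j s IH /andP[js us]; rewrite mnmDE mnm1E IH// inE.
have [->|ij] /= := eqVneq i j; first by rewrite (negPf js) iterD.
rewrite add0n; case: (i \in s) => //.
by elim: (m j) => //= e ->; rewrite DC.
Qed.

Lemma poly_act_supp (s : seq (multinom N)) P v : uniq s -> {subset msupp P <= s} ->
  poly_act P v = \sum_(m <- s) mcoeff m P *: mon_act (enum 'I_N) m v.
Proof.
move=> us Ps; rewrite [RHS](bigID (fun m => m \in msupp P)) /=.
rewrite [X in _ + X]big1 ?addr0; last first.
  by move=> m; rewrite -mcoeff_eq0 => /eqP ->; rewrite scale0r.
rewrite -big_filter; apply: perm_big; apply: uniq_perm; first exact: msupp_uniq.
  exact: filter_uniq.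
by move=> m; rewrite mem_filter; case: (boolP (m \in msupp P)) => // /Ps ->.
Qed.

Lemma poly_actP c P Q v :
  poly_act (c *: P + Q) v = c *: poly_act P v + poly_act Q v.
Proof.
pose s := undup (msupp (c *: P + Q) ++ msupp P ++ msupp Q).
rewrite !(@poly_act_supp s) ?undup_uniq//;
  try by move=> m; rewrite mem_undup !mem_cat => ->; rewrite ?orbT.
rewrite scaler_sumr -big_split; apply: eq_bigr => m _ /=.
by rewrite mcoeffD mcoeffZ scalerDl scalerA.
Qed.

Lemma poly_act0 v : poly_act 0 v = 0.
Proof. by rewrite /poly_act msupp0 big_nil. Qed.

Lemma poly_actZ c P v : poly_act (c *: P) v = c *: poly_act P v.
Proof. by rewrite -[c *: P]addr0 poly_actP poly_act0 addr0. Qed.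

Lemma poly_actD P Q v : poly_act (P + Q) v = poly_act P v + poly_act Q v.
Proof. by rewrite -[P]scale1r poly_actP !scale1r. Qed.

Lemma poly_actN P v : poly_act (- P) v = - poly_act P v.
Proof. by rewrite -[- P]scaleN1r poly_actZ scaleN1r. Qed.

Lemma poly_act_sum (I : Type) (r : seq I) (F : I -> poly) v :
  poly_act (\sum_(i <- r) F i) v = \sum_(i <- r) poly_act (F i) v.
Proof.
elim/big_rec2: _ => [|i P Q _ <-]; first exact: poly_act0.
exact: poly_actD.
Qed.

Lemma poly_act1 v : poly_act 1 v = v.
Proof.
rewrite /poly_act msupp1 big_seq1 mcoeff1 eqxx scale1r /mon_act.
by elim: (enum _) => //= i s ->; rewrite mnm0E.
Qed.

Lemma poly_act_monX i m v :
  poly_act (mpolyX K (mnm1 i) * mpolyX K m) v = D i (poly_act (mpolyX K m) v).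
Proof.
rewrite -mpolyXD /poly_act !msuppX !big_seq1 !mcoeffX !eqxx !scale1r.
by rewrite mon_actX ?enum_uniq// mem_enum.
Qed.

Lemma poly_actX i P v :
  poly_act (mpolyX K (mnm1 i) * P) v = D i (poly_act P v).
Proof.
elim/mpolyind: P => [|c m P _ _ IH]; first by rewrite mulr0 poly_act0 linear0.
by rewrite mulrDr -scalerAr !poly_actP poly_act_monX IH linearP.
Qed.

Lemma poly_act_comm (L : {linear V -> V}) P v :
  (forall i w, L (D i w) = D i (L w)) -> L (poly_act P v) = poly_act P (L v).
Proof.
move=> LD; elim/mpoly_mulX_ind: P => [|c P1 P2 h1 h2|i P h].
- by rewrite !poly_act1.
- by rewrite !poly_actP linearP h1 h2.
- by rewrite !poly_actX LD h.
Qed.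

End PolynomialAction.

(** * Derivative of a determinant under an abstract derivation *)

Section DerivationDet.
Variables (A : comNzRingType) (d : A -> A).
Hypotheses (dD : forall a b, d (a + b) = d a + d b)
  (dM : forall a b, d (a * b) = d a * b + a * d b).

Lemma derivation0 : d 0 = 0.
Proof. by have /eqP := dD 0 0; rewrite addr0 -subr_eq0 opprD addNKr oppr_eq0 => /eqP. Qed.

Lemma derivationN a : d (- a) = - d a.
Proof. by apply/eqP; rewrite -addr_eq0 -dD addNr derivation0. Qed.

Lemma derivation1 : d 1 = 0.
Proof.
have /eqP := dM 1 1; rewrite !mulr1 mul1r -subr_eq0 opprD addNKr oppr_eq0.
by move/eqP.
Qed.

Lemma derivation_sign (b : bool) : d ((-1) ^+ b) = 0.
Proof. by case: b; rewrite ?expr1 ?derivationN derivation1 ?oppr0. Qed.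

Lemma derivation_sum (I : Type) (r : seq I) (P : pred I) (F : I -> A) :
  d (\sum_(i <- r | P i) F i) = \sum_(i <- r | P i) d (F i).
Proof. exact: (big_morph d dD derivation0). Qed.

Lemma derivation_prod (I : eqType) (r : seq I) (F : I -> A) : uniq r ->
  d (\prod_(i <- r) F i) = \sum_(i <- r) d (F i) * \prod_(l <- r | l != i) F l.
Proof.
elim: r => [|i r IH] /=; first by rewrite !big_nil derivation1.
case/andP=> ir ur; rewrite !big_cons dM IH// eqxx /= mulr_sumr; congr (_ + _).
  congr (_ * _); rewrite big_seq [RHS]big_seq_cond; apply: eq_bigl => l.
  by case: (boolP (l \in r)) => //= lr; apply/esym; apply: contraNneq ir => <-.
apply: eq_big_seq => l lr; rewrite big_cons.
have -> : i != l by apply: contraNneq ir => ->.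
by rewrite mulrCA.
Qed.

(** Jacobi's formula, for any derivation, since it is applied both to polarization operators on
    polynomials and to [dleft] on smooth functions. *)
Lemma derivation_det m (M : 'M[A]_m) :
  d (\det M) = \sum_i \sum_j d (M i j) * cofactor M i j.
Proof.
(* Only the row [i] is differentiated; the cofactors along that row do not see it and are those of
   [M]. *)
pose Mi i := \matrix_(l, j) if l == i then d (M i j) else M l j.
transitivity (\sum_i \det (Mi i)); last first.
  apply: eq_bigr => i _; rewrite (expand_det_row _ i); apply: eq_bigr => j _.
  rewrite mxE eqxx; congr (_ * _); rewrite /cofactor; congr (_ * \det _).
  by apply/matrixP => a b; rewrite !mxE eq_sym (negPf (neq_lift _ _)).
rewrite {1}/determinant derivation_sum exchange_big; apply: eq_bigr => s _.
rewrite dM derivation_sign mul0r add0r.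
rewrite derivation_prod ?index_enum_uniq// mulr_sumr; apply: eq_bigr => i _.
rewrite [in RHS](bigD1 i) //= mxE eqxx; congr (_ * (_ * _)).
by apply: eq_bigr => l li; rewrite mxE (negPf li).
Qed.

End DerivationDet.

(** * Polarization identities for powers of the generic determinant *)

Section DetPolynomial.
Variables (K : comNzRingType) (k : nat).

Definition var_idx (p q : 'I_k) : 'I_#|{: 'I_k * 'I_k}| := enum_rank (p, q).
Local Notation poly := (mpoly #|{: 'I_k * 'I_k}| K).

Definition pvar p q : poly := mpolyX K (mnm1 (var_idx p q)).
Definition pder p q (P : poly) : poly := mderiv (var_idx p q) P.
Definition pvar_mx : 'M[poly]_k := \matrix_(p, q) pvar p q.
Definition det_pow m : poly := \det pvar_mx ^+ m.

Lemma pderM p q P Q : pder p q (P * Q) = pder p q P * Q + P * pder p q Q.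
Proof. exact: mderivM. Qed.

Lemma pderD p q P Q : pder p q (P + Q) = pder p q P + pder p q Q.
Proof. exact: mderivD. Qed.

Lemma pderZ p q c P : pder p q (c *: P) = c *: pder p q P.
Proof. exact: mderivZ. Qed.

Lemma pder0 p q : pder p q 0 = 0.
Proof. exact: mderiv0. Qed.

Lemma pderC p q p' q' P : pder p q (pder p' q' P) = pder p' q' (pder p q P).
Proof. exact: mderiv_comm. Qed.

Lemma pder_sum p q (I : Type) (r : seq I) (F : I -> poly) :
  pder p q (\sum_(i <- r) F i) = \sum_(i <- r) pder p q (F i).
Proof. exact: (big_morph _ (pderD p q) (pder0 p q)). Qed.

Lemma pder_var p q p' q' :
  pder p q (pvar p' q') = if (p == p') && (q == q') then 1 else 0.
Proof.
rewrite /pder /pvar mderivX mnm1E /var_idx (inj_eq enum_rank_inj) xpair_eqE.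
rewrite [p' == p]eq_sym [q' == q]eq_sym; case: andP => [[/eqP-> /eqP->]|_].
  by rewrite scale1r -[X in mnm_sub X _]add0m addmK mpolyX0.
by rewrite scale0r.
Qed.

(* The polarization operator replacing the column [q] by the column [r]. *)
Definition polarize q r (P : poly) : poly := \sum_p pvar p r * pder p q P.

Lemma polarizeD q r P Q : polarize q r (P + Q) = polarize q r P + polarize q r Q.
Proof.
by rewrite /polarize -big_split; apply: eq_bigr => p _; rewrite pderD mulrDr.
Qed.

Lemma polarizeZ q r c P : polarize q r (c *: P) = c *: polarize q r P.
Proof.
by rewrite /polarize scaler_sumr; apply: eq_bigr => p _; rewrite pderZ scalerAr.
Qed.

Lemma polarizeM q r P Q :
  polarize q r (P * Q) = polarize q r P * Q + P * polarize q r Q.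
Proof.
rewrite /polarize mulr_suml mulr_sumr -big_split; apply: eq_bigr => p _ /=.
by rewrite pderM mulrDr mulrA [P * (_ * _)]mulrCA.
Qed.

Lemma polarize_var q r p' q' :
  polarize q r (pvar p' q') = if q == q' then pvar p' r else 0.
Proof.
rewrite /polarize (bigD1 p')//= big1 ?addr0.
  by rewrite pder_var eqxx /=; case: ifP => _; rewrite ?mulr1 ?mulr0.
by move=> p /negPf pp'; rewrite pder_var pp' mulr0.
Qed.

(** Replacing the column q of the generic matrix X by its column r creates two equal columns unless
    q = r. In formulas, the result is the entry (q, r) of adj(X) X. *)
Lemma polarize_det q r :
  polarize q r (\det pvar_mx) = if q == r then \det pvar_mx else 0.
Proof.
rewrite (derivation_det (polarizeD q r) (polarizeM q r)).
transitivity (\sum_i pvar_mx i r * cofactor pvar_mx i q).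
  apply: eq_bigr => i _; rewrite (bigD1 q)//= big1 ?addr0.
    by rewrite !mxE polarize_var eqxx.
  by move=> j /negPf jq; rewrite mxE polarize_var eq_sym jq mul0r.
have /matrixP/(_ q r) := mul_adj_mx pvar_mx; rewrite !mxE.
have -> : \sum_j (\adj pvar_mx) q j * pvar_mx j r =
    \sum_i pvar_mx i r * cofactor pvar_mx i q.
  by apply: eq_bigr => j _; rewrite mxE mulrC.
by move=> ->; case: eqP.
Qed.

Lemma polarize_det_pow m q r :
  polarize q r (det_pow m) = if q == r then det_pow m *+ m else 0.
Proof.
rewrite /det_pow; elim: m => [|m IH].
  by rewrite (derivation1 (polarizeM q r)) mulr0n if_same.
rewrite exprS polarizeM IH polarize_det; case: eqP => _.
  by rewrite mulrS mulrnAr.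
by rewrite mul0r mulr0 addr0.
Qed.

(** The row analogue, replacing the row [s] by the row [p]; it describes how lower right derivations
    act on symbols. *)
Definition row_polarize p s (P : poly) : poly := \sum_r pvar p r * pder s r P.

Lemma row_polarize1 p s : row_polarize p s 1 = 0.
Proof.
by rewrite /row_polarize big1// => r _; rewrite (derivation1 (pderM s r)) mulr0.
Qed.

Lemma row_polarizeP p s c P Q :
  row_polarize p s (c *: P + Q) = c *: row_polarize p s P + row_polarize p s Q.
Proof.
rewrite /row_polarize scaler_sumr -big_split; apply: eq_bigr => r _ /=.
by rewrite pderD pderZ mulrDr scalerAr.
Qed.

Lemma row_polarizeX p s m t P : row_polarize p s (pvar m t * P) =
  pvar m t * row_polarize p s P + (if m == s then pvar p t * P else 0).
Proof.
rewrite /row_polarize mulr_sumr.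
rewrite (eq_bigr (fun r => pvar m t * (pvar p r * pder s r P)
  + (if (m == s) && (t == r) then pvar p r * P else 0))); last first.
  move=> r _; rewrite pderM pder_var mulrDr addrC; congr (_ + _).
    by rewrite mulrCA.
  by rewrite eq_sym [t == r]eq_sym; case: ifP => _; rewrite ?mul1r ?mul0r ?mulr0.
rewrite big_split; congr (_ + _) => /=.
case: eqP => _ /=; last by rewrite big1.
by rewrite (bigD1 t)//= eqxx big1 ?addr0// => r; rewrite eq_sym => /negPf ->.
Qed.

(** The second order part sum_(p,r) x_pr d_pq d_sr P, grouped by columns so that the rules for
    [polarize] apply. *)
Definition row_col_polarize q s (P : poly) : poly :=
  \sum_r polarize q r (pder s r P).

Lemma row_col_polarize1 q s : row_col_polarize q s 1 = 0.
Proof.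
rewrite /row_col_polarize big1// => r _.
by rewrite (derivation1 (pderM s r)) (derivation0 (polarizeD q r)).
Qed.

Lemma row_col_polarizeP q s c P Q : row_col_polarize q s (c *: P + Q) =
  c *: row_col_polarize q s P + row_col_polarize q s Q.
Proof.
rewrite /row_col_polarize scaler_sumr -big_split; apply: eq_bigr => r _ /=.
by rewrite pderD pderZ polarizeD polarizeZ.
Qed.

(** The two correction terms are, up to sign, the symbol actions of the two Levi derivations
    occurring in the bracket of an upper right derivation with D_mt. *)
Lemma row_col_polarizeX q s m t P : row_col_polarize q s (pvar m t * P) =
  pvar m t * row_col_polarize q s P
  + (if q == t then row_polarize m s P else 0)
  + (if m == s then polarize q t P else 0).
Proof.
rewrite /row_col_polarize mulr_sumr.
rewrite (eq_bigr (fun r => pvar m t * polarize q r (pder s r P)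
  + (if q == t then pvar m r * pder s r P else 0)
  + (if (m == s) && (t == r) then polarize q t P else 0))); last first.
  move=> r _; rewrite pderM polarizeD !polarizeM polarize_var pder_var.
  rewrite addrC; congr (_ + _).
    by rewrite addrC; congr (_ + _); case: ifP; rewrite ?mul0r.
  rewrite eq_sym [r == t]eq_sym; case: andP => [[_ /eqP<-]|_].
    by rewrite (derivation1 (polarizeM q t)) mul0r add0r mul1r.
  by rewrite mul0r addr0 (derivation0 (polarizeD q r)) mul0r.
rewrite !big_split /=; congr (_ + _ + _); first by case: ifP => _ //; rewrite big1.
case: eqP => _ /=; last by rewrite big1.
by rewrite (bigD1 t)//= eqxx big1 ?addr0// => r; rewrite eq_sym => /negPf ->.
Qed.

Definition second_order (lam : K) q s (P : poly) : poly :=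
  lam *: pder s q P - row_col_polarize q s P.

(** Since d_sr polarize_qr = polarize_qr d_sr + d_sq, each of the k values of r costs one -d_sq,
    while only r = q contributes, by m d_sq. Hence the value m - k. *)
Lemma second_order_det_pow m q s :
  second_order (m%:R - k%:R) q s (det_pow m) = 0.
Proof.
rewrite /second_order.
have -> : row_col_polarize q s (det_pow m) =
    \sum_r (pder s r (polarize q r (det_pow m)) - pder s q (det_pow m)).
  apply: eq_bigr => r _; rewrite {2}/polarize pder_sum.
  rewrite (_ : \sum_p _ = \sum_p (if p == s then pder s q (det_pow m) else 0)
    + polarize q r (pder s r (det_pow m))).
    by rewrite -big_mkcond big_pred1_eq addrAC subrr add0r.
  rewrite /polarize -big_split; apply: eq_bigr => p _ /=.
  rewrite pderM pder_var eqxx andbT (pderC s r p q) eq_sym.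
  by case: eqP => [->|_]; rewrite ?mul1r ?mul0r.
rewrite sumrB sumr_const card_ord (bigD1 q)//= big1 ?addr0; last first.
  by move=> r /negPf rq; rewrite polarize_det_pow eq_sym rq pder0.
rewrite polarize_det_pow eqxx scalerBl -!scaler_nat.
by rewrite pderZ subrr.
Qed.

(** The substitution X |-> D X A of the generic matrix. *)
Definition linear_subst (D A : 'M[K]_k) (P : poly) : poly :=
  mmap (@mpolyC #|{: 'I_k * 'I_k}| K) (fun i =>
    \sum_p' \sum_q' (D (enum_val i).1 p' * A q' (enum_val i).2) *: pvar p' q') P.

Lemma linear_substM D A P Q :
  linear_subst D A (P * Q) = linear_subst D A P * linear_subst D A Q.
Proof. exact: rmorphM. Qed.

Lemma linear_subst1 D A : linear_subst D A 1 = 1.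
Proof. exact: rmorph1. Qed.

Lemma linear_substD D A P Q :
  linear_subst D A (P + Q) = linear_subst D A P + linear_subst D A Q.
Proof. exact: rmorphD. Qed.

Lemma linear_substC D A c : linear_subst D A (mpolyC _ c) = mpolyC _ c.
Proof. exact: mmapC. Qed.

Lemma linear_substP D A c P Q :
  linear_subst D A (c *: P + Q) = c *: linear_subst D A P + linear_subst D A Q.
Proof. by rewrite -!mul_mpolyC linear_substD linear_substM linear_substC. Qed.

Lemma linear_subst_var D A p q :
  linear_subst D A (pvar p q) = \sum_p' \sum_q' (D p p' * A q' q) *: pvar p' q'.
Proof. by rewrite /linear_subst /pvar mmapX mmap1U /var_idx enum_rankK. Qed.

Lemma linear_subst_det_pow D A m :
  linear_subst D A (det_pow m) = (\det D * \det A) ^+ m *: det_pow m.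
Proof.
rewrite /det_pow; transitivity (\det (map_mx (linear_subst D A) pvar_mx) ^+ m).
  by rewrite det_map_mx /linear_subst rmorphXn.
suff -> : map_mx (linear_subst D A) pvar_mx =
    map_mx (@mpolyC #|{: 'I_k * 'I_k}| K) D *m pvar_mx
    *m map_mx (@mpolyC #|{: 'I_k * 'I_k}| K) A.
  rewrite !det_mulmx !det_map_mx mulrAC exprMn -!rmorphM -rmorphXn.
  exact: mul_mpolyC.
apply/matrixP => p q; rewrite !mxE linear_subst_var exchange_big.
apply: eq_bigr => q' _; rewrite !mxE mulr_suml; apply: eq_bigr => p' _.
by rewrite !mxE mulrAC -rmorphM; exact/esym/mul_mpolyC.
Qed.

End DetPolynomial.

(** * The singular vector *)

Section HighestWeight.
Variables (R : realType) (k : nat) (b : bool).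
Local Notation C := (Cplx R).
Local Notation G := (GL R (k + k)).
Local Notation S := (smoothGL R (k + k)).
Implicit Types (f g : S) (p q r s : 'I_k).

(* The indices of [dleft] are ordered so that [low p q] derives along the entry
   (p, q) of the lower left block. *)
Definition low p q : {linear S -> S} := dleft b (rshift k p) (lshift k q).

Definition low_idx (i : 'I_#|{: 'I_k * 'I_k}|) : {linear S -> S} :=
  low (enum_val i).1 (enum_val i).2.

Lemma lowC i j f : low_idx i (low_idx j f) = low_idx j (low_idx i f).
Proof.
by apply/eqP; rewrite -subr_eq0 dleft_bracket !eq_rlshift subrr.
Qed.

Definition lowpoly P f : S := poly_act low_idx P f.

Lemma lowpolyX p q P f :
  lowpoly (pvar C p q * P) f = dleft b (rshift k p) (lshift k q) (lowpoly P f).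
Proof.
rewrite /lowpoly /pvar (poly_actX lowC) /low_idx /var_idx enum_rankK.
by [].
Qed.

Lemma lowpoly_ind (Q : mpoly #|{: 'I_k * 'I_k}| C -> Prop) : Q 1 ->
  (forall c P1 P2, Q P1 -> Q P2 -> Q (c *: P1 + P2)) ->
  (forall p q P, Q P -> Q (pvar C p q * P)) -> forall P, Q P.
Proof.
move=> Q1 Qlin QX; apply: mpoly_mulX_ind => // i P QP.
have -> : mpolyX C (mnm1 i) = pvar C (enum_val i).1 (enum_val i).2.
  by rewrite /pvar /var_idx -surjective_pairing enum_valK.
exact: QX.
Qed.

Lemma lowpolyP c P Q f : lowpoly (c *: P + Q) f = c *: lowpoly P f + lowpoly Q f.
Proof. exact: poly_actP. Qed.

Lemma lowpoly1 f : lowpoly 1 f = f.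
Proof. exact: poly_act1. Qed.

Lemma lowpolyD P Q f : lowpoly (P + Q) f = lowpoly P f + lowpoly Q f.
Proof. exact: poly_actD. Qed.

Lemma lowpolyN P f : lowpoly (- P) f = - lowpoly P f.
Proof. exact: poly_actN. Qed.

Lemma lowpolyZ c P f : lowpoly (c *: P) f = c *: lowpoly P f.
Proof. exact: poly_actZ. Qed.

Lemma lowpoly0 f : lowpoly 0 f = 0.
Proof. exact: poly_act0. Qed.

Lemma dleft_swap i j i' j' f :
  dleft b i j (dleft b i' j' f) = dleft b i' j' (dleft b i j f) +
  ((if i == j' then dleft b i' j f else 0) - (if i' == j then dleft b i j' f else 0)).
Proof. by rewrite -dleft_bracket addrC subrK. Qed.

(** Bracketing with this derivation turns D_pq into D_pr and annihilates the D from other columns,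
    so on symbols it is the derivation [polarize q r]. *)
Lemma lowpoly_upper_left q r P f :
  dleft b (lshift k q) (lshift k r) (lowpoly P f) =
  lowpoly P (dleft b (lshift k q) (lshift k r) f) + lowpoly (polarize q r P) f.
Proof.
elim/lowpoly_ind: P => [|c P1 P2 h1 h2|p q' P h].
- by rewrite !lowpoly1 (derivation1 (polarizeM q r)) lowpoly0 addr0.
- have -> : polarize q r (c *: P1 + P2) = c *: polarize q r P1 + polarize q r P2.
    by rewrite polarizeD polarizeZ.
  by rewrite !lowpolyP dleft_linear h1 h2 scalerDr addrACA.
- rewrite !lowpolyX dleft_swap h linearD polarizeM lowpolyD lowpolyX /=.
  rewrite polarize_var eq_rlshift subr0 eq_shift -addrA; congr (_ + _).
  rewrite addrC; congr (_ + _).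
  by case: eqP => _; rewrite ?lowpolyX ?mul0r ?lowpoly0.
Qed.

(** Now the bracket changes the row index from [s] to [p], and with a minus sign because the matrix
    acts on the other side of the block. *)
Lemma lowpoly_lower_right p s P f :
  dleft b (rshift k p) (rshift k s) (lowpoly P f) =
  lowpoly P (dleft b (rshift k p) (rshift k s) f) - lowpoly (row_polarize p s P) f.
Proof.
elim/lowpoly_ind: P => [|c P1 P2 h1 h2|m t P h].
- by rewrite !lowpoly1 row_polarize1 lowpoly0 subr0.
- by rewrite row_polarizeP !lowpolyP dleft_linear h1 h2 scalerBr opprD addrACA.
- rewrite !lowpolyX dleft_swap h linearB /= eq_rlshift sub0r eq_shift.
  rewrite row_polarizeX lowpolyD lowpolyX opprD -!addrA; congr (_ + (_ - _)).
  by case: eqP => _; rewrite ?lowpolyX ?lowpoly0.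
Qed.

Section Weight.
Variables (f : S) (lam : C).
Hypothesis ul0 : forall q r, q != r -> dleft b (lshift k q) (lshift k r) f = 0.
Hypothesis dr0 : forall p s, p != s -> dleft b (rshift k p) (rshift k s) f = 0.
Hypothesis ur0 : forall q s, dleft b (lshift k q) (rshift k s) f = 0.
Hypothesis diag : forall q s, dleft b (rshift k s) (rshift k s) f
  - dleft b (lshift k q) (lshift k q) f = lam *: f.

(** Moving the derivation past D_mt leaves Levi derivations, which go through P by the two previous
    lemmas and then act on [f] by the weight hypotheses. The weight enters only when m = s and t =
    q, and then only as the difference [lam]. *)
Lemma lowpoly_upper_right q s P :
  dleft b (lshift k q) (rshift k s) (lowpoly P f) =
  lowpoly (second_order lam q s P) f.
Proof.
have slin c P1 P2 : second_order lam q s (c *: P1 + P2) =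
    c *: second_order lam q s P1 + second_order lam q s P2.
  rewrite /second_order row_col_polarizeP pderD pderZ scalerDr scalerBr opprD addrACA.
  by rewrite !scalerA mulrC.
have sX m t P1 : second_order lam q s (pvar C m t * P1) =
    pvar C m t * second_order lam q s P1
    + ((if (m == s) && (t == q) then lam *: P1 else 0)
    - ((if q == t then row_polarize m s P1 else 0)
       + (if m == s then polarize q t P1 else 0))).
  rewrite /second_order row_col_polarizeX pderM pder_var mulrBr scalerDr.
  have -> : lam *: ((if (s == m) && (q == t) then 1 else 0) * P1) =
      if (m == s) && (t == q) then lam *: P1 else 0.
    by rewrite eq_sym [q == t]eq_sym; case: ifP => _; rewrite ?mul1r ?mul0r ?scaler0.
  by rewrite scalerAr [X in X - _]addrC -[X in _ - X]addrA opprD addrACA.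
elim/lowpoly_ind: P => [|c P1 P2 h1 h2|m t P h].
- by rewrite lowpoly1 ur0 /second_order (derivation1 (pderM s q)) scaler0 sub0r
    row_col_polarize1 oppr0 lowpoly0.
- by rewrite lowpolyP dleft_linear h1 h2 slin lowpolyP.
- rewrite lowpolyX dleft_swap h sX [RHS]lowpolyD lowpolyX.
  congr (_ + _); rewrite !eq_shift lowpoly_lower_right lowpoly_upper_left.
  rewrite [t == q]eq_sym; case: (eqVneq m s) => [->|ms] /=; last first.
    rewrite subr0 add0r addr0 lowpolyN; case: eqP => _; last by rewrite lowpoly0 oppr0.
    by rewrite dr0// /lowpoly linear0 sub0r.
  case: (eqVneq q t) => [<-|qt] /=.
    rewrite lowpolyD lowpolyN lowpolyZ lowpolyD -[lam *: _]linearZ.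
    rewrite -[X in _ = X + _]/(lowpoly P (lam *: f)) -(diag q s).
    rewrite [lowpoly P (_ - _)]linearB /= opprD addrACA.
    by rewrite [in RHS]opprD.
  by rewrite ul0// /lowpoly linear0 !add0r poly_actN.
Qed.

End Weight.

End HighestWeight.

(** * Infinitesimal and global equivariance *)

Section LogDerivative.
Variable R : realType.
Local Notation C := (Cplx R).
Implicit Types (phi psi : R -> C) (l m : C).

(** For a curve through 1 the derivative is the logarithmic derivative, so it is additive under
    products and linear in integer exponents. *)
Definition has_logd phi l : Prop := has_cderiv phi 0 l /\ phi 0 = 1.

Lemma has_logd_affine l : has_logd (fun t => 1 + ofreal t * l) l.
Proof.
split; last by rewrite ofreal0 mul0r addr0.
rewrite -[X in has_cderiv _ _ X]add0r.
by apply: has_cderivD; [exact: has_cderiv_cst|exact: has_cderiv_ofreal].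
Qed.

Lemma has_logd1 : has_logd (fun=> 1) 0.
Proof. by split=> //; exact: has_cderiv_cst. Qed.

Lemma has_logdM phi psi l m : has_logd phi l -> has_logd psi m ->
  has_logd (fun t => phi t * psi t) (l + m).
Proof.
move=> [pl p1] [pm q1]; split; last by rewrite p1 q1 mulr1.
by have := has_cderivM pl pm; rewrite p1 q1 mulr1 mul1r.
Qed.

Lemma has_logdV phi l : has_logd phi l -> has_logd (fun t => (phi t)^-1) (- l).
Proof.
move=> [pl p1]; split; last by rewrite p1 invr1.
have p0 : phi 0 != 0 by rewrite p1 oner_neq0.
by have := has_cderivV p0 pl; rewrite p1 expr1n invr1 mulr1.
Qed.

Lemma has_logdX phi l (n : nat) : has_logd phi l ->
  has_logd (fun t => phi t ^+ n) (n%:R * l).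
Proof.
move=> pl; elim: n => [|n IH].
  by rewrite mul0r; exact: has_logd1.
rewrite -natr1 mulrDl mul1r addrC.
suff -> : (fun t => phi t ^+ n.+1) = (fun t => phi t * phi t ^+ n).
  exact: has_logdM.
by apply/funext => t; rewrite exprS.
Qed.

Lemma has_logd_exprz phi l (n : int) : has_logd phi l ->
  has_logd (fun t => phi t ^ n) (n%:~R * l).
Proof.
case: n => n pl; first exact: has_logdX.
rewrite NegzE mulrNz mulNr; exact/has_logdV/has_logdX.
Qed.

End LogDerivative.

Section Equivariance.
Variables (R : realType) (k : nat).
Local Notation C := (Cplx R).
Local Notation G := (GL R (k + k)).
Local Notation S := (smoothGL R (k + k)).
Implicit Types (f g : S) (p q r s : 'I_k) (x y : G) (b : bool).

Definition left_equivariant (c : GL R k -> GL R k -> C) (f : G -> C) : Prop :=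
  forall a d B y, f (ublock a d B * y)%g = c a d * f y.

Lemma det_add_delta q r (z : C) :
  \det (1%:M + z *: delta_mx q r) = if q == r then 1 + z else 1.
Proof.
(* The identity with its row [q] replaced by the basis vector [r]: multilinearity in that row
   reduces the claim to det M, which vanishes through two equal rows unless q = r. *)
pose M : 'M[C]_k := \matrix_(i, j) if i == q then (j == r)%:R else (i == j)%:R.
have lq i : (lift q i == q) = false.
  by rewrite eq_sym; apply: negbTE; exact: neq_lift.
have -> : \det (1%:M + z *: delta_mx q r) = 1 * \det (1%:M : 'M[C]_k) + z * \det M.
  apply: (determinant_multilinear (i0 := q)).
  - by apply/rowP => j; rewrite !mxE eqxx mul1r /= ?eqxx.
  - by apply/matrixP => i j; rewrite !mxE lq /= mulr0 addr0.
  - by apply/matrixP => i j; rewrite !mxE lq /= mulr0 addr0.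
rewrite det1 mulr1; case: eqP => [qr|/eqP qr].
  suff -> : M = 1%:M by rewrite det1 mulr1.
  apply/matrixP => i j; rewrite !mxE; case: eqP => [->|//].
  by rewrite qr eq_sym.
suff -> : \det M = 0 by rewrite mulr0 addr0.
apply: (determinant_alternate qr) => j.
by rewrite !mxE eqxx eq_sym [r == q]eq_sym (negPf qr).
Qed.

(** The affine curve 1 + tX takes the place of exp(tX), since only the first order at t = 0 matters;
    [e] bounds the range where its diagonal blocks are invertible. *)
Lemma rderive_ublock (c : GL R k -> GL R k -> C) f (A B D : 'M[C]_k)
    (phi : R -> C) (l : C) (e : R) y :
  left_equivariant c f -> 0 < e ->
  (forall t : R, `|t| < e -> exists a d, [/\ GLmx a = 1%:M + ofreal t *: A,
     GLmx d = 1%:M + ofreal t *: D & c a d = phi t]) ->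
  has_cderiv phi 0 l -> rderive f (block_mx A B 0 D *m GLmx y) y = l * f y.
Proof.
move=> fc e0 H pl; set X := block_mx A B 0 D.
have y0 : GLmx y = GLmx y + ofreal (0 : R) *: (X *m GLmx y).
  by rewrite ofreal0 scale0r addr0.
have L := has_cderiv_line y0 (@diffq_rderive _ _ f (X *m GLmx y) y (@smoothP _ _ f)).
apply: (has_cderiv_unique L).
have E t : `|t| < e -> phi t * f y = ext0 f (GLmx y + ofreal t *: (X *m GLmx y)).
  move=> /H[a [d [aE dE <-]]].
  have -> : GLmx y + ofreal t *: (X *m GLmx y) =
      GLmx (ublock a d (ofreal t *: B) * y)%g.
    rewrite GLmxM [GLmx (ublock _ _ _)]/(block_mx _ _ _ _) aE dE.
    rewrite -[X in X + _]mul1mx scalemxAl -mulmxDl; congr (_ *m _).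
    rewrite [1%:M]scalar_mx_block /X scale_block_mx add_block_mx scaler0 addr0.
    by rewrite add0r.
  by rewrite ext0_GL fc.
have := has_cderivM pl (has_cderiv_cst (f y) 0); rewrite mulr0 addr0.
apply: has_cderiv_eq.
  by apply/dnbhs0P; exists e => // t _ te; rewrite add0r E.
by rewrite E// normr0.
Qed.

Lemma dwirt_ublock (c : GL R k -> GL R k -> C) f (A B D : 'M[C]_k)
    (phi1 phii : R -> C) (l1 li : C) (e : R) b y :
  left_equivariant c f -> 0 < e ->
  (forall t : R, `|t| < e -> exists a d, [/\ GLmx a = 1%:M + ofreal t *: A,
     GLmx d = 1%:M + ofreal t *: D & c a d = phi1 t]) ->
  (forall t : R, `|t| < e -> exists a d, [/\ GLmx a = 1%:M + ofreal t *: ('i *: A),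
     GLmx d = 1%:M + ofreal t *: ('i *: D) & c a d = phii t]) ->
  has_cderiv phi1 0 l1 -> has_cderiv phii 0 li ->
  dwirt b (block_mx A B 0 D *m GLmx y) f y = 2^-1 * (l1 - cpxi R b * li) * f y.
Proof.
move=> fc e0 H1 Hi pl1 pli.
rewrite dwirtE !drealE (rderive_ublock _ _ fc e0 H1 pl1).
rewrite scalemxAl scale_block_mx scaler0 (rderive_ublock _ _ fc e0 Hi pli).
by move: (cpxi R b) (f y) => z w; ring.
Qed.

Lemma sum_cjg_delta b (n : nat) (i j : 'I_n) (F : 'I_n -> 'I_n -> C) :
  \sum_i' \sum_j' cjg b (delta_mx i j i' j') * F i' j' = F i j.
Proof.
rewrite (bigD1 i)//= (bigD1 j)//= mxE !eqxx cjg1 mul1r.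
rewrite [X in _ + X + _]big1 => [|l /negPf lj]; last first.
  by rewrite mxE lj andbF cjg0 mul0r.
rewrite [X in _ + X]big1 ?addr0 => [//|l /negPf lj].
by apply: big1 => l' _; rewrite mxE lj cjg0 mul0r.
Qed.

Lemma dleft_dwirt b i j f y : dleft b i j f y = dwirt b (delta_mx i j *m GLmx y) f y.
Proof.
by rewrite dwirt_mul (sum_cjg_delta b i j (fun i' j' => dleft b i' j' f y)).
Qed.

Lemma delta_mx_ul q r : delta_mx (lshift k q) (lshift k r) =
  block_mx (delta_mx q r) 0 0 0 :> 'M[C]_(k + k).
Proof.
apply/matrixP => i j; rewrite !mxE.
by case: splitP => i' iE; rewrite mxE; case: splitP => j' jE; rewrite !mxE -!val_eqE
  /= iE jE ?(gtn_eqF (ltn_addr _ (ltn_ord _))) ?andbF.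
Qed.

Lemma delta_mx_ur q s : delta_mx (lshift k q) (rshift k s) =
  block_mx 0 (delta_mx q s) 0 0 :> 'M[C]_(k + k).
Proof.
apply/matrixP => i j; rewrite !mxE.
by case: splitP => i' iE; rewrite mxE; case: splitP => j' jE; rewrite !mxE -!val_eqE
  /= iE jE ?eqn_add2l ?(gtn_eqF (ltn_addr _ (ltn_ord _)))
  ?(ltn_eqF (ltn_addr _ (ltn_ord _))) ?andbF.
Qed.

Lemma delta_mx_dr p s : delta_mx (rshift k p) (rshift k s) =
  block_mx 0 0 0 (delta_mx p s) :> 'M[C]_(k + k).
Proof.
apply/matrixP => i j; rewrite !mxE.
by case: splitP => i' iE; rewrite mxE; case: splitP => j' jE; rewrite !mxE -!val_eqE
  /= iE jE ?eqn_add2l ?(ltn_eqF (ltn_addr _ (ltn_ord _))) ?andbF.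
Qed.

Lemma delta_mx_dl p q : delta_mx (rshift k p) (lshift k q) =
  block_mx 0 0 (delta_mx p q) 0 :> 'M[C]_(k + k).
Proof.
apply/matrixP => i j; rewrite !mxE.
by case: splitP => i' iE; rewrite mxE; case: splitP => j' jE; rewrite !mxE -!val_eqE
  /= iE jE ?eqn_add2l ?(gtn_eqF (ltn_addr _ (ltn_ord _)))
  ?(ltn_eqF (ltn_addr _ (ltn_ord _))) ?andbF.
Qed.

Lemma GL_add_delta q r (z : C) : (q == r -> 1 + z != 0) ->
  exists2 a : GL R k, GLmx a = 1%:M + z *: delta_mx q r &
    \det (GLmx a) = if q == r then 1 + z else 1.
Proof.
move=> z1; have ua : 1%:M + z *: delta_mx q r \in unitmx.
  rewrite unitmxE unitfE det_add_delta; case: ifP => [/z1//|_].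
  exact: oner_neq0.
by exists (toGL ua) => //; rewrite -det_add_delta.
Qed.

Lemma affine_neq0 (z : C) (t : R) : cabs z = 1 -> `|t| < 1 -> 1 + ofreal t * z != 0.
Proof.
move=> z1 t1; apply/eqP => /(congr1 (fun w => cabs (w - 1))).
rewrite addrAC subrr !add0r cabsN cabsM cabs_ofreal z1 mulr1.
have -> : cabs (1 : C) = 1 by rewrite -ofreal1 cabs_ofreal normr1.
by move=> te; rewrite te ltxx in t1.
Qed.

(** On reals [nu] is the square, and both bases are positive for |t| < 1, so the root is a rational
    function of t and [sqrtC] need not be differentiated. *)
Lemma sqrtC_modulus_real (t : R) : `|t| < 1 ->
  sqrtC (nu (1 - ofreal t) ^+ k * nu (1 + ofreal t) ^- k) =
  (1 - ofreal t) ^+ k * ((1 + ofreal t) ^+ k)^-1 :> C.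
Proof.
move=> t1; have nuE (u : R) : nu (ofreal u) = ofreal u ^+ 2.
  by rewrite /nu conj_ofreal.
rewrite -ofreal1 -ofrealN -!ofrealD !nuE.
rewrite -!exprM ![(2 * k)%N]mulnC !exprM -exprVn -exprMn sqrCK//.
move: t1; rewrite ltr_norml => /andP[t0 t1].
have ge0 (u : R) : 0 <= u -> 0 <= ofreal u by rewrite -ofreal0 ler_ofreal.
by rewrite mulr_ge0 ?invr_ge0 ?exprn_ge0// ge0//; lra.
Qed.

(** The two numbers are conjugate, so the modulus does not vary in the imaginary direction. *)
Lemma modulus_imaginary (t : R) : `|t| < 1 ->
  nu (1 - ofreal t * 'i) ^+ k * nu (1 + ofreal t * 'i) ^- k = 1 :> C.
Proof.
move=> t1; have ci : cabs ('i : C) = 1 by rewrite /cabs normCi.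
have cE : Num.conj (1 + ofreal t * 'i) = 1 - ofreal t * 'i.
  by rewrite conjCD conjCM conj_ofreal conjCi rmorph1 mulrN.
have cE' : Num.conj (1 - ofreal t * 'i) = 1 + ofreal t * 'i by rewrite -cE conjCK.
rewrite /nu cE cE' mulrC [(1 - _) * _]mulrC mulVf// expf_neq0// mulf_neq0//.
  exact: affine_neq0.
by rewrite -cE conjC_eq0; exact: affine_neq0.
Qed.

Section Source.
Variables (b : bool) (m : nat) (j : int).

Definition source_char (a d : GL R k) : C :=
  cjg b (\det (GLmx d)) ^+ m * cjg (~~ b) (\det (GLmx d)) ^ j * sqrtC (modulus a d).

Variable f : S.
Hypothesis fc : left_equivariant source_char f.

Lemma source_char1 (a d : GL R k) : \det (GLmx a) = 1 -> \det (GLmx d) = 1 ->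
  source_char a d = 1.
Proof.
move=> a1 d1; rewrite /source_char /modulus /nu a1 d1 !cjg1 expr1n exp1rz.
by rewrite rmorph1 !mulr1 !expr1n invr1 mulr1 sqrtC1 mulr1.
Qed.

Lemma source_nilpotent b' (A B D : 'M[C]_k) y :
  (forall z : C, exists a d : GL R k, [/\ GLmx a = 1%:M + z *: A,
    GLmx d = 1%:M + z *: D, \det (GLmx a) = 1 & \det (GLmx d) = 1]) ->
  dwirt b' (block_mx A B 0 D *m GLmx y) f y = 0.
Proof.
move=> H; rewrite (@dwirt_ublock _ f A B D (fun=> 1) (fun=> 1) 0 0 1 b' y fc ltr01).
- by rewrite mulr0 subr0 mulr0 mul0r.
- by move=> t _; have [a [d [aE dE a1 d1]]] := H (ofreal t);
    exists a, d; split; rewrite ?source_char1.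
- move=> t _; have [a [d [aE dE a1 d1]]] := H (ofreal t * 'i).
  by exists a, d; split; rewrite ?source_char1 ?scalerA.
- exact: has_cderiv_cst.
- exact: has_cderiv_cst.
Qed.

Lemma source_ul0 b' q r : q != r -> dleft b' (lshift k q) (lshift k r) f = 0.
Proof.
move=> qr; apply: smooth_ext => y; rewrite dleft_dwirt delta_mx_ul.
apply: source_nilpotent => z; have [|a aE a1] := @GL_add_delta q r z.
  by rewrite (negPf qr).
exists a, (GLone R k); split=> //; last by rewrite det1.
- by rewrite scaler0 addr0.
- by rewrite a1 (negPf qr).
Qed.

Lemma source_dr0 b' p s : p != s -> dleft b' (rshift k p) (rshift k s) f = 0.
Proof.
move=> ps; apply: smooth_ext => y; rewrite dleft_dwirt delta_mx_dr.
apply: source_nilpotent => z; have [|a aE a1] := @GL_add_delta p s z.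
  by rewrite (negPf ps).
exists (GLone R k), a; split=> //; first by rewrite scaler0 addr0.
- by rewrite det1.
- by rewrite a1 (negPf ps).
Qed.

Lemma source_ur0 b' q s : dleft b' (lshift k q) (rshift k s) f = 0.
Proof.
apply: smooth_ext => y; rewrite dleft_dwirt delta_mx_ur.
apply: source_nilpotent => z.
by exists (GLone R k), (GLone R k); split; rewrite ?scaler0 ?addr0// det1.
Qed.

Lemma source_diag_direction (z : C) (phi : R -> C) q s : cabs z = 1 ->
  (forall t : R, `|t| < 1 -> forall a d : GL R k,
     \det (GLmx a) = 1 - ofreal t * z -> \det (GLmx d) = 1 + ofreal t * z ->
     source_char a d = phi t) ->
  forall t : R, `|t| < 1 -> exists a d,
    [/\ GLmx a = 1%:M + ofreal t *: (z *: - delta_mx q q),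
      GLmx d = 1%:M + ofreal t *: (z *: delta_mx s s) & source_char a d = phi t].
Proof.
move=> z1 H t t1.
have [|a aE a1] := @GL_add_delta q q (ofreal t * - z).
  by move=> _; apply: affine_neq0; rewrite ?cabsN.
have [|d dE d1] := @GL_add_delta s s (ofreal t * z).
  by move=> _; apply: affine_neq0.
rewrite !eqxx in a1 d1; exists a, d; split.
- by rewrite aE scalerA scalerN -scaleNr mulrN.
- by rewrite dE scalerA.
- by apply: H => //; rewrite a1 mulrN.
Qed.

(** The logarithmic derivative of the character is m + j - 2k in the real direction, and m - j times
    [cpxi R b] in the imaginary one. The Wirtinger combination cancels j and halves the rest, which
    gives m - k. *)
Lemma source_diag q s : dleft b (rshift k s) (rshift k s) f
  - dleft b (lshift k q) (lshift k q) f = (m%:R - k%:R) *: f.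
Proof.
apply: smooth_ext => y; rewrite smoothDE smoothNE smoothZE !dleft_dwirt.
rewrite delta_mx_dr delta_mx_ul.
transitivity (dwirt b (block_mx (- delta_mx q q) 0 0 (delta_mx s s) *m GLmx y) f y).
  have -> : block_mx (- delta_mx q q) 0 0 (delta_mx s s) =
    block_mx 0 0 0 (delta_mx s s) + -1 *: block_mx (delta_mx q q) 0 0 0 :> 'M[C]_(k + k).
    by rewrite scaleN1r opp_block_mx add_block_mx !oppr0 !add0r addr0.
  rewrite mulmxDl -scalemxAl dwirt_dirD dwirt_dirZ smoothDE smoothZE.
  by rewrite -[X in cjg b X]/(- (1 : C)) -ofreal1 -ofrealN cjg_ofreal ofrealN mulN1r.
have c1 : cabs (1 : C) = 1 by rewrite -ofreal1 cabs_ofreal normr1.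
have ci : cabs ('i : C) = 1 by rewrite /cabs normCi.
pose phi1 (t : R) : C := (1 + ofreal t * 1) ^+ m * (1 + ofreal t * 1) ^ j *
  ((1 + ofreal t * -1) ^+ k * ((1 + ofreal t * 1) ^+ k)^-1).
pose phii (t : R) : C := (1 + ofreal t * cpxi R b) ^+ m * (1 + ofreal t * cpxi R (~~ b)) ^ j.
have p1 : has_logd phi1 (m%:R * 1 + j%:~R * 1 + (k%:R * -1 + - (k%:R * 1))).
  apply: has_logdM.
    by apply: has_logdM; [apply: has_logdX|apply: has_logd_exprz]; exact: has_logd_affine.
  by apply: has_logdM; [apply: has_logdX|apply/has_logdV/has_logdX];
    exact: has_logd_affine.
have pi : has_logd phii (m%:R * cpxi R b + j%:~R * cpxi R (~~ b)).
  by apply: has_logdM; [apply: has_logdX|apply: has_logd_exprz]; exact: has_logd_affine.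
rewrite (@dwirt_ublock _ f _ _ _ phi1 phii _ _ 1 b y fc ltr01 _ _ p1.1 pi.1).
- have -> : cpxi R (~~ b) = - cpxi R b by case: (b) => /=; rewrite ?opprK.
  have := cpxi2 R b; move: (cpxi R b) (f y) => z w zz; congr (_ * _).
  rewrite [X in _ - X](_ : _ = m%:R * (z * z) - j%:~R * (z * z)); last by ring.
  by rewrite zz; field.
- have := source_diag_direction (phi := phi1) q s c1; rewrite !scale1r; apply.
  move=> t t1 a d aE dE; rewrite /source_char /modulus /nu aE dE /phi1.
  rewrite !cjgD !cjgM !cjg1 !cjg_ofreal; congr (_ * _).
  by rewrite mulrN1 !mulr1; exact: sqrtC_modulus_real.
- apply: (source_diag_direction (phi := phii) q s ci) => t t1 a d aE dE.
  rewrite /source_char /modulus aE dE /phii modulus_imaginary// sqrtC1 mulr1.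
  by rewrite !cjgD !cjgM !cjg1 !cjg_ofreal !cjgi.
Qed.

End Source.

(** Since X^2 = 0, the direction X y equals X times the moved point (1 + uX) y, so the derivative
    along the whole line is a combination of upper right derivations at the moving point. Both
    values of [b] occur because a real derivative is the sum of the two Wirtinger derivatives. *)
Lemma upper_unipotent_invariant g : (forall b q s, dleft b (lshift k q) (rshift k s) g = 0) ->
  forall B y, g (ublock (GLone R k) (GLone R k) B * y)%g = g y.
Proof.
move=> g0 B y; pose X : 'M[C]_(k + k) := block_mx 0 B 0 0.
have XX : X *m X = 0.
  by rewrite /X mulmx_block !(mul0mx, mulmx0, addr0) block_mx0.
have hE t : GLmx (ublock (GLone R k) (GLone R k) (ofreal t *: B) * y)%g =
    GLmx y + ofreal t *: (X *m GLmx y).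
  rewrite GLmxM [GLmx (ublock _ _ _)]/(block_mx _ _ _ _).
  rewrite -[X in _ = X + _]mul1mx scalemxAl -mulmxDl; congr (_ *m _).
  by rewrite [1%:M]scalar_mx_block /X scale_block_mx add_block_mx !scaler0 !addr0 add0r.
pose phi t := ext0 g (GLmx y + ofreal t *: (X *m GLmx y)).
have dX h : rderive g (X *m GLmx h) h = 0.
  have := dreal_dwirt (X *m GLmx h) g => /(congr1 (fun u : S => u h)).
  rewrite drealE => ->; rewrite smoothDE.
  suff E b : dwirt b (X *m GLmx h) g h = 0 by rewrite !E addr0.
  rewrite dwirt_mul big1// => i _; rewrite big1// => l _; rewrite /X.
  case: (splitP i) => i' iE; case: (splitP l) => l' lE.
  - rewrite (_ : i = lshift k i'); last exact: val_inj.
    rewrite (_ : l = lshift k l'); last exact: val_inj.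
    by rewrite block_mxEul mxE cjg0 mul0r.
  - rewrite (_ : i = lshift k i'); last exact: val_inj.
    rewrite (_ : l = rshift k l'); last exact: val_inj.
    by rewrite g0 smooth0E mulr0.
  - rewrite (_ : i = rshift k i'); last exact: val_inj.
    rewrite (_ : l = lshift k l'); last exact: val_inj.
    by rewrite block_mxEdl mxE cjg0 mul0r.
  - rewrite (_ : i = rshift k i'); last exact: val_inj.
    rewrite (_ : l = rshift k l'); last exact: val_inj.
    by rewrite block_mxEdr mxE cjg0 mul0r.
have p0 u : has_cderiv phi u 0.
  have <- := dX (ublock (GLone R k) (GLone R k) (ofreal u *: B) * y)%g.
  have -> : X *m GLmx (ublock (GLone R k) (GLone R k) (ofreal u *: B) * y)%g =
      X *m GLmx y by rewrite hE mulmxDr -scalemxAr mulmxA XX mul0mx scaler0 addr0.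
  by apply: (has_cderiv_line (hE u)); apply: diffq_rderive; exact: smoothP.
have phi1 : phi 1 = g (ublock (GLone R k) (GLone R k) B * y)%g.
  by rewrite /phi -(hE 1) ext0_GL ofreal1 scale1r.
have phi0 : phi 0 = g y by rewrite /phi ofreal0 scale0r addr0 ext0_GL.
by rewrite -phi1 -phi0; exact: has_cderiv0_cst.
Qed.

End Equivariance.

(** * Continuity *)

Section CompactConvergence.
Variables (R : realType) (n : nat) (X : topologicalType).
Local Notation C := (Cplx R).
Local Notation G := (GL R n).
Implicit Types (F : X -> G -> C) (V : 'M[C]_n).

Lemma compact_convergenceP F :
  continuous (F : X -> {family compact, G -> C}) <->
  forall x (K : set G), compact K -> forall e : R, 0 < e ->
    \forall x' \near x, forall y, K y -> cabs (F x' y - F x y) < e.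
Proof.
split=> [cF x K cK e e0|H x].
  have Fx : Filter (F x' @[x' --> x]) by exact: fmap_filter.
  have /fam_cvgP/(_ K cK) := cF x.
  move/(_ [set h | forall y, K y -> cabs (h y - F x y) < e]); apply.
  apply/uniform_nbhs; exists [set xy : C * C | ball xy.1 (ofreal e) xy.2]; split.
    rewrite -entourage_ballE; exists (ofreal e) => //=.
    by rewrite -ofreal0 ltr_ofreal.
  move=> h Eh y Ky; have := Eh y Ky; rewrite /= -ball_normE /= distrC cabsE.
  by rewrite ltr_ofreal.
have Fx : Filter (F x' @[x' --> x]) by exact: fmap_filter.
apply/fam_cvgP => K cK P /uniform_nbhs[E [entE sEP]].
move: entE; rewrite -entourage_ballE => -[e /= e0 sE].
have er : ofreal (complex.Re e) = e by apply: RRe_real; exact: gtr0_real.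
have e0' : 0 < complex.Re e by rewrite -ltr_ofreal er.
apply: filterS (H x K cK _ e0') => x' Hx'; apply: sEP => y Ky; apply: sE.
by rewrite /= -ball_normE /= distrC cabsE -er ltr_ofreal; exact: Hx'.
Qed.

Lemma continuous_bounded_compact (u : G -> C) (K : set G) : continuous u -> compact K ->
  exists2 M : R, 0 < M & forall y, K y -> cabs (u y) < M.
Proof.
move=> cu cK; have cv : continuous (fun y => cabs (u y) : R^o).
  move=> y; have Fy : Filter (nbhs y) by exact: nbhs_filter.
  apply/cvgrPdist_lt => e e0; have /cplx_cvgP/(_ e e0) := cu y.
  apply: filterS => z uz; apply: le_lt_trans uz; rewrite distrC.
  exact: cabs_lipschitz.
have cI : compact ((fun y => cabs (u y) : R^o) @` K).
  by apply: continuous_compact => //; exact: continuous_subspaceT.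
have [M [_ HM]] := compact_bounded cI.
(* Every number above M is a bound; max M 0 + 1 is one, and one more makes the bound strict. *)
exists (Num.max M 0 + 2) => [|y Ky].
  by rewrite ltr_wpDl// le_max lexx orbT.
have M1 : M < Num.max M 0 + 1.
  by apply: (@le_lt_trans _ _ (Num.max M 0)); rewrite ?le_max ?lexx// ltrDl.
have := HM _ M1 (cabs (u y)); rewrite /= => /(_ _).
have yK : exists2 x, K x & cabs (u x) = cabs (u y) by exists y.
move=> /(_ yK); rewrite ger0_norm ?cabs_ge0// => h; apply: le_lt_trans h _.
by rewrite ltrD2l ltr1n.
Qed.

Definition jet_continuous_at Vs (Psi : X -> smoothGL R n) : Prop :=
  continuous (fun x => rderive_seq Vs (Psi x) : {family compact, G -> C}).

(** Continuity of a family of smooth functions for the C^oo topology. With the source representation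
    as parameter space, continuity of the operator is built up one derivation at a time. *)
Definition jet_continuous (Psi : X -> smoothGL R n) : Prop :=
  forall Vs, jet_continuous_at Vs Psi.

Lemma rderive_seq_rcons Vs V (f : G -> C) :
  rderive_seq (rcons Vs V) f = rderive_seq Vs (rderive f V).
Proof. by rewrite /rderive_seq foldr_rcons. Qed.

Lemma jet_continuous_at_dreal Vs V Psi : jet_continuous_at (rcons Vs V) Psi <->
  jet_continuous_at Vs (fun x => dreal V (Psi x)).
Proof.
rewrite /jet_continuous_at.
by under [X in continuous X <-> _]eq_fun do rewrite rderive_seq_rcons.
Qed.

Lemma jet_continuous_dreal V Psi : jet_continuous Psi ->
  jet_continuous (fun x => dreal V (Psi x)).
Proof. by move=> cP Vs; apply/jet_continuous_at_dreal; exact: cP. Qed.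

Lemma jet_continuous_at_lin Vs (c : C) Psi1 Psi2 :
  jet_continuous_at Vs Psi1 -> jet_continuous_at Vs Psi2 ->
  jet_continuous_at Vs (fun x => c *: Psi1 x + Psi2 x).
Proof.
move=> c1 c2; apply/compact_convergenceP => x K cK e e0.
have e1 : 0 < e / 2 / (cabs c + 1) by rewrite !divr_gt0// ltr_wpDl// cabs_ge0.
have e2 : 0 < e / 2 by rewrite divr_gt0.
have /compact_convergenceP/(_ x K cK _ e1) H1 := c1.
have /compact_convergenceP/(_ x K cK _ e2) H2 := c2.
apply: filterS2 H1 H2 => x' H1 H2 y Ky.
have E x0 : rderive_seq Vs (c *: Psi1 x0 + Psi2 x0 : smoothGL R n) y =
    c * rderive_seq Vs (Psi1 x0) y + rderive_seq Vs (Psi2 x0) y.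
  have := rderive_seq_linear c Vs (@smoothP _ _ (Psi1 x0)) (@smoothP _ _ (Psi2 x0)).
  by move/(congr1 (fun u => u y)).
rewrite !E opprD addrACA -mulrBr; apply: le_lt_trans (cabsD _ _) _.
rewrite [e]splitr; apply: ler_ltD; last exact: H2.
have c0 := cabs_ge0 c.
rewrite cabsM; apply: le_trans (_ : cabs c * (e / 2 / (cabs c + 1)) <= _).
  by apply: ler_wpM2l => //; apply/ltW/H1.
rewrite mulrA ler_pdivrMr ?ltr_wpDl//.
by rewrite mulrC; apply: ler_wpM2l; [exact: ltW|lra].
Qed.

Lemma jet_continuous0 : jet_continuous (fun=> 0).
Proof. by move=> Vs x; exact: cst_continuous. Qed.

Lemma jet_continuous_lin (c : C) Psi1 Psi2 :
  jet_continuous Psi1 -> jet_continuous Psi2 ->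
  jet_continuous (fun x => c *: Psi1 x + Psi2 x).
Proof. by move=> c1 c2 Vs; apply: jet_continuous_at_lin; [exact: c1|exact: c2]. Qed.

Lemma jet_continuousD Psi1 Psi2 : jet_continuous Psi1 -> jet_continuous Psi2 ->
  jet_continuous (fun x => Psi1 x + Psi2 x).
Proof.
move=> c1 c2; have := jet_continuous_lin (c := 1) c1 c2.
by under [X in jet_continuous X]eq_fun do rewrite scale1r.
Qed.

Lemma jet_continuousZ (c : C) Psi : jet_continuous Psi ->
  jet_continuous (fun x => c *: Psi x).
Proof.
move=> c1; have := jet_continuous_lin (c := c) c1 jet_continuous0.
by under [X in jet_continuous X]eq_fun do rewrite addr0.
Qed.

Lemma jet_continuous_sum (I : Type) (r : seq I) (Psi : I -> X -> smoothGL R n) :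
  (forall i, jet_continuous (Psi i)) ->
  jet_continuous (fun x => \sum_(i <- r) Psi i x).
Proof.
move=> H; elim: r => [|i r IH].
  by under [X in jet_continuous X]eq_fun do rewrite big_nil; exact: jet_continuous0.
under [X in jet_continuous X]eq_fun do rewrite big_cons.
exact: jet_continuousD.
Qed.

(** Without derivatives, an entry is bounded on compact sets. With them, the innermost one is
    distributed by the Leibniz rule, and the derivative of an entry is constant. *)
Lemma jet_continuous_coord b i j Psi : jet_continuous Psi ->
  jet_continuous (fun x => entry R b i j * Psi x).
Proof.
move=> cP Vs; elim/last_ind: Vs Psi cP => [|Vs V IH] Psi cP.
  have ccoord : continuous (entry R b i j) by exact/rsmooth_continuous/smoothP.
  apply/compact_convergenceP => x K cK e e0.
  have [M M0 HM] := continuous_bounded_compact ccoord cK.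
  have e1 : 0 < e / M by rewrite divr_gt0.
  have /compact_convergenceP/(_ x K cK _ e1) := cP [::].
  apply: filterS => x' Hx' y Ky; 
  rewrite -[X in cabs X]/(entry R b i j y * Psi x' y - entry R b i j y * Psi x y).
  rewrite -mulrBr cabsM.
  have := Hx' y Ky; rewrite /= ltr_pdivlMr// mulrC; apply: le_lt_trans.
  by apply: ler_wpM2r; [exact: cabs_ge0|exact/ltW/HM].
apply/jet_continuous_at_dreal.
suff : jet_continuous_at Vs (fun x =>
    cjg b (V i j) *: Psi x + entry R b i j * dreal V (Psi x)).
  rewrite /jet_continuous_at; under [X in continuous X -> _]eq_fun do
    rewrite -[Psi _ in X in X + _]mul1r smoothZAl -dreal_coord -drealM.
  exact.
exact: jet_continuous_at_lin (cP Vs) (IH _ (jet_continuous_dreal (V := V) cP)).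
Qed.

Lemma jet_continuous_dwirt b V Psi : jet_continuous Psi ->
  jet_continuous (fun x => dwirt b V (Psi x)).
Proof.
move=> cP; apply: jet_continuousZ; apply: jet_continuousD.
  exact: jet_continuous_dreal.
rewrite (_ : (fun x => _) = fun x => (- cpxi R b) *: dreal ('i *: V) (Psi x)).
  by apply: jet_continuousZ; exact: jet_continuous_dreal.
by apply/funext => x; rewrite scaleNr.
Qed.

Lemma jet_continuous_dleft b i j Psi : jet_continuous Psi ->
  jet_continuous (fun x => dleft b i j (Psi x)).
Proof.
move=> cP; apply: jet_continuous_sum => l; apply: jet_continuous_coord.
exact: jet_continuous_dwirt.
Qed.

End CompactConvergence.

(** * The intertwining operator *)

Section Intertwiner.
Variables (R : realType) (k : nat) (b : bool).
Local Notation C := (Cplx R).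
Local Notation G := (GL R (k + k)).
Local Notation S := (smoothGL R (k + k)).
Implicit Types (f g : S) (p q r s : 'I_k) (x y h : G).

Lemma ext0_ltransl x (f : G -> C) A :
  ext0 (fun y => f (x * y)%g) A = ext0 f (GLmx x *m A).
Proof.
rewrite /ext0; have [uA|nA] := boolP (A \in unitmx).
  have -> : A = val (toGL uA) by [].
  by rewrite valK /= -[_ *m _]/(val (x * toGL uA)%g) valK.
rewrite !insubF //.
- apply/negP; rewrite inE /= unitmx_mul => /andP[_].
  by rewrite (negPf nA).
- by apply/negP; rewrite inE /= (negPf nA).
Qed.

(** The left translate is given by an equation with some smooth f', which in the applications is a
    multiple of a known function; its smoothness is thus never proved separately. *)
Lemma rderive_ltransl x f f' V y : (forall z, f (x * z)%g = f' z) ->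
  rderive f (GLmx x *m V) (x * y)%g = rderive f' V y.
Proof.
move=> ff'; have -> : (f' : G -> C) = fun z => f (x * z)%g.
  by apply/funext => z; rewrite ff'.
apply/esym; apply: rderive_eq.
apply: cplx_cvg0_eq (@diffq_rderive _ _ f (GLmx x *m V) (x * y)%g (@smoothP _ _ f)).
move=> t _; rewrite /diffq ext0_ltransl GLmxM mulmxDr.
by rewrite -scalemxAr.
Qed.

Lemma dwirt_ltransl b' x f f' V y : (forall z, f (x * z)%g = f' z) ->
  dwirt b' (GLmx x *m V) f (x * y)%g = dwirt b' V f' y.
Proof.
move=> ff'; rewrite !dwirtE !drealE scalemxAr.
by rewrite !(rderive_ltransl _ _ ff').
Qed.

Lemma dwirt_lower_left b' (M : 'M[C]_k) f y :
  dwirt b' (block_mx 0 0 M 0 *m GLmx y) f y =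
  \sum_p \sum_q cjg b' (M p q) * dleft b' (rshift k p) (lshift k q) f y.
Proof.
rewrite dwirt_mul big_split_ord /= [X in X + _]big1 ?add0r; last first.
  move=> p _; rewrite big_split_ord /= !big1 ?addr0// => q _.
    by rewrite block_mxEur mxE cjg0 mul0r.
  by rewrite block_mxEul mxE cjg0 mul0r.
apply: eq_bigr => p _; rewrite big_split_ord /= [X in _ + X]big1 ?addr0; last first.
  by move=> q _; rewrite block_mxEdr mxE cjg0 mul0r.
by apply: eq_bigr => q _; rewrite block_mxEdl.
Qed.

Lemma dleft_levi (a d : GL R k) f f' p q y :
  (forall z, f (ublock a d 0 * z)%g = f' z) ->
  dleft b (rshift k p) (lshift k q) f (ublock a d 0 * y)%g =
  \sum_p' \sum_q' (cjg b (invmx (GLmx d) p' p) * cjg b (GLmx a q q')) *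
    dleft b (rshift k p') (lshift k q') f' y.
Proof.
move=> ff'; pose M := invmx (GLmx d) *m delta_mx p q *m GLmx a.
rewrite dleft_dwirt delta_mx_dl GLmxM mulmxA.
have dM : GLmx d *m M = delta_mx p q *m GLmx a.
  by rewrite /M !mulmxA (mulmxV (GLmx_unit d)) mul1mx.
have -> : block_mx 0 0 (delta_mx p q) 0 *m GLmx (ublock a d 0) =
    GLmx (ublock a d 0) *m block_mx 0 0 M 0.
  rewrite [GLmx (ublock _ _ _)]/(block_mx _ _ _ _) !mulmx_block dM.
  by rewrite !(mul0mx, mulmx0, addr0, add0r).
rewrite -mulmxA (dwirt_ltransl b _ _ ff') dwirt_lower_left.
apply: eq_bigr => p' _; apply: eq_bigr => q' _; rewrite -cjgM; congr (cjg b _ * _).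
(* An elementary matrix is a column times a row, so [M] is the product of a column of d^-1 and a row
   of a. *)
rewrite /M -(mul_delta_mx (0 : 'I_1)) mulmxA -mulmxA -colE -rowE mxE big_ord1.
by rewrite !mxE.
Qed.

(** The transposes appear because a substitution acts on the variables, with the summation indices
    on the opposite sides from those of d^-1 E_pq a. *)
Definition levi_poly (a d : GL R k) := linear_subst
  (map_mx (cjg b) (invmx (GLmx d)))^T (map_mx (cjg b) (GLmx a))^T.

Lemma lowpoly_levi (a d : GL R k) (c : C) f P y :
  (forall z, f (ublock a d 0 * z)%g = c * f z) ->
  lowpoly b P f (ublock a d 0 * y)%g = c * lowpoly b (levi_poly a d P) f y.
Proof.
move=> fc; elim/lowpoly_ind: P y => [|z P1 P2 h1 h2|p q P h] y.
- by rewrite /levi_poly linear_subst1 !lowpoly1.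
- rewrite /levi_poly linear_substP !lowpolyP !smoothDE !smoothZE h1 h2.
  by rewrite mulrDr mulrCA.
- have fc' z : lowpoly b P f (ublock a d 0 * z)%g =
      (c *: lowpoly b (levi_poly a d P) f) z by rewrite h smoothZE.
  have E : lowpoly b (levi_poly a d (pvar C p q * P)) f = \sum_p' \sum_q'
      (cjg b (invmx (GLmx d) p' p) * cjg b (GLmx a q q')) *:
      dleft b (rshift k p') (lshift k q') (lowpoly b (levi_poly a d P) f).
    rewrite /levi_poly linear_substM linear_subst_var mulr_suml /lowpoly poly_act_sum.
    apply: eq_bigr => p' _; rewrite mulr_suml poly_act_sum; apply: eq_bigr => q' _.
    rewrite -scalerAl poly_actZ !mxE; congr (_ *: _); exact: lowpolyX.
  rewrite E lowpolyX (dleft_levi p q y fc') smooth_sumE mulr_sumr.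
  apply: eq_bigr => p' _; rewrite smooth_sumE mulr_sumr.
  by apply: eq_bigr => q' _; rewrite smoothZE linearZ smoothZE mulrCA.
Qed.

Lemma cjg_det b' (n : nat) (A : 'M[C]_n) : cjg b' (\det A) = \det (map_mx (cjg b') A).
Proof.
case: b' => /=; last by congr (\det _); apply/matrixP => i j; rewrite mxE.
by rewrite -det_map_mx; congr (\det _); apply/matrixP => i j; rewrite !mxE.
Qed.

Lemma cjg_eq0 b' (z : C) : (cjg b' z == 0) = (z == 0).
Proof. by case: b' => //=; rewrite conjC_eq0. Qed.

Lemma cjgV b' (z : C) : cjg b' z^-1 = (cjg b' z)^-1.
Proof. by case: b' => //=; exact: fmorphV. Qed.

Variables (m : nat) (j : int).

Definition target_char (a d : GL R k) : C :=
  cjg b (\det (GLmx a)) ^+ m * cjg (~~ b) (\det (GLmx d)) ^ j * sqrtC (modulus a d).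

Definition det_op f : S := lowpoly b (det_pow C k m) f.

Lemma det_op_linear c f g : det_op (c *: f + g) = c *: det_op f + det_op g.
Proof. exact: poly_act_linear. Qed.

Lemma GL_det_neq0 (a : GL R k) : \det (GLmx a) != 0.
Proof. by have := GLmx_unit a; rewrite unitmxE unitfE. Qed.

Lemma det_op_equivariant f : left_equivariant (source_char b m j) f ->
  left_equivariant target_char (det_op f).
Proof.
move=> fc a d B y.
have inv_u : forall B y, det_op f (ublock (GLone R k) (GLone R k) B * y)%g = det_op f y.
  apply: upper_unipotent_invariant => b' q s; rewrite /det_op.
  have [->|bb'] := eqVneq b' b.
    rewrite (lowpoly_upper_right (lam := m%:R - k%:R)).
    - by rewrite second_order_det_pow lowpoly0.
    - by move=> q' r; exact: source_ul0 fc _ _ _.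
    - by move=> p s'; exact: source_dr0 fc _ _ _.
    - by move=> q' s'; exact: source_ur0 fc _ _ _.
    - by move=> q' s'; exact: source_diag fc _ _.
  (* A derivation of the other type commutes with every D_pq, so it passes directly to [f], which it
     annihilates. *)
  rewrite /lowpoly (poly_act_comm _ (L := dleft b' (lshift k q) (rshift k s))).
  - by rewrite /= (source_ur0 fc) linear0.
  - exact: lowC.
  - by move=> i w; exact: dleft_mixed.
(* Unipotent times Levi; the unipotent factor is already dealt with. *)
have xE : (ublock a d B * y = ublock (GLone R k) (GLone R k) (B *m invmx (GLmx d)) *
    (ublock a d 0 * y))%g.
  rewrite mulgA; congr (_ * _)%g; apply: GLmx_inj; rewrite GLmxM.
  rewrite ![GLmx (ublock _ _ _)]/(block_mx _ _ _ _) mulmx_block.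
  rewrite !(mul0mx, mulmx0, mul1mx, addr0, add0r) -mulmxA mulVmx ?GLmx_unit//.
  by rewrite mulmx1.
rewrite xE inv_u /det_op (lowpoly_levi (c := source_char b m j a d)); last first.
  by move=> z; exact: fc.
(* The factor (det a / det d)^m, conjugated according to [b], exchanges the m-th power of det d in
   the source character for that of det a. *)
rewrite /levi_poly linear_subst_det_pow lowpolyZ smoothZE mulrA; congr (_ * _).
rewrite !det_tr -!cjg_det det_inv cjgV /source_char /target_char.
have d0 : cjg b (\det (GLmx d)) != 0 by rewrite cjg_eq0 GL_det_neq0.
rewrite exprMn exprVn; move: (expf_neq0 m d0).
move: (cjg b (\det (GLmx d)) ^+ m) (cjg b (\det (GLmx a)) ^+ m) => u v u0.
by move: (_ ^ j) (sqrtC _) => w z; field.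
Qed.

Definition smooth_rtransl h f : S := mk_smooth (rsmooth_rtransl h (@smoothP _ _ f)).

Lemma smooth_rtransl_linear h c f g :
  smooth_rtransl h (c *: f + g) = c *: smooth_rtransl h f + smooth_rtransl h g.
Proof. exact: smooth_ext. Qed.

HB.instance Definition _ h := GRing.isLinear.Build C S S *:%R (smooth_rtransl h)
  (fun c f g => smooth_rtransl_linear h c f g).

Lemma dreal_rtransl h V f y :
  dreal V (smooth_rtransl h f) y = dreal (V *m GLmx h) f (y * h)%g.
Proof.
rewrite !drealE.
by have /= -> := rderive_seq_rtransl h [:: V] f.
Qed.

Lemma dwirt_rtransl h b' V f y :
  dwirt b' V (smooth_rtransl h f) y = dwirt b' (V *m GLmx h) f (y * h)%g.
Proof.
rewrite (dwirtE b' V) (dwirtE b' (V *m GLmx h)) (dreal_rtransl h V).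
by rewrite (dreal_rtransl h ('i *: V)) -scalemxAl.
Qed.

Lemma dleft_rtransl h b' i l f :
  smooth_rtransl h (dleft b' i l f) = dleft b' i l (smooth_rtransl h f).
Proof.
apply: smooth_ext => y; rewrite [RHS]dleft_dwirt dwirt_rtransl -mulmxA -GLmxM.
exact: dleft_dwirt.
Qed.

Lemma det_op_rtransl h f : smooth_rtransl h (det_op f) = det_op (smooth_rtransl h f).
Proof.
apply: (poly_act_comm (@lowC R k b) (L := smooth_rtransl h)) => i w.
exact: dleft_rtransl.
Qed.

Definition source_rep := ind_rep (@triv R k) (fun x : GL R k =>
  cjg b (\det (GLmx x)) ^ m%:Z * cjg (~~ b) (\det (GLmx x)) ^ j).
Definition target_rep := ind_rep (fun x : GL R k => cjg b (\det (GLmx x)) ^ m%:Z)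
  (fun x : GL R k => cjg (~~ b) (\det (GLmx x)) ^ j).

Definition source_smooth (f : source_rep) : S := mk_smooth (inducedP f).1.

Lemma source_smooth_equivariant (f : source_rep) :
  left_equivariant (source_char b m j) (source_smooth f).
Proof. by move=> a d B y; have [_ /(_ a d B y)] := inducedP f; rewrite /triv mul1r. Qed.

Lemma det_op_induced (f : source_rep) : (det_op (source_smooth f) : G -> C) \in
  induced_pred (fun x : GL R k => cjg b (\det (GLmx x)) ^ m%:Z)
    (fun x : GL R k => cjg (~~ b) (\det (GLmx x)) ^ j).
Proof.
apply/asboolP; split; first exact: smoothP.
exact: det_op_equivariant (source_smooth_equivariant f).
Qed.

Definition det_intertwiner (f : source_rep) : target_rep := IndRep (det_op_induced f).

Lemma det_intertwiner_linear c (u v : source_rep) :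
  det_intertwiner (c *: u + v) = c *: det_intertwiner u + det_intertwiner v.
Proof.
apply: val_inj; rewrite /=.
have -> : source_smooth (c *: u + v) = c *: source_smooth u + source_smooth v.
  exact: smooth_ext.
by rewrite det_op_linear.
Qed.

HB.instance Definition _ := GRing.isLinear.Build C source_rep target_rep *:%R
  det_intertwiner (fun c u v => det_intertwiner_linear c u v).

Lemma jet_continuous_source : jet_continuous source_smooth.
Proof.
move=> Vs f; apply: (continuous_comp (f := @jet R k _ _) (g := proj Vs)).
  exact: initial_continuous.
exact: proj_continuous.
Qed.

Lemma jet_continuous_det_op : jet_continuous (fun u : source_rep => det_op (source_smooth u)).
Proof.
rewrite /det_op; elim/lowpoly_ind: (det_pow C k m) => [|c P1 P2 h1 h2|p q P h].
- under [X in jet_continuous X]eq_fun do rewrite lowpoly1.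
  exact: jet_continuous_source.
- under [X in jet_continuous X]eq_fun do rewrite lowpolyP.
  exact: jet_continuous_lin.
- under [X in jet_continuous X]eq_fun do rewrite lowpolyX.
  exact: jet_continuous_dleft.
Qed.

Lemma det_intertwiner_continuous : continuous det_intertwiner.
Proof.
apply: continuous_comp_initial => f; have Ff : Filter (nbhs f) by exact: nbhs_filter.
have Fj : Filter ((@jet R k _ _ \o det_intertwiner) u @[u --> f]).
  exact: fmap_filter.
apply/cvg_sup => Vs.
apply: (@continuous_comp_initial _ _ _ (fun u : prod_topology (fun _ : seq 'M[C]_(k + k) =>
  {family compact, G -> C}) => u Vs)).
exact: jet_continuous_det_op.
Qed.

Lemma det_intertwiner_intertwining : intertwining det_intertwiner.
Proof.
split; first exact: det_intertwiner_continuous.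
move=> h f; apply: val_inj => /=.
have := det_op_rtransl h (source_smooth f) => /(congr1 (fun u : S => u : G -> C)) /= ->.
by congr (smooth_fun (det_op _)); exact: smooth_ext.
Qed.

End Intertwiner.

(** * Nonvanishing *)

Section FischerPairing.
Variables (K : numClosedFieldType) (N : nat).
Local Notation poly := (mpoly N K).

Lemma meval0_mcoeff0 (P : poly) : meval (fun=> 0) P = mcoeff mnm0 P.
Proof.
elim/mpoly_mulX_ind: P => [|c P1 P2 h1 h2|i P h].
- by rewrite meval1 mcoeff1 eqxx.
- by rewrite mevalD mevalZ h1 h2 mcoeffD mcoeffZ.
- rewrite mevalM mevalXU mul0r.
  have -> : mcoeff mnm0 (mpolyX K (mnm1 i) * P) =
      mcoeff mnm0 (mpolyX K (mnm1 i)) * mcoeff mnm0 P by exact: rmorphM.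
  rewrite mcoeffX.
  suff -> : (mnm1 i == mnm0) = false by rewrite mul0r.
  by apply/eqP => /(congr1 (fun u : multinom N => u i)); rewrite mnm1E eqxx mnm0E.
Qed.

(* The constant term of [P(d) P] is the sum of the [m! |P_m|^2]. *)
Lemma Fischer_neq0 (P : poly) : map_mpoly (Num.conj : K -> K) P = P -> P != 0 ->
  mcoeff mnm0 (poly_act (fun i => mderiv i : {linear poly -> poly}) P P) != 0.
Proof.
move=> Preal P0.
have E : mcoeff mnm0 (poly_act (fun i => mderiv i : {linear poly -> poly}) P P) =
    \sum_(m <- msupp P) `|mcoeff m P| ^+ 2 *+ \prod_(i < N) (m i)`!.
  rewrite /poly_act raddf_sum; apply: eq_bigr => m _ /=.
  rewrite mcoeffZ -[mon_act _ _ _ _]/(mderivm m P) mcoeff_mderivm addm0.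
  rewrite mulrnAr normCK -{2}Preal mcoeff_map_mpoly; congr (_ *+ _).
  by apply: eq_bigr => i _; rewrite ffactnn.
have := P0; rewrite -msupp_eq0 E; case sE: (msupp P) => [//|m s] _.
have pos m' : 0 <= `|mcoeff m' P| ^+ 2 *+ \prod_(i < N) (m' i)`!.
  by rewrite mulrn_wge0// exprn_ge0.
rewrite big_cons gt_eqF// ltr_pwDl ?sumr_ge0// pmulrn_lgt0.
  by rewrite exprn_gt0// normr_gt0 mcoeff_eq0 sE mem_head.
by rewrite prodn_gt0// => i; exact: fact_gt0.
Qed.

End FischerPairing.

Section DetPowReal.
Variables (K : numClosedFieldType) (k : nat).

Lemma det_pow_real m : map_mpoly (Num.conj : K -> K) (det_pow K k m) = det_pow K k m.
Proof.
rewrite /det_pow.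
transitivity (map_mpoly (Num.conj : K -> K) (\det (pvar_mx K k)) ^+ m).
  exact: rmorphXn.
congr (_ ^+ _); transitivity (\det (map_mx (map_mpoly (Num.conj : K -> K)) (pvar_mx K k))).
  by rewrite det_map_mx.
by congr (\det _); apply/matrixP => p q; rewrite !mxE /pvar map_mpolyX.
Qed.

Lemma meval_det_pow (v : 'I_#|{: 'I_k * 'I_k}| -> K) m :
  meval v (det_pow K k m) = \det (\matrix_(p, q) v (var_idx p q)) ^+ m.
Proof.
rewrite /det_pow rmorphXn -det_map_mx; congr (\det _ ^+ _); apply/matrixP => p q.
by rewrite !mxE; exact: mevalXU.
Qed.

Lemma det_pow_neq0 m : det_pow K k m != 0.
Proof.
apply/eqP => /(congr1 (meval (fun i => ((enum_val i).1 == (enum_val i).2)%:R))).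
rewrite meval_det_pow meval0; apply/eqP; rewrite expf_neq0//.
suff -> : \matrix_(p, q) ((enum_val (@var_idx k p q)).1 ==
    (enum_val (@var_idx k p q)).2)%:R = 1%:M :> 'M[K]_k by rewrite det1 oner_neq0.
by apply/matrixP => p q; rewrite !mxE /var_idx enum_rankK.
Qed.

End DetPowReal.

(** * Computation at the identity modulo flat functions *)

Section Nonvanishing.
Variables (R : realType) (k : nat) (b : bool).
Local Notation C := (Cplx R).
Local Notation G := (GL R (k + k)).
Local Notation S := (smoothGL R (k + k)).
Local Notation y0 := (GLone R (k + k)).
Local Notation low p q := (dleft b (rshift k p) (lshift k q)).
Local Notation poly := (mpoly #|{: 'I_k * 'I_k}| C).
Implicit Types (f g a u : S) (p q r s : 'I_k).

Lemma smooth_detE n (M : 'M[S]_n) y : (\det M : S) y = \det (\matrix_(i, l) M i l y).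
Proof.
rewrite /determinant smooth_sumE; apply: eq_bigr => sg _.
rewrite smoothME smoothXE smoothNE smooth1E smooth_prodE; congr (_ * _).
by apply: eq_bigr => i _; rewrite mxE.
Qed.

Definition flat f : Prop := forall l : seq ('I_k * 'I_k),
  foldr (fun pq g => low pq.1 pq.2 g) f l y0 = 0.

Lemma foldr_low_linear (l : seq ('I_k * 'I_k)) c f g :
  foldr (fun pq g => low pq.1 pq.2 g) (c *: f + g) l =
  c *: foldr (fun pq g => low pq.1 pq.2 g) f l
  + foldr (fun pq g => low pq.1 pq.2 g) g l.
Proof. by elim: l => //= pq l ->; rewrite dleft_linear. Qed.

Lemma flat_linear c f g : flat f -> flat g -> flat (c *: f + g).
Proof.
by move=> ff fg l; rewrite foldr_low_linear smoothDE smoothZE ff fg mulr0 addr0.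
Qed.

Lemma flat0 : flat 0.
Proof.
move=> l; suff -> : foldr (fun pq g => low pq.1 pq.2 g) 0 l = 0 by [].
by elim: l => //= pq l ->; exact: linear0.
Qed.

Lemma flatD f g : flat f -> flat g -> flat (f + g).
Proof. by move=> ff fg; rewrite -[f]scale1r; exact: flat_linear. Qed.

Lemma flatZ c f : flat f -> flat (c *: f).
Proof. by move=> ff; rewrite -[c *: f]addr0; apply: flat_linear => //; exact: flat0. Qed.

Lemma flat_low p q f : flat f -> flat (low p q f).
Proof. by move=> ff l; have := ff (rcons l (p, q)); rewrite foldr_rcons. Qed.

(** By the Leibniz rule on the innermost derivation. Flat functions thus form an ideal stable under
    D, and one may compute modulo it. *)
Lemma flat_mul a f : flat f -> flat (a * f).
Proof.
move=> ff l; elim/last_ind: l a f ff => [|l [p q] IH] a f ff.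
  by rewrite -[LHS]/(a y0 * f y0) (ff [::] : f y0 = 0) mulr0.
rewrite foldr_rcons /= dleftM -[_ * f]scale1r foldr_low_linear scale1r smoothDE.
by rewrite (IH _ _ ff) (IH _ _ (flat_low p q ff)) addr0.
Qed.

Lemma flat_sum (I : Type) (r : seq I) (F : I -> S) :
  (forall i, flat (F i)) -> flat (\sum_(i <- r) F i).
Proof.
by move=> H; apply: big_ind => //; [exact: flat0|move=> f g; exact: flatD].
Qed.

Lemma flat_cst f : (forall p q, low p q f = 0) -> f y0 = 0 -> flat f.
Proof.
move=> f0 fy l; elim/last_ind: l => [//|l [p q] _].
by rewrite foldr_rcons /= f0; exact: (flat0 l).
Qed.

Lemma flat_eq f g : flat (f - g) -> f y0 = g y0.
Proof.
by move=> /(_ [::]) fg; apply/eqP; rewrite -subr_eq0; apply/eqP; exact: fg.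
Qed.

(** Such a function behaves as a constant when D is applied and the result evaluated at the
    identity. *)
Definition flat_const f : Prop := forall p q, flat (low p q f).

Lemma flat_flat_const f : flat f -> flat_const f.
Proof. by move=> ff p q; exact: flat_low. Qed.

Lemma low_flat_const f : (forall p q, low p q f = 0) -> flat_const f.
Proof. by move=> f0 p q; rewrite f0; exact: flat0. Qed.

Lemma flat_constD f g : flat_const f -> flat_const g -> flat_const (f + g).
Proof. by move=> cf cg p q; rewrite linearD; apply: flatD; [exact: cf|exact: cg]. Qed.

Lemma flat_constM f g : flat_const f -> flat_const g -> flat_const (f * g).
Proof.
move=> cf cg p q; rewrite dleftM mulrC; apply: flatD; apply: flat_mul.
  exact: cf.
exact: cg.
Qed.

Lemma dleft1 i l : dleft b i l (1 : S) = 0.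
Proof. exact: (derivation1 (dleftM b i l)). Qed.

Lemma flat_const1 : flat_const 1.
Proof. by apply: low_flat_const => p q; exact: dleft1. Qed.

Lemma flat_constX f n : flat_const f -> flat_const (f ^+ n).
Proof.
move=> cf; elim: n => [|n IH]; first exact: flat_const1.
by rewrite exprS; exact: flat_constM.
Qed.

Lemma flat_const_sum (I : Type) (r : seq I) (F : I -> S) :
  (forall i, flat_const (F i)) -> flat_const (\sum_(i <- r) F i).
Proof.
move=> H; apply: big_ind => //; last by move=> f g; exact: flat_constD.
by apply: flat_flat_const; exact: flat0.
Qed.

Lemma dleft_add i l f g : dleft b i l (f + g) = dleft b i l f + dleft b i l g.
Proof. exact: linearD. Qed.

Lemma dleft_sub i l f g : dleft b i l (f - g) = dleft b i l f - dleft b i l g.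
Proof. exact: linearB. Qed.

Lemma flat_const_det n (M : 'M[S]_n) :
  (forall i l, flat_const (M i l)) -> flat_const (\det M).
Proof.
move=> cM p q; rewrite (derivation_det (@dleft_add _ _) (dleftM b _ _)).
apply: flat_sum => i; apply: flat_sum => l; rewrite mulrC; apply: flat_mul.
exact: cM.
Qed.

(** Differentiating f g = 1 writes the derivative of g as -g^2 times the flat derivative of f. *)
Lemma flat_const_inv f g : f * g = 1 -> flat_const f -> flat_const g.
Proof.
move=> fg cf p q; have := dleft1 (rshift k p) (lshift k q).
rewrite -fg dleftM => /(congr1 (fun u => g * u)); rewrite mulr0 mulrDr mulrA.
rewrite [g * (f * _)]mulrA [g * f]mulrC fg mul1r => /eqP.
rewrite addrC addr_eq0 => /eqP ->.
by rewrite -mulrA mulrCA mulrC -mulNr; apply: flat_mul; exact: cf.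
Qed.

(** Twice f times its derivative is flat, and 2f is invertible. This treats |det y| through |det
    y|^2, which is polynomial in the entries and their conjugates. *)
Lemma flat_const_sqrt f f' g : f * f = g -> f * f' = 1 -> flat_const g -> flat_const f.
Proof.
move=> ffg ff' cg p q; have := cg p q.
rewrite -ffg dleftM mulrC -mulr2n => h.
have half (z : S) : 2^-1 *: (z *+ 2) = z.
  by rewrite -[z *+ 2]scaler_nat scalerA mulVf ?scale1r// pnatr_eq0.
have := flat_mul f' (flatZ 2^-1 h).
by rewrite half mulrA [f' * f]mulrC ff' mul1r.
Qed.

Lemma dleft_entry b' i l i' l' : dleft b i l (entry R b' i' l') =
  if (b == b') && (i == i') then entry R b' l l' else 0 :> S.
Proof.
rewrite /dleft (eq_bigr (fun l1 => if (b == b') && (i == i') && (l' == l1)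
  then entry R b l l1 else 0)) => [|l1 _].
  case: (b =P b') => [<-|_] /=; last by rewrite big1.
  case: (i =P i') => _ /=; last by rewrite big1.
  by rewrite (bigD1 l')//= eqxx big1 ?addr0// => l1; rewrite eq_sym => /negPf ->.
rewrite dwirt_coord mxE; case: (b == b') => /=; last by rewrite mulr0.
rewrite [i' == i]eq_sym; case: (i == i') => /=; last by rewrite cjg0 scale0r mulr0.
case: (l' == l1); first by rewrite cjg1 scale1r mulr1.
by rewrite cjg0 scale0r mulr0.
Qed.

Lemma entry_y0 b' i l : entry R b' i l y0 = (i == l)%:R.
Proof.
rewrite coordE /GLmx /= mxE; case: eqP => _; last by rewrite cjg0.
by rewrite cjg1.
Qed.

(** Infinitesimally, D adds upper rows to lower rows: upper entries are annihilated, and off the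
    diagonal they vanish at the identity. *)
Lemma upper_entry_flat b' q i : lshift k q != i -> flat (entry R b' (lshift k q) i).
Proof.
move=> qi; apply: flat_cst => [p' q'|]; last by rewrite entry_y0 (negPf qi).
by rewrite dleft_entry eq_rlshift andbF.
Qed.

Lemma conj_entry_low i l p q : low p q (entry R (~~ b) i l) = 0.
Proof. by rewrite dleft_entry; case: (b). Qed.

Lemma conj_lower_flat p q : flat (entry R (~~ b) (rshift k p) (lshift k q)).
Proof.
apply: flat_cst => [p' q'|]; first exact: conj_entry_low.
by rewrite entry_y0 eq_rlshift.
Qed.

Lemma entry_right_flat_const i s : flat_const (entry R b i (rshift k s)).
Proof.
move=> p q; rewrite dleft_entry eqxx /=; case: eqP => _; last exact: flat0.
by apply: upper_entry_flat; rewrite eq_lrshift.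
Qed.

(** Adding one row to another does not change a determinant; infinitesimally this is the vanishing
    of an off-diagonal entry of M adj(M). For the other type of entries every single derivative is
    0. *)
Lemma det_low b' p q :
  low p q (\det (\matrix_(i, l) entry R b' i l : 'M[S]_(k + k))) = 0.
Proof.
rewrite (derivation_det (@dleft_add _ _) (dleftM b _ _)).
set M := \matrix_(i, l) _.
have [bb'|/negPf bb'] := eqVneq b b'; last first.
  by rewrite big1// => i _; rewrite big1// => l _; rewrite mxE dleft_entry bb' mul0r.
rewrite (bigD1 (rshift k p))//= [X in _ + X]big1 ?addr0; last first.
  move=> i /negPf ip; rewrite big1// => l _.
  by rewrite mxE dleft_entry [_ == i]eq_sym ip andbF mul0r.
have /matrixP/(_ (lshift k q) (rshift k p)) := mul_mx_adj M.
rewrite mxE [X in _ = X -> _]mxE eq_lrshift mulr0n => E0.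
rewrite -[RHS]E0; apply: eq_bigr => l _.
by rewrite !mxE dleft_entry bb' !eqxx.
Qed.

(** Each derivation falling on [u] produces a flat term, so [u] can be taken out of P(D). *)
Lemma lowpoly_mul_const P a u : flat_const u ->
  flat (lowpoly b P (a * u) - u * lowpoly b P a).
Proof.
move=> cu; elim/lowpoly_ind: P => [|c P1 P2 h1 h2|p q P h].
- by rewrite !lowpoly1 mulrC subrr; exact: flat0.
- rewrite !lowpolyP mulrDr -smoothZAr opprD addrACA -scalerBr.
  exact: (flat_linear c h1 h2).
- rewrite !lowpolyX.
  have -> : low p q (lowpoly b P (a * u)) - u * low p q (lowpoly b P a) =
    low p q (lowpoly b P (a * u) - u * lowpoly b P a) + lowpoly b P a * low p q u.
    have aux (x y z : S) : x - y = x - (z + y) + z by ring.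
    rewrite dleft_sub dleftM [lowpoly b P a * _]mulrC; exact: aux.
  apply: flatD; first exact: flat_low.
  by apply: flat_mul; exact: cu.
Qed.

Definition mul_entry (i : 'I_#|{: 'I_k * 'I_k}|) f : S :=
  entry R b (rshift k (enum_val i).1) (lshift k (enum_val i).2) * f.

Lemma mul_entry_linear i c f g :
  mul_entry i (c *: f + g) = c *: mul_entry i f + mul_entry i g.
Proof. by rewrite /mul_entry mulrDr -smoothZAr. Qed.

HB.instance Definition _ i := GRing.isLinear.Build C S S *:%R (mul_entry i)
  (fun c f g => mul_entry_linear i c f g).

(** The value of [Q] on the lower left block, encoded as [Q] in the commuting multiplication
    operators applied to 1, so that the induction for P(D) serves here too. *)
Definition lower_poly (Q : poly) : S :=
  poly_act (fun i => mul_entry i : {linear S -> S}) Q 1.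

Lemma lower_polyX p q Q : lower_poly (pvar C p q * Q) =
  entry R b (rshift k p) (lshift k q) * lower_poly Q.
Proof.
rewrite /lower_poly /pvar poly_actX; last by move=> i l v; exact: mulrCA.
by rewrite /= /mul_entry /var_idx enum_rankK.
Qed.

Lemma lower_polyP c Q1 Q2 :
  lower_poly (c *: Q1 + Q2) = c *: lower_poly Q1 + lower_poly Q2.
Proof. exact: poly_actP. Qed.

Lemma lower_poly1 : lower_poly 1 = 1.
Proof. exact: poly_act1. Qed.

Lemma lower_polyE Q y : lower_poly Q y = meval (fun i =>
  cjg b (GLmx y (rshift k (enum_val i).1) (lshift k (enum_val i).2))) Q.
Proof.
elim/lowpoly_ind: Q => [|c P1 P2 h1 h2|p q P h].
- by rewrite lower_poly1 meval1.
- by rewrite lower_polyP mevalD mevalZ smoothDE smoothZE h1 h2.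
- by rewrite lower_polyX smoothME coordE h mevalM mevalXU /var_idx enum_rankK.
Qed.

(** D_pq sends the entry (p, q') of the lower left block to the entry (q, q') of the upper left
    block, which modulo flat functions is 1 or 0 according to q = q'. So D_pq acts as the partial
    derivative by x_pq. *)
Lemma low_lower_poly p q Q :
  flat (low p q (lower_poly Q) - lower_poly (pder p q Q)).
Proof.
elim/lowpoly_ind: Q => [|c P1 P2 h1 h2|p' q' P h].
- rewrite lower_poly1 dleft1 (derivation1 (pderM p q)) /lower_poly poly_act0 subr0.
  exact: flat0.
- rewrite lower_polyP pderD pderZ lower_polyP dleft_linear opprD addrACA -scalerBr.
  exact: (flat_linear c h1 h2).
- rewrite lower_polyX dleftM pderM pder_var dleft_entry eqxx eq_shift /=.
  set z := entry R b (rshift k p') _; set D := if _ then 1 else _.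
  have -> : lower_poly (D * P + pvar C p' q' * pder p q P) =
      lower_poly (D * P) + z * lower_poly (pder p q P).
    by rewrite -[D * P]scale1r lower_polyP !scale1r lower_polyX.
  rewrite opprD addrACA -mulrBr; apply: flatD; last exact: flat_mul.
  rewrite /D; case: (p == p') => /=; last first.
    by rewrite !mul0r /lower_poly poly_act0 subr0; exact: flat0.
  case: (eqVneq q q') => [<-|qq'].
    rewrite mul1r -[X in _ - X]mul1r -mulrBl mulrC; apply: flat_mul.
    (* A diagonal entry of the upper left block minus 1: annihilated by D and zero at the
       identity. *)
    apply: flat_cst => [p1 q1|].
      by rewrite dleft_sub dleft_entry eq_rlshift andbF dleft1 subr0.
    by rewrite smoothDE smoothNE smooth1E entry_y0 eqxx subrr.
  rewrite mul0r /lower_poly poly_act0 subr0 mulrC; apply: flat_mul.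
  by apply: upper_entry_flat; rewrite eq_shift.
Qed.

Definition diff_poly (P Q : poly) : poly :=
  poly_act (fun i => mderiv i : {linear poly -> poly}) P Q.

Lemma lowpoly_lower_poly P Q :
  flat (lowpoly b P (lower_poly Q) - lower_poly (diff_poly P Q)).
Proof.
elim/lowpoly_ind: P => [|c P1 P2 h1 h2|p q P h].
- by rewrite lowpoly1 /diff_poly poly_act1 subrr; exact: flat0.
- rewrite lowpolyP /diff_poly poly_actP lower_polyP opprD addrACA -scalerBr.
  exact: (flat_linear c h1 h2).
- have -> : diff_poly (pvar C p q * P) Q = pder p q (diff_poly P Q).
    by rewrite /diff_poly /pvar poly_actX// => i l v; exact: mderiv_comm.
  rewrite lowpolyX.
  have -> : low p q (lowpoly b P (lower_poly Q)) - lower_poly (pder p q (diff_poly P Q)) =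
    low p q (lowpoly b P (lower_poly Q) - lower_poly (diff_poly P Q))
    + (low p q (lower_poly (diff_poly P Q)) - lower_poly (pder p q (diff_poly P Q))).
    by rewrite dleft_sub addrA subrK.
  by apply: flatD; [exact: flat_low|exact: low_lower_poly].
Qed.

End Nonvanishing.

(** * An explicit vector of the source with nonzero image *)

Section TestFunction.
Variables (R : realType) (k : nat) (b : bool) (m : nat) (j : int).
Local Notation C := (Cplx R).
Local Notation G := (GL R (k + k)).
Local Notation S := (smoothGL R (k + k)).
Local Notation y0 := (GLone R (k + k)).
Implicit Types (p q r s : 'I_k) (x y : G).

Lemma hermitian_norm_eq0 (l : nat) (w : 'rV[C]_l) :
  w *m (map_mx Num.conj w)^T = 0 -> w = 0.
Proof.
move=> /matrixP/(_ 0 0); rewrite mxE [RHS]mxE.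
rewrite (eq_bigr (fun i => `|w 0 i| ^+ 2)) => [|i _]; last first.
  by rewrite normCK !mxE.
move/psumr_eq0P => w0; apply/rowP => i; rewrite [RHS]mxE.
apply/eqP; rewrite -normr_eq0 -sqrf_eq0; apply/eqP; by apply: w0.
Qed.

Lemma gram_matrixE (n l : nat) (A : 'M[C]_(n, l)) :
  \matrix_(p, q) \sum_i A p i * Num.conj (A q i) = A *m (map_mx Num.conj A)^T.
Proof.
by apply/matrixP => p q; rewrite !mxE; apply: eq_bigr => i _; rewrite !mxE.
Qed.

Lemma gram_det_neq0 (n l : nat) (A : 'M[C]_(n, l)) :
  (forall v : 'rV_n, v *m A = 0 -> v = 0) ->
  \det (\matrix_(p, q) \sum_i A p i * Num.conj (A q i)) != 0.
Proof.
move=> A0; rewrite gram_matrixE; apply/det0P => -[v v0 vA].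
move/eqP: v0; apply; apply: A0; apply: hermitian_norm_eq0.
by rewrite map_mxM trmx_mul mulmxA -[v *m A *m _]mulmxA vA mul0mx.
Qed.

Definition full_det b' : S := \det (\matrix_(i, l) entry R b' i l : 'M[S]_(k + k)).

Lemma full_detE b' y : full_det b' y = cjg b' (\det (GLmx y)).
Proof.
rewrite smooth_detE cjg_det; congr (\det _); apply/matrixP => i l.
by rewrite !mxE coordE.
Qed.

Lemma rsmooth_abs_det : rsmooth (fun y : G => `|\det (GLmx y)| : C).
Proof.
apply: (rsmooth_sqrt (u := full_det false * full_det true)).
- have cd : continuous (fun y : G => \det (GLmx y) : C).
    have -> : (fun y : G => \det (GLmx y) : C) = full_det false.
      by apply/funext => y; rewrite full_detE.
    exact/rsmooth_continuous/smoothP.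
  move=> y; have Fy : Filter (nbhs y) by exact: nbhs_filter.
  apply/cplx_cvgP => e e0; have /cplx_cvgP/(_ e e0) := cd y.
  apply: filterS => z h; rewrite !cabsE; apply: le_lt_trans h.
  by rewrite -ofrealN -ofrealD cabs_ofreal; exact: cabs_lipschitz.
- by move=> y; rewrite normr_gt0; have := GLmx_unit y; rewrite unitmxE unitfE.
- by move=> y; rewrite smoothME !full_detE /= normCK.
- exact: smoothP.
Qed.

Definition abs_det : S := mk_smooth rsmooth_abs_det.

Definition right_det b' : S :=
  \det (\matrix_(p, s) entry R b' (rshift k p) (rshift k s) : 'M[S]_k).

Lemma right_detE b' y : right_det b' y = cjg b' (\det (drsubmx (GLmx y))).
Proof.
rewrite smooth_detE cjg_det; congr (\det _); apply/matrixP => p s.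
by rewrite !mxE coordE.
Qed.

Definition gram : S := \det (\matrix_(p, q)
  \sum_l entry R b (rshift k p) l * entry R (~~ b) (rshift k q) l : 'M[S]_k).

Lemma cjgN b' (z : C) : cjg (~~ b') z = Num.conj (cjg b' z).
Proof. by case: b' => //=; rewrite conjCK. Qed.

Lemma gramE y : gram y = \det (\matrix_(p, q) \sum_l
  (map_mx (cjg b) (dsubmx (GLmx y))) p l *
  Num.conj ((map_mx (cjg b) (dsubmx (GLmx y))) q l)).
Proof.
rewrite smooth_detE; congr (\det _); apply/matrixP => p q; rewrite !mxE smooth_sumE.
by apply: eq_bigr => l _; rewrite smoothME !coordE !mxE cjgN.
Qed.

Lemma gram_neq0 y : gram y != 0.
Proof.
rewrite gramE; apply: gram_det_neq0 => v vA.
have uY : map_mx (cjg b) (GLmx y) \in unitmx.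
  by rewrite unitmxE unitfE -cjg_det cjg_eq0; have := GLmx_unit y;
    rewrite unitmxE unitfE.
(* A linear relation between the rows of the lower half extends by zero to one between the rows of
   an invertible matrix. *)
have : row_mx 0 v *m map_mx (cjg b) (GLmx y) = 0.
  rewrite -[map_mx _ (GLmx y)]vsubmxK mul_row_col mul0mx add0r -[RHS]vA.
  by congr (_ *m _); apply/matrixP => p l; rewrite !mxE.
move/(congr1 (fun M => M *m invmx (map_mx (cjg b) (GLmx y)))).
rewrite mul0mx -mulmxA mulmxV// mulmx1 => /(congr1 rsubmx).
by rewrite row_mxKr linear0.
Qed.

Definition gram_inv : S := mk_smooth (rsmoothV gram_neq0 (@smoothP _ _ gram)).

(** The determinant of Z2 may vanish, so only natural exponents of it are allowed: e = j + |j| is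
    one for either sign of j, and the surplus |j| is matched on the conjugate factor and removed by
    the Gram determinant. *)
Let c : nat := absz j.
Let e : nat := absz (j + (absz j)%:Z).

Lemma test_exponent : e%:Z = j + c%:Z.
Proof. by rewrite /e /c; lia. Qed.

Definition test_weight : S :=
  abs_det ^+ k * (right_det b ^+ c * (right_det (~~ b) ^+ e * gram_inv ^+ (k + c))).

Definition test_fun : S := lower_poly b (det_pow C k m) * test_weight.

Lemma lower_poly_det_pow y : lower_poly b (det_pow C k m) y =
  cjg b (\det (dlsubmx (GLmx y))) ^+ m.
Proof.
rewrite lower_polyE meval_det_pow cjg_det; congr (\det _ ^+ _).
by apply/matrixP => p q; rewrite !mxE /var_idx enum_rankK.
Qed.

Lemma sqrtC_modulus (a d : GL R k) : sqrtC (modulus a d) =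
  `|\det (GLmx a)| ^+ k * (`|\det (GLmx d)| ^+ k)^-1.
Proof.
rewrite /modulus /nu -!normCK -!exprM ![(2 * k)%N]mulnC !exprM -exprVn -exprMn.
by rewrite sqrCK// mulr_ge0// ?invr_ge0 exprn_ge0.
Qed.

Lemma gram_mul (a d : GL R k) B y : gram (ublock a d B * y)%g =
  cjg b (\det (GLmx d)) * cjg (~~ b) (\det (GLmx d)) * gram y.
Proof.
rewrite !gramE; set A := map_mx (cjg b) (dsubmx (GLmx y)).
have -> : map_mx (cjg b) (dsubmx (GLmx (ublock a d B * y)%g)) =
    map_mx (cjg b) (GLmx d) *m A.
  rewrite GLmxM -[GLmx y]submxK [GLmx (ublock _ _ _)]/(block_mx _ _ _ _) mulmx_block.
  rewrite /block_mx col_mxKd !mul0mx !add0r -mul_mx_row /A.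
  have -> : dsubmx (GLmx y) = row_mx (dlsubmx (GLmx y)) (drsubmx (GLmx y)).
    by rewrite hsubmxK.
  apply/matrixP => p l; rewrite !mxE (big_morph _ (@cjgD R b) (@cjg0 R b)).
  by apply: eq_bigr => q _; rewrite cjgM !mxE.
rewrite !gram_matrixE map_mxM trmx_mul mulmxA -[X in \det (X *m _)]mulmxA !det_mulmx.
have dc (M : 'M[C]_k) : \det (map_mx Num.conj M) = Num.conj (\det M).
  by rewrite det_map_mx.
by rewrite det_tr dc -cjg_det -cjgN mulrAC.
Qed.

Lemma test_fun_equivariant : left_equivariant (source_char b m j) test_fun.
Proof.
move=> a d B y; have yE := submxK (GLmx y).
have xyE : GLmx (ublock a d B * y)%g = block_mx
    (GLmx a *m ulsubmx (GLmx y) + B *m dlsubmx (GLmx y))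
    (GLmx a *m ursubmx (GLmx y) + B *m drsubmx (GLmx y))
    (GLmx d *m dlsubmx (GLmx y)) (GLmx d *m drsubmx (GLmx y)).
  rewrite GLmxM -{1}yE [GLmx (ublock _ _ _)]/(block_mx _ _ _ _) mulmx_block.
  by rewrite !mul0mx !add0r.
have detx : \det (GLmx (ublock a d B * y)%g) =
    \det (GLmx a) * \det (GLmx d) * \det (GLmx y).
  by rewrite GLmxM det_mulmx [GLmx (ublock _ _ _)]/(block_mx _ _ _ _) det_ublock.
rewrite /test_fun /test_weight !smoothME !smoothXE !lower_poly_det_pow !right_detE.
rewrite !mk_smoothE gram_mul detx xyE block_mxKdl block_mxKdr !det_mulmx !cjgM.
rewrite /source_char sqrtC_modulus !normrM !exprMn.
have a0 : \det (GLmx a) != 0 := GL_det_neq0 a.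
have d0 : \det (GLmx d) != 0 := GL_det_neq0 d.
have D0 : cjg b (\det (GLmx d)) != 0 by rewrite cjg_eq0.
have D'0 : cjg (~~ b) (\det (GLmx d)) != 0 by rewrite cjg_eq0.
have nd : cjg b (\det (GLmx d)) * cjg (~~ b) (\det (GLmx d)) = `|\det (GLmx d)| ^+ 2.
  by rewrite normCK cjgN; case: (b) => //=; rewrite conjCK mulrC.
have De : cjg (~~ b) (\det (GLmx d)) ^+ e =
    cjg (~~ b) (\det (GLmx d)) ^ j * cjg (~~ b) (\det (GLmx d)) ^+ c.
  by rewrite -[LHS]/(_ ^ e%:Z) test_exponent expfzDr.
(* The Gram determinant scales by |det d|^2. Its k-th power turns |det a det d|^k into the square
   root of the modulus, and its c-th power removes the auxiliary c-th powers of det d and its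
   conjugate. *)
rewrite De; have -> : ((cjg b (\det (GLmx d)) * cjg (~~ b) (\det (GLmx d)) * gram y)^-1)
     ^+ (k + c) = ((`|\det (GLmx d)| ^+ k) ^+ 2)^-1
     * (cjg b (\det (GLmx d)) ^+ c)^-1 * (cjg (~~ b) (\det (GLmx d)) ^+ c)^-1
     * (gram y)^-1 ^+ (k + c).
  rewrite invfM exprMn; congr (_ * _); rewrite exprD {1}nd exprVn -!exprM mulnC.
  by rewrite -mulrA; congr (_ * _); rewrite invfM exprMn !exprVn.
have := expf_neq0 k (lt0r_neq0 (_ : 0 < `|\det (GLmx d)|)).
rewrite normr_gt0 => /(_ d0); have := expf_neq0 c D0; have := expf_neq0 c D'0.
move: (cjg b _ ^+ c) (cjg (~~ b) (\det (GLmx d)) ^+ c) (`|\det (GLmx d)| ^+ k).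
move=> u1 u2 u3 h2 h1 h3.
move: (cjg (~~ b) (\det (GLmx d)) ^ j) ((gram y)^-1 ^+ _) => u4 u5.
by field; rewrite h1 h2 h3.
Qed.

Lemma test_weight_flat_const : flat_const b test_weight.
Proof.
have n0 y : `|\det (GLmx y)| != 0 :> C.
  by rewrite normr_eq0; have := GLmx_unit y; rewrite unitmxE unitfE.
apply: flat_constM; first apply: flat_constX.
  apply: (@flat_const_sqrt R k b abs_det (mk_smooth (rsmoothV n0 rsmooth_abs_det))
    (full_det b * full_det (~~ b))).
  - apply: smooth_ext => y; rewrite !smoothME !full_detE mk_smoothE -expr2 normCK cjgN.
    by case: (b) => //=; rewrite conjCK mulrC.
  - apply: smooth_ext => y; rewrite smoothME smooth1E !mk_smoothE mulfV//; exact: n0.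
  - by apply: flat_constM; apply: low_flat_const => p q; exact: det_low.
apply: flat_constM; first apply: flat_constX.
  apply: flat_const_det => p s; rewrite mxE; exact: entry_right_flat_const.
apply: flat_constM; apply: flat_constX.
  apply: flat_const_det => p s; rewrite mxE; apply: low_flat_const => p' q'.
  exact: conj_entry_low.
apply: (@flat_const_inv R k b gram).
  by apply: smooth_ext => y; rewrite smoothME smooth1E mk_smoothE mulfV ?gram_neq0.
(* In the left half of the sum the conjugated factor is itself flat; in the right half both factors
   are constant modulo flat functions. *)
apply: flat_const_det => p q; rewrite mxE big_split_ord.
apply: flat_constD; apply: flat_const_sum => l.
  by apply/flat_flat_const/flat_mul/conj_lower_flat.
apply: flat_constM; first exact: entry_right_flat_const.
by apply: low_flat_const => p' q'; exact: conj_entry_low.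
Qed.

Lemma test_weight_y0 : test_weight y0 != 0.
Proof.
have r0 b' : right_det b' y0 = 1.
  rewrite right_detE /GLmx /= [1%:M]scalar_mx_block block_mxKdr det1.
  exact: cjg1.
rewrite /test_weight !smoothME !smoothXE !r0 !expr1n !mul1r mulf_neq0// expf_neq0//.
  by rewrite mk_smoothE normr_eq0; have := GLmx_unit y0; rewrite unitmxE unitfE.
by rewrite mk_smoothE invr_neq0// gram_neq0.
Qed.

(** The lower left block of the identity is 0, so the value is the nonzero weight times the constant
    term of P(d) P, where P = det^m. *)
Lemma det_op_test_fun : det_op b m test_fun y0 != 0.
Proof.
set P := det_pow C k m; rewrite /det_op -/P.
have E : lowpoly b P test_fun y0 = test_weight y0 * lowpoly b P (lower_poly b P) y0.
  exact: flat_eq (lowpoly_mul_const P (lower_poly b P) test_weight_flat_const).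
rewrite E mulf_neq0 ?test_weight_y0//.
rewrite (flat_eq (lowpoly_lower_poly b P P)).
have z0 : (fun i : 'I_#|{: 'I_k * 'I_k}| => cjg b (GLmx y0 (rshift k (enum_val i).1)
    (lshift k (enum_val i).2))) = fun=> 0.
  by apply/funext => i; rewrite /GLmx /= mxE eq_rlshift; exact: cjg0.
rewrite lower_polyE z0.
rewrite meval0_mcoeff0; apply: Fischer_neq0; first exact: det_pow_real.
exact: det_pow_neq0.
Qed.

Lemma test_fun_induced : (test_fun : G -> C) \in induced_pred (@triv R k)
  (fun x : GL R k => cjg b (\det (GLmx x)) ^ m%:Z * cjg (~~ b) (\det (GLmx x)) ^ j).
Proof.
apply/asboolP; split; first exact: smoothP.
by move=> a d B y; rewrite /triv mul1r; exact: test_fun_equivariant.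
Qed.

Lemma exists_intertwiner : exists T : {linear source_rep R k b m j -> target_rep R k b m j},
  intertwining T /\ exists f, T f <> 0.
Proof.
exists (@det_intertwiner R k b m j); split; first exact: det_intertwiner_intertwining.
exists (IndRep test_fun_induced) => T0.
have /eqP := det_op_test_fun; apply.
have := congr1 (fun u : target_rep R k b m j => induced_fun u y0) T0.
rewrite /= -[RHS]/(0 : C) => <-.
by congr (smooth_fun (det_op _ _ _) _); exact: smooth_ext.
Qed.

End TestFunction.

Theorem proposition1p5 (R : realType) (k : nat) (k_gt0 : (0 < k)%N)
    (i j : int) (i_gt0 : 0 < i) :
  (exists T : {linear
       ind_rep (@triv R k) (fun x : GL R k => delta x ^ i * deltabar x ^ j) ->
       ind_rep (fun x : GL R k => delta x ^ i) (fun x : GL R k => deltabar x ^ j)},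
     intertwining T /\ exists f, T f <> 0) /\
  (exists T : {linear
       ind_rep (@triv R k) (fun x : GL R k => deltabar x ^ i * delta x ^ j) ->
       ind_rep (fun x : GL R k => deltabar x ^ i) (fun x : GL R k => delta x ^ j)},
     intertwining T /\ exists f, T f <> 0).
Proof.
(* A positive integer is a natural number [m], the number of factors det(D) in the operator; the two
   claims are the two values of [b]. *)
case: i i_gt0 => // m _; split.
- exact: (@exists_intertwiner R k false m j).
- exact: (@exists_intertwiner R k true m j).
Qed.
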